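(* Suppose that the standing assumptions (1)-(3) of the context hold and that $\bar a_2\neq0$ and $\bar b_2\neq0$, where $$\bar a_2=-\int_{-\infty}^\infty\partial_2\partial_\mu F(U_0(x)^2,0;0)V_1(x)^2\,dx,$$ $$\bar b_2=-2\int_{-\infty}^\infty\partial_1\partial_2F(U_0(x)^2,0;0)U_0(x)U_2(x)V_1(x)^2\,dx-\int_{-\infty}^\infty\partial_2^2F(U_0(x)^2,0;0)V_1(x)^4\,dx.$$ Then a pitchfork bifurcation of the fundamental solitary wave $(e^{i\omega t}U_0(x),0)$ occurs at $\mu=0$. In addition, it is supercritical or subcritical, depending on whether $\bar a_2\bar b_2<0$ or $\bar a_2\bar b_2>0$. Moreover, the bifurcated solitary waves are written as $$(u(t,x),v(t,x))=(e^{i\omega t}U_\epsilon(x),e^{ist}V_\epsilon(x))$$ with $$U_\epsilon(x)=U_0(x)+\epsilon^2U_2(x)+O(\epsilon^4),\qquad V_\epsilon(x)=\pm(\epsilon V_1(x)+O(\epsilon^3)),$$ where $\epsilon>0$ is a small parameter such that $\mu=\bar\mu\,\epsilon^2$ with $\bar\mu:=-\bar b_2/\bar a_2$.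
   Context: Setting. Fix real constants $\omega,s>0$ and a function $F:\mathbb R\times\mathbb R\times\mathbb R\to\mathbb R$, $(\zeta_1,\zeta_2,\mu)\mapsto F(\zeta_1,\zeta_2;\mu)$, with real parameter $\mu$; $\partial_jF$ ($j=1,2$) is the derivative in the $j$-th argument. The coupled nonlinear Schrödinger (CNLS) equations are $$i\partial_tu+\partial_x^2u+\partial_1F(|u|^2,|v|^2;\mu)u=0,\quad i\partial_tv+\partial_x^2v+\partial_2F(|u|^2,|v|^2;\mu)v=0.$$ A real-valued solution $(U,V)$, with $U(x),V(x)\to0$ as $x\to\pm\infty$ (a homoclinic solution), of the stationary system $$-U''+\omega U-\partial_1F(U^2,V^2;\mu)U=0,\quad -V''+sV-\partial_2F(U^2,V^2;\mu)V=0$$ gives the solitary wave $(e^{i\omega t}U(x),e^{ist}V(x))$. Standing assumptions. (1) $F$ is $C^3$ and $F(0,0;\mu)=\partial_1F(0,0;\mu)=\partial_2F(0,0;\mu)=0$, $\partial_\mu F(\zeta,0;\mu)=0$ for all $\zeta,\mu\in\mathbb R$. One writes $\partial_1^jF(\zeta,0)$ for $\partial_1^jF(\zeta,0;\mu)$. (2) $-U''+\omega U-\partial_1F(U^2,0)U=0$ has a homoclinic solution $U_0\not\equiv0$ with $\lim_{x\to\pm\infty}U_0(x)=0$ and $U_0'(0)=0$; it is taken positive, even, with $U_0'(x)<0$ for $x>0$. (3) At $\mu=0$ the equation $-\delta V''+s\,\delta V-\partial_2F(U_0(x)^2,0;0)\delta V=0$ has a nonzero bounded solution $\delta V=V_1(x)$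 with $\lim_{x\to\pm\infty}V_1(x)=0$. The function $U_2$ is $$U_2(x)=-\phi_{11}(x)\int_x^\infty\phi_{12}(y)g(y)\,dy-\phi_{12}(x)\int_0^x\phi_{11}(y)g(y)\,dy,\quad g=\partial_1\partial_2F(U_0^2,0;0)U_0V_1^2,$$ where $\phi_{11},\phi_{12}$ solve $-\phi''+\omega\phi-\bigl(2\partial_1^2F(U_0^2,0)U_0^2+\partial_1F(U_0^2,0)\bigr)\phi=0$ with $\phi_{11}(0)=1,\phi_{11}'(0)=0$, $\phi_{12}(0)=0,\phi_{12}'(0)=1$. Terminology. ''Pitchfork bifurcation at $\mu=0$'' means that, besides the branch $(U_0,0)$ existing for all $\mu$, a pair of homoclinic solutions of the stationary system with nonzero $V$-components $\pm V$ (which give the same family of solitary waves up to phase) is born from $(U_0,0)$ at $\mu=0$. It is supercritical if the pair exists for small $\mu>0$ and subcritical if it exists for small $\mu<0$. *)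

(* Defs.v *)
From Stdlib Require Import Reals.
From Coquelicot Require Import Coquelicot.
Open Scope R_scope.

(* [F z1 z2 mu]; the parameter mu is the third argument. *)
Definition D1 (F : R -> R -> R -> R) : R -> R -> R -> R :=
  fun z1 z2 mu => Derive (fun z => F z z2 mu) z1.
Definition D2 (F : R -> R -> R -> R) : R -> R -> R -> R :=
  fun z1 z2 mu => Derive (fun z => F z1 z mu) z2.
Definition Dmu (F : R -> R -> R -> R) : R -> R -> R -> R :=
  fun z1 z2 mu => Derive (fun m => F z1 z2 m) mu.

Definition jointly_continuous (F : R -> R -> R -> R) : Prop :=
  forall p : R * R * R,
    continuous (fun q : R * R * R => F (fst (fst q)) (snd (fst q)) (snd q)) p.

Fixpoint of_class_C (k : nat) (F : R -> R -> R -> R) : Prop :=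
  jointly_continuous F /\
  match k with
  | O => True
  | S k' =>
      (forall z1 z2 mu,
          ex_derive (fun z => F z z2 mu) z1 /\
          ex_derive (fun z => F z1 z mu) z2 /\
          ex_derive (fun m => F z1 z2 m) mu) /\
      of_class_C k' (D1 F) /\ of_class_C k' (D2 F) /\ of_class_C k' (Dmu F)
  end.

(* Both clauses are needed: [ex_derive_n f 2 x] only asserts that the total
   function [Derive f] is differentiable at [x]. *)
Definition twice_derivable (f : R -> R) : Prop :=
  forall x, ex_derive_n f 1 x /\ ex_derive_n f 2 x.

Definition vanishes_at_infinity (f : R -> R) : Prop :=
  is_lim f p_infty 0 /\ is_lim f m_infty 0.

Definition nontrivial (f : R -> R) : Prop := exists x, f x <> 0.

(** * The CNLS equations *)

Definition cnls_solution (F : R -> R -> R -> R) (mu : R) (u v : R -> R -> C)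
  : Prop :=
  exists ut ux uxx vt vx vxx : R -> R -> C,
  forall t x : R,
    @is_derive R_AbsRing C_R_NormedModule (fun t' => u t' x) t (ut t x) /\
    @is_derive R_AbsRing C_R_NormedModule (fun x' => u t x') x (ux t x) /\
    @is_derive R_AbsRing C_R_NormedModule (fun x' => ux t x') x (uxx t x) /\
    @is_derive R_AbsRing C_R_NormedModule (fun t' => v t' x) t (vt t x) /\
    @is_derive R_AbsRing C_R_NormedModule (fun x' => v t x') x (vx t x) /\
    @is_derive R_AbsRing C_R_NormedModule (fun x' => vx t x') x (vxx t x) /\
    (Ci * ut t x + uxx t x
      + RtoC (D1 F (Cmod (u t x) ^ 2) (Cmod (v t x) ^ 2) mu) * u t x)%C
      = RtoC 0 /\
    (Ci * vt t x + vxx t x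
      + RtoC (D2 F (Cmod (u t x) ^ 2) (Cmod (v t x) ^ 2) mu) * v t x)%C
      = RtoC 0.

(* e^{i theta} for real theta *)
Definition expi (theta : R) : C := (cos theta, sin theta).

Definition standing_wave (freq : R) (U : R -> R) : R -> R -> C :=
  fun t x => (expi (freq * t) * RtoC (U x))%C.

(** * The stationary system *)

Definition stationary_solution (F : R -> R -> R -> R) (omega s mu : R)
    (U V : R -> R) : Prop :=
  twice_derivable U /\ twice_derivable V /\
  forall x,
    - Derive_n U 2 x + omega * U x - D1 F (U x ^ 2) (V x ^ 2) mu * U x = 0 /\
    - Derive_n V 2 x + s * V x - D2 F (U x ^ 2) (V x ^ 2) mu * V x = 0.

Definition homoclinic_solution (F : R -> R -> R -> R) (omega s mu : R)
    (U V : R -> R) : Prop :=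
  stationary_solution F omega s mu U V /\
  vanishes_at_infinity U /\ vanishes_at_infinity V.

(** * Standing assumptions *)

Definition nonlinearity_assumption (F : R -> R -> R -> R) : Prop :=
  of_class_C 3 F /\
  (forall mu, F 0 0 mu = 0 /\ D1 F 0 0 mu = 0 /\ D2 F 0 0 mu = 0) /\
  (forall z mu, Dmu F z 0 mu = 0).

(* F(z,0;mu) does not depend on mu under [nonlinearity_assumption], so that
   the z1-derivatives at z2 = 0 are written with mu = 0, here and below. *)
Definition fundamental_assumption (F : R -> R -> R -> R) (omega : R)
    (U0 : R -> R) : Prop :=
  twice_derivable U0 /\
  (forall x, - Derive_n U0 2 x + omega * U0 x - D1 F (U0 x ^ 2) 0 0 * U0 x = 0) /\
  vanishes_at_infinity U0 /\
  Derive U0 0 = 0 /\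
  (forall x, 0 < U0 x) /\
  (forall x, U0 (- x) = U0 x) /\
  (forall x, 0 < x -> Derive U0 x < 0).

Definition kernel_assumption (F : R -> R -> R -> R) (s : R)
    (U0 V1 : R -> R) : Prop :=
  twice_derivable V1 /\
  (forall x, - Derive_n V1 2 x + s * V1 x - D2 F (U0 x ^ 2) 0 0 * V1 x = 0) /\
  nontrivial V1 /\
  (exists M, forall x, Rabs (V1 x) <= M) /\
  vanishes_at_infinity V1.

(** * The second-order profile and the bifurcation coefficients *)

Definition linearized_U_solution (F : R -> R -> R -> R) (omega : R)
    (U0 phi : R -> R) : Prop :=
  twice_derivable phi /\
  forall x,
    - Derive_n phi 2 x + omega * phi x
      - (2 * D1 (D1 F) (U0 x ^ 2) 0 0 * U0 x ^ 2 + D1 F (U0 x ^ 2) 0 0) * phi x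
    = 0.

Definition fundamental_pair (F : R -> R -> R -> R) (omega : R)
    (U0 phi11 phi12 : R -> R) : Prop :=
  linearized_U_solution F omega U0 phi11 /\
  phi11 0 = 1 /\ Derive phi11 0 = 0 /\
  linearized_U_solution F omega U0 phi12 /\
  phi12 0 = 0 /\ Derive phi12 0 = 1.

Definition int_line (f : R -> R) : R :=
  RInt_gen f (Rbar_locally m_infty) (Rbar_locally p_infty).

Definition U2 (F : R -> R -> R -> R) (U0 V1 phi11 phi12 : R -> R) : R -> R :=
  let g := fun y => D1 (D2 F) (U0 y ^ 2) 0 0 * U0 y * V1 y ^ 2 in
  fun x =>
    - phi11 x
        * RInt_gen (fun y => phi12 y * g y) (at_point x) (Rbar_locally p_infty)
    - phi12 x * RInt (fun y => phi11 y * g y) 0 x.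

Definition a2bar (F : R -> R -> R -> R) (U0 V1 : R -> R) : R :=
  - int_line (fun x => D2 (Dmu F) (U0 x ^ 2) 0 0 * V1 x ^ 2).

Definition b2bar (F : R -> R -> R -> R) (U0 V1 phi11 phi12 : R -> R) : R :=
  - 2 * int_line (fun x =>
          D1 (D2 F) (U0 x ^ 2) 0 0 * U0 x * U2 F U0 V1 phi11 phi12 x * V1 x ^ 2)
  - int_line (fun x => D2 (D2 F) (U0 x ^ 2) 0 0 * V1 x ^ 4).

(** * Pitchfork bifurcation *)

Definition unif_close (r : R) (f g : R -> R) : Prop :=
  forall x, Rabs (f x - g x) <= r.

(* [(Ub mu, Vb mu)] and [(Ub mu, - Vb mu)], for small mu with [side mu], form
   the pair born from [(U0, 0)] at mu = 0: it tends to [(U0, 0)] as mu -> 0,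
   and for small mu every homoclinic solution near [(U0, 0)] with nonzero
   V-component is a member of the pair, in particular there is none off
   [side].  Translations in x, which preserve the stationary system, have to
   be factored out. *)
Definition bifurcating_pair (F : R -> R -> R -> R) (omega s : R)
    (U0 : R -> R) (side : R -> Prop) (Ub Vb : R -> R -> R) : Prop :=
  (exists mu0, 0 < mu0 /\
     forall mu, Rabs mu < mu0 -> side mu ->
       homoclinic_solution F omega s mu (Ub mu) (Vb mu) /\
       homoclinic_solution F omega s mu (Ub mu) (fun x => - Vb mu x) /\
       nontrivial (Vb mu)) /\
  (forall r, 0 < r -> exists delta, 0 < delta /\
     forall mu, Rabs mu < delta -> side mu ->
       unif_close r (Ub mu) U0 /\ unif_close r (Vb mu) (fun _ => 0)) /\
  (exists r mu1, 0 < r /\ 0 < mu1 /\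
     forall mu U V, Rabs mu < mu1 ->
       homoclinic_solution F omega s mu U V -> nontrivial V ->
       unif_close r U U0 -> unif_close r V (fun _ => 0) ->
       side mu /\
       exists tau,
         (forall x, U x = Ub mu (x + tau)) /\
         ((forall x, V x = Vb mu (x + tau)) \/
          (forall x, V x = - Vb mu (x + tau)))).

Definition pitchfork_on (F : R -> R -> R -> R) (omega s : R) (U0 : R -> R)
    (side : R -> Prop) : Prop :=
  (forall mu, homoclinic_solution F omega s mu U0 (fun _ => 0)) /\
  exists Ub Vb, bifurcating_pair F omega s U0 side Ub Vb.

Definition supercritical_pitchfork (F : R -> R -> R -> R) (omega s : R)
    (U0 : R -> R) : Prop :=
  pitchfork_on F omega s U0 (fun mu => 0 < mu).

Definition subcritical_pitchfork (F : R -> R -> R -> R) (omega s : R)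
    (U0 : R -> R) : Prop :=
  pitchfork_on F omega s U0 (fun mu => mu < 0).

Definition pitchfork_bifurcation (F : R -> R -> R -> R) (omega s : R)
    (U0 : R -> R) : Prop :=
  supercritical_pitchfork F omega s U0 \/ subcritical_pitchfork F omega s U0.

(* Main.v *)
Require Import Defs.
From Stdlib Require Import Reals Lra Lia Psatz FunctionalExtensionality ClassicalEpsilon.
From Coquelicot Require Import Coquelicot.
Open Scope R_scope.

(* Lyapunov-Schmidt reduction in the space of bounded continuous functions.  Both
   linearized operators -d^2 + m(x) at (U0, 0) have a one-dimensional bounded kernel,
   spanned by phi12 (a multiple of U0') and by V1, and a bounded right inverse given by
   variation of constants.  For fixed (a, mu) a contraction solves the two equations
   up to multiples l1 phi12 and l2 V1 of the kernel elements, where a is the amplitude of V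
   along V1 and the phase condition W'(0) = 0 on W = U - U0 removes translations.
   Comparing two such solutions, with amplitudes a and a', gives both the expansions
   (a' = 0) and
     n (l2 - l2') = - (a - a') (b2 (a^2 + a a' + a'^2) + a2 mu) + h.o.t.,  n = int V1^2,
   hence the nonzero zeros of l2 are a = +- eps + O(eps^3) for mu = - (b2 / a2) eps^2, they exist
   by the intermediate value theorem, and they are unique.  The multiplier l1
   vanishes because the reflection x -> - x replaces it by - l1. *)

(** Closeness and uniqueness of the bifurcating pair are measured in the sup norm, hence the choice
    of bounded continuous functions. Decay is not built into the space: far out both equations have
    coefficients bounded below by a positive constant, and there bounded solutions decay. The
    nonlinearities see V only through V^2, so W, V^2 and mu are given one common order tau, and V
    the order rho with rho^2 <= tau; every remainder is graded in this way. The obstacle that shapes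
    the estimates is uniqueness. An expansion of l2 at a single amplitude does not exclude two
    nearby zeros, and differentiating l2 in a would require derivatives of the solution map. All
    estimates are therefore made for differences of two solutions, in a form that keeps the factor a
    - a'. For two zeros of l2 this factor can be divided out; subtracting the equation of one of
    them leaves b2 a' (a + a') = O(a'^4), which is impossible for small positive amplitudes. *)

(** * Differentiation rules, monotonicity and decay of convex functions *)

Lemma is_derive_eq (f : R -> R) (x a b : R) : is_derive f x a -> a = b -> is_derive f x b.
Proof. intros H <-; exact H. Qed.

Lemma der_mult (f g : R -> R) (x a b : R) :
  is_derive f x a -> is_derive g x b ->
  is_derive (fun t => f t * g t) x (a * g x + f x * b).
Proof.
  intros Hf Hg. refine (is_derive_mult (K := R_AbsRing) f g x a b Hf Hg _).
  intros n m; apply Rmult_comm.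
Qed.

Lemma der_plus (f g : R -> R) (x a b : R) :
  is_derive f x a -> is_derive g x b -> is_derive (fun t => f t + g t) x (a + b).
Proof. intros Hf Hg. exact (is_derive_plus f g x a b Hf Hg). Qed.

Lemma der_minus (f g : R -> R) (x a b : R) :
  is_derive f x a -> is_derive g x b -> is_derive (fun t => f t - g t) x (a - b).
Proof. intros Hf Hg. exact (is_derive_minus f g x a b Hf Hg). Qed.

Lemma der_opp (f : R -> R) (x a : R) :
  is_derive f x a -> is_derive (fun t => - f t) x (- a).
Proof. intros Hf. exact (is_derive_opp f x a Hf). Qed.

Lemma der_const (c x : R) : is_derive (fun _ => c) x 0.
Proof. apply (is_derive_const (K := R_AbsRing) (V := R_NormedModule) c x). Qed.

Lemma der_id (x : R) : is_derive (fun t => t) x 1.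
Proof. apply (is_derive_id (K := R_AbsRing) x). Qed.

Lemma der_comp (f g : R -> R) (x a b : R) :
  is_derive f (g x) a -> is_derive g x b -> is_derive (fun t => f (g t)) x (b * a).
Proof. intros Hf Hg. exact (is_derive_comp f g x a b Hf Hg). Qed.

Lemma der_inv (f : R -> R) (x a : R) :
  is_derive f x a -> f x <> 0 -> is_derive (fun t => / f t) x (- a / (f x) ^ 2).
Proof. intros Hf H0. apply (is_derive_inv f x a Hf H0). Qed.

Lemma der_exp (c x : R) : is_derive (fun t => exp (c * t)) x (c * exp (c * x)).
Proof. auto_derive; [exact I | ring]. Qed.

Ltac fext := apply functional_extensionality; intros; ring.

(** Derivatives of unknown functions are taken from the context by [eassumption], which is why
    pointwise derivative facts are put there before [der] is called; [der] leaves only the identity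
    between the computed and the claimed derivative. *)
Ltac der_step :=
  match goal with
  | |- is_derive (fun t => _ + _) _ _ => apply der_plus
  | |- is_derive (fun t => _ - _) _ _ => apply der_minus
  | |- is_derive (fun t => _ * _) _ _ => apply der_mult
  | |- is_derive (fun t => - _) _ _ => apply der_opp
  | |- is_derive (fun t => exp (_ * t)) _ _ => apply der_exp
  | |- is_derive (fun t => t) _ _ => apply der_id
  | |- is_derive (fun t => ?c) _ _ => apply (der_const c)
  | |- is_derive _ _ _ => eassumption
  end.

Ltac der := eapply is_derive_eq; [ repeat der_step | cbv beta ].

Lemma der_continuous (f : R -> R) (x a : R) : is_derive f x a -> continuous f x.
Proof. intros H; apply (ex_derive_continuous f x); exists a; exact H. Qed.

Lemma cont_pt (f : R -> R) (x : R) : continuous f x -> continuity_pt f x.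
Proof. intros H; apply continuity_pt_filterlim; exact H. Qed.

Lemma mvt_le (f df : R -> R) (a b : R) :
  a <= b -> (forall x, a <= x <= b -> is_derive f x (df x)) ->
  exists c, a <= c <= b /\ f b - f a = df c * (b - a).
Proof.
  intros Hab Hd.
  destruct (MVT_gen f a b df) as [c [Hc He]].
  - rewrite Rmin_left, Rmax_right by lra. intros x Hx; apply Hd; lra.
  - rewrite Rmin_left, Rmax_right by lra. intros x Hx; apply cont_pt.
    eapply der_continuous; apply Hd; lra.
  - rewrite Rmin_left, Rmax_right in Hc by lra. exists c; split; assumption.
Qed.

Lemma nondecreasing_of_derive (f df : R -> R) (a b : R) :
  a <= b -> (forall x, a <= x <= b -> is_derive f x (df x)) ->
  (forall x, a <= x <= b -> 0 <= df x) -> f a <= f b.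
Proof.
  intros Hab Hd Hp. destruct (mvt_le f df a b Hab Hd) as [c [Hc He]].
  specialize (Hp c Hc). nra.
Qed.

Lemma nonincreasing_of_derive (f df : R -> R) (a b : R) :
  a <= b -> (forall x, a <= x <= b -> is_derive f x (df x)) ->
  (forall x, a <= x <= b -> df x <= 0) -> f b <= f a.
Proof.
  intros Hab Hd Hp. destruct (mvt_le f df a b Hab Hd) as [c [Hc He]].
  specialize (Hp c Hc). nra.
Qed.

Lemma lipschitz_of_derive (f df : R -> R) (K a b : R) :
  (forall x, is_derive f x (df x)) -> (forall x, Rabs (df x) <= K) ->
  Rabs (f b - f a) <= K * Rabs (b - a).
Proof.
  intros Hd HK.
  destruct (MVT_gen f a b df) as [c [Hc He]].
  - intros x _; apply Hd.
  - intros x _; apply cont_pt; eapply der_continuous; apply Hd.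
  - rewrite He, Rabs_mult. apply Rmult_le_compat_r; [apply Rabs_pos | apply HK].
Qed.

(* Landau's inequality. *)
Lemma derive_bound (f f1 f2 : R -> R) (A B x : R) :
  (forall y, x <= y <= x + 1 -> is_derive f y (f1 y)) ->
  (forall y, x <= y <= x + 1 -> is_derive f1 y (f2 y)) ->
  (forall y, x <= y <= x + 1 -> Rabs (f y) <= A) ->
  (forall y, x <= y <= x + 1 -> Rabs (f2 y) <= B) ->
  Rabs (f1 x) <= 2 * A + B.
Proof.
  intros H1 H2 HA HB.
  destruct (mvt_le f f1 x (x + 1)) as [c [Hc Ec]]; [lra | assumption |].
  destruct (mvt_le f1 f2 x c) as [d [Hd Ed]]; [lra | intros y Hy; apply H2; lra |].
  assert (Ha := HA x ltac:(lra)). assert (Hb := HA (x + 1) ltac:(lra)).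
  assert (Hg := HB d ltac:(lra)).
  apply Rabs_le_between in Ha. apply Rabs_le_between in Hb. apply Rabs_le_between in Hg.
  apply Rabs_le_between.
  replace (x + 1 - x) with 1 in Ec by ring.
  assert (- B <= f2 d * (c - x) <= B) by nra.
  lra.
Qed.

Lemma bounded_on_segment (f : R -> R) (a b : R) :
  (forall x, continuous f x) -> exists B, 0 <= B /\ forall x, a <= x <= b -> Rabs (f x) <= B.
Proof.
  intros Hf. destruct (Rle_or_lt a b) as [Hab|Hab].
  - destruct (continuity_ab_maj (fun x => Rabs (f x)) a b Hab) as [c [Hc _]].
    + intros c _. apply cont_pt. apply (continuous_comp f Rabs); [apply Hf | apply continuous_Rabs].
    + exists (Rabs (f c)); split; [apply Rabs_pos | assumption].
  - exists 0; split; [lra | intros; lra].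
Qed.

Lemma tends_small (f : R -> R) (e : R) :
  is_lim f p_infty 0 -> 0 < e -> exists X, 0 <= X /\ forall x, X <= x -> Rabs (f x) <= e.
Proof.
  intros H He. apply is_lim_spec in H. destruct (H (mkposreal e He)) as [M HM].
  exists (Rmax 0 (M + 1)); split; [apply Rmax_l |]. intros x Hx.
  assert (M < x) by (generalize (Rmax_r 0 (M + 1)); lra).
  specialize (HM x H0). simpl in HM. rewrite Rminus_0_r in HM. lra.
Qed.

Lemma tends_small_m (f : R -> R) (e : R) :
  is_lim f m_infty 0 -> 0 < e -> exists X, 0 <= X /\ forall x, x <= - X -> Rabs (f x) <= e.
Proof.
  intros H He. apply is_lim_spec in H. destruct (H (mkposreal e He)) as [M HM].
  exists (Rmax 0 (1 - M)); split; [apply Rmax_l |]. intros x Hx.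
  assert (x < M) by (generalize (Rmax_r 0 (1 - M)); lra).
  specialize (HM x H0). simpl in HM. rewrite Rminus_0_r in HM. lra.
Qed.

Lemma exp_growth (b x : R) : 1 + b * x <= exp (b * x).
Proof. apply exp_ineq1_le. Qed.

(* The function exp (- b x) (y' + b y) is nondecreasing; if it became positive,
   y would grow without bound. *)
Lemma convex_decay (y y1 y2 : R -> R) (b X B : R) :
  0 < b ->
  (forall x, X <= x -> is_derive y x (y1 x)) ->
  (forall x, X <= x -> is_derive y1 x (y2 x)) ->
  (forall x, X <= x -> b ^ 2 * y x <= y2 x) ->
  (forall x, X <= x -> y x <= B) ->
  forall x, X <= x -> y1 x + b * y x <= 0.
Proof.
  intros Hb H1 H2 Hc HB x0 Hx0.
  apply Rnot_lt_le; intros Hpos.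
  set (eta := exp (- b * x0) * (y1 x0 + b * y x0)).
  assert (Heta : 0 < eta) by (apply Rmult_lt_0_compat; [apply exp_pos | lra]).
  assert (Hge : forall x, x0 <= x -> eta * exp (b * x) <= y1 x + b * y x).
  { intros x Hx.
    assert (Hm : eta <= exp (- b * x) * (y1 x + b * y x)).
    {
      apply (nondecreasing_of_derive (fun x => exp (- b * x) * (y1 x + b * y x))
               (fun x => exp (- b * x) * (y2 x - b ^ 2 * y x)) x0 x Hx).
      - intros z Hz. assert (A1 := H1 z ltac:(lra)). assert (A2 := H2 z ltac:(lra)).
        der. ring.
      - intros z Hz. apply Rmult_le_pos; [left; apply exp_pos |].
        generalize (Hc z ltac:(lra)); lra. }
    assert (He : exp (- b * x) * exp (b * x) = 1).
    { rewrite <- exp_plus. replace (- b * x + b * x) with 0 by ring. apply exp_0. }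
    assert (Hp := exp_pos (b * x)).
    apply Rmult_le_compat_r with (r := exp (b * x)) in Hm; [| lra].
    replace (exp (- b * x) * (y1 x + b * y x) * exp (b * x))
      with ((exp (- b * x) * exp (b * x)) * (y1 x + b * y x)) in Hm by ring.
    rewrite He in Hm. lra. }
  (* Beyond x1 the inequality 1 + t <= exp t gives eta exp (b x) >= 1 + b |B|; as b y <= b |B|, the
     derivative of y is at least 1 there. *)
  set (x1 := Rmax (Rmax x0 0) ((1 + b * Rabs B) / (eta * b))).
  assert (Hx10 : x0 <= x1) by (unfold x1; generalize (Rmax_l (Rmax x0 0) ((1 + b * Rabs B) / (eta * b))) (Rmax_l x0 0); lra).
  assert (Hx1b : (1 + b * Rabs B) / (eta * b) <= x1) by apply Rmax_r.
  assert (Heb : 0 < eta * b) by nra.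
  assert (Hgrow : forall x, x1 <= x -> 1 <= y1 x).
  { intros x Hx. assert (G := Hge x ltac:(lra)).
    assert (E := exp_growth b x).
    assert (K1 : 1 + b * Rabs B <= eta * b * x).
    { apply Rle_trans with (eta * b * x1); [| apply Rmult_le_compat_l; lra].
      apply Rmult_le_compat_l with (r := eta * b) in Hx1b; [| lra].
      replace (eta * b * ((1 + b * Rabs B) / (eta * b))) with (1 + b * Rabs B) in Hx1b by (field; lra).
      exact Hx1b. }
    assert (K2 : b * y x <= b * Rabs B).
    { apply Rmult_le_compat_l; [lra |]. generalize (HB x ltac:(lra)) (Rle_abs B); lra. }
    assert (K3 : eta * (1 + b * x) <= eta * exp (b * x)) by nra.
    lra. }
  (* With slope at least 1, y exceeds B after an interval of this length. *)
  set (t := B - y x1 + 1).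
  assert (Ht : 1 <= t) by (generalize (HB x1 ltac:(lra)); unfold t; lra).
  destruct (mvt_le y y1 x1 (x1 + t)) as [c [Hc' Ec]]; [lra | intros; apply H1; lra |].
  assert (G := Hgrow c ltac:(lra)). assert (G' := HB (x1 + t) ltac:(lra)).
  assert (t <= y1 c * (x1 + t - x1)) by nra.
  unfold t in *; lra.
Qed.

(** The derivative of exp (b x) y is exp (b x) (y' + b y), which [convex_decay] makes
    nonpositive. *)
Lemma convex_decay_exp (y y1 y2 : R -> R) (b X B : R) :
  0 < b ->
  (forall x, X <= x -> is_derive y x (y1 x)) ->
  (forall x, X <= x -> is_derive y1 x (y2 x)) ->
  (forall x, X <= x -> b ^ 2 * y x <= y2 x) ->
  (forall x, X <= x -> y x <= B) ->
  forall x z, X <= x <= z -> exp (b * z) * y z <= exp (b * x) * y x.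
Proof.
  intros Hb H1 H2 Hc HB x z Hxz.
  apply (nonincreasing_of_derive (fun x => exp (b * x) * y x)
           (fun x => exp (b * x) * (y1 x + b * y x))); [lra | |].
  - intros t Ht. assert (A1 := H1 t ltac:(lra)). der. ring.
  - intros t Ht.
    assert (D := convex_decay y y1 y2 b X B Hb H1 H2 Hc HB t ltac:(lra)).
    assert (P := exp_pos (b * t)). nra.
Qed.

(** * Linear second-order equations *)

(** The equation - d'' + m d = h. As [Derive] is total, the second clause alone would not make
    [Derive d] a derivative of d. *)
Definition solves (m h d : R -> R) : Prop :=
  forall x, ex_derive d x /\ is_derive (Derive d) x (m x * d x - h x).

Lemma solves_der {m h d} : solves m h d -> forall x, is_derive d x (Derive d x).
Proof. intros H x. apply Derive_correct, H. Qed.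

Lemma solves_der2 {m h d} : solves m h d -> forall x, is_derive (Derive d) x (m x * d x - h x).
Proof. intros H x. apply H. Qed.

Lemma solves_intro m h d d1 :
  (forall x, is_derive d x (d1 x)) ->
  (forall x, is_derive d1 x (m x * d x - h x)) -> solves m h d.
Proof.
  intros H1 H2 x. split; [exists (d1 x); apply H1 |].
  apply is_derive_ext with d1; [| apply H2].
  intros t; symmetry; apply is_derive_unique, H1.
Qed.

Lemma solves_cont {m h d} : solves m h d -> forall x, continuous d x.
Proof. intros H x; eapply der_continuous, (solves_der H). Qed.

Lemma solves_cont1 {m h d} : solves m h d -> forall x, continuous (Derive d) x.
Proof. intros H x; eapply der_continuous, (solves_der2 H). Qed.

Lemma solves_lin {m h1 h2 d1 d2} (a b : R) :
  solves m h1 d1 -> solves m h2 d2 ->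
  solves m (fun x => a * h1 x + b * h2 x) (fun x => a * d1 x + b * d2 x).
Proof.
  intros H1 H2.
  apply solves_intro with (fun x => a * Derive d1 x + b * Derive d2 x); intros x.
  - assert (A := solves_der H1 x). assert (B := solves_der H2 x). der. ring.
  - assert (A := solves_der2 H1 x). assert (B := solves_der2 H2 x). der. ring.
Qed.

Lemma solves_ext m m' h h' d d' :
  (forall x, m x = m' x) -> (forall x, h x = h' x) -> (forall x, d x = d' x) ->
  solves m h d -> solves m' h' d'.
Proof.
  intros Em Eh Ed H. apply solves_intro with (Derive d); intros x.
  - apply is_derive_ext with d; [exact Ed | apply (solves_der H)].
  - rewrite <- Em, <- Eh, <- Ed. apply (solves_der2 H).
Qed.

Lemma Derive_lin (f g : R -> R) (a b x : R) : ex_derive f x -> ex_derive g x ->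
  Derive (fun t => a * f t + b * g t) x = a * Derive f x + b * Derive g x.
Proof.
  intros Hf Hg. apply is_derive_unique.
  apply Derive_correct in Hf. apply Derive_correct in Hg. der. ring.
Qed.

Lemma solves_reflect {m h d} :
  solves m h d -> solves (fun x => m (- x)) (fun x => h (- x)) (fun x => d (- x)).
Proof.
  intros H.
  assert (N : forall x : R, is_derive (fun t : R => - t) x (- 1)).
  { intros x. der. ring. }
  apply solves_intro with (fun x => - Derive d (- x)); intros x.
  - eapply is_derive_eq; [apply (der_comp d (fun t => - t)); [apply (solves_der H) | apply N] |]. ring.
  - eapply is_derive_eq; [apply der_opp, (der_comp (Derive d) (fun t => - t)); [apply (solves_der2 H) | apply N] |]. ring.
Qed.

Lemma Derive_reflect (d : R -> R) (x : R) :
  ex_derive d (- x) -> Derive (fun t => d (- t)) x = - Derive d (- x).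
Proof.
  intros H. apply is_derive_unique. apply Derive_correct in H.
  eapply is_derive_eq; [apply (der_comp d (fun t => - t)); [exact H | der; reflexivity] |]. ring.
Qed.

(* Gronwall for d^2 + d'^2. *)
Lemma ode_zero m d M x0 :
  solves m (fun _ => 0) d -> (forall x, Rabs (m x) <= M) ->
  d x0 = 0 -> Derive d x0 = 0 -> forall x, d x = 0.
Proof.
  intros H HM H0 H1 x.
  set (rho := fun x => d x * d x + Derive d x * Derive d x).
  assert (Dr : forall x, is_derive rho x (2 * d x * Derive d x * (1 + m x))).
  { intros y. assert (A := solves_der H y). assert (B := solves_der2 H y).
    unfold rho. der. ring. }
  assert (Br : forall x, - (1 + M) * rho x <= 2 * d x * Derive d x * (1 + m x) <= (1 + M) * rho x).
  { intros y. specialize (HM y). apply Rabs_le_between in HM. unfold rho.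
    assert (Q : - (d y * d y + Derive d y * Derive d y) <= 2 * d y * Derive d y <= d y * d y + Derive d y * Derive d y) by (generalize (pow2_ge_0 (d y + Derive d y)) (pow2_ge_0 (d y - Derive d y)); lra).
    split; nra. }
  assert (R0 : rho x0 = 0) by (unfold rho; rewrite H0, H1; ring).
  assert (Hr : rho x <= 0).
  { destruct (Rle_or_lt x0 x) as [Hx|Hx].
    - assert (E : exp (- (1 + M) * x) * rho x <= exp (- (1 + M) * x0) * rho x0).
      { apply (nonincreasing_of_derive (fun x => exp (- (1 + M) * x) * rho x)
          (fun x => exp (- (1 + M) * x) * (2 * d x * Derive d x * (1 + m x) - (1 + M) * rho x))); [lra | |].
        - intros y _. specialize (Dr y). der. ring.
        - intros y _. assert (P := exp_pos (- (1 + M) * y)). specialize (Br y). nra. }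
      rewrite R0 in E. assert (P := exp_pos (- (1 + M) * x)). nra.
    - assert (E : exp ((1 + M) * x) * rho x <= exp ((1 + M) * x0) * rho x0).
      { apply (nondecreasing_of_derive (fun x => exp ((1 + M) * x) * rho x)
          (fun x => exp ((1 + M) * x) * (2 * d x * Derive d x * (1 + m x) + (1 + M) * rho x))); [lra | |].
        - intros y _. specialize (Dr y). der. ring.
        - intros y _. assert (P := exp_pos ((1 + M) * y)). specialize (Br y). nra. }
      rewrite R0 in E. assert (P := exp_pos ((1 + M) * x)). nra. }
  unfold rho in Hr. nra.
Qed.

Lemma rho_pos m d M :
  solves m (fun _ => 0) d -> (forall x, Rabs (m x) <= M) -> nontrivial d ->
  forall x, 0 < d x ^ 2 + Derive d x ^ 2.
Proof.
  intros H HM [x0 Hx0] x.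
  destruct (Req_dec (d x) 0) as [E0|E0]; [destruct (Req_dec (Derive d x) 0) as [E1|E1] |].
  - exfalso; apply Hx0. exact (ode_zero m d M x H HM E0 E1 x0).
  - generalize (pow2_gt_0 _ E1) (pow2_ge_0 (d x)); lra.
  - generalize (pow2_gt_0 _ E0) (pow2_ge_0 (Derive d x)); lra.
Qed.

(** The square y = d^2 satisfies y'' = 2 d'^2 + 2 m d^2 >= b^2 y, so the convexity argument applies
    whatever the sign of d; taking the root halves the rate. The differential inequality in the
    first part later controls 1 / k^2. *)
Lemma homogeneous_decay m d b X B :
  0 < b -> solves m (fun _ => 0) d -> (forall x, X <= x -> b ^ 2 <= m x) ->
  (forall x, X <= x -> Rabs (d x) <= B) ->
  (forall x, X <= x -> 2 * d x * Derive d x + b * d x ^ 2 <= 0) /\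
  (forall x z, X <= x <= z -> Rabs (d z) <= Rabs (d x) * exp (- (b / 2) * (z - x))).
Proof.
  intros Hb H Hm HB.
  assert (A1 : forall x, X <= x -> is_derive (fun x => d x ^ 2) x (2 * d x * Derive d x)).
  { intros x _. assert (A := solves_der H x).
    apply is_derive_ext with (fun x => d x * d x); [intros; simpl; ring |]. der. ring. }
  assert (A2 : forall x, X <= x -> is_derive (fun x => 2 * d x * Derive d x) x
             (2 * Derive d x ^ 2 + 2 * m x * d x ^ 2)).
  { intros x _. assert (A := solves_der H x). assert (A' := solves_der2 H x). der. ring. }
  assert (A3 : forall x, X <= x -> b ^ 2 * d x ^ 2 <= 2 * Derive d x ^ 2 + 2 * m x * d x ^ 2).
  { intros x Hx. specialize (Hm x Hx). generalize (pow2_ge_0 (d x)) (pow2_ge_0 (Derive d x)) (pow2_ge_0 b). nra. }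
  assert (A4 : forall x, X <= x -> d x ^ 2 <= B ^ 2).
  { intros x Hx. rewrite <- (pow2_abs (d x)). apply pow_incr. split; [apply Rabs_pos | apply HB, Hx]. }
  split.
  - intros x Hx.
    exact (convex_decay _ _ _ b X (B ^ 2) Hb A1 A2 A3 A4 x Hx).
  - intros x z Hxz.
    assert (E := convex_decay_exp _ _ _ b X (B ^ 2) Hb A1 A2 A3 A4 x z Hxz). simpl in E.
    set (q := exp (- (b / 2) * (z - x))).
    assert (Hq : 0 < q) by apply exp_pos.
    assert (Eq : exp (b * x) = q * q * exp (b * z)).
    { unfold q. rewrite <- !exp_plus. f_equal. field. }
    assert (P := exp_pos (b * z)).
    rewrite Eq in E.
    rewrite <- (Rabs_pos_eq q) by lra. rewrite <- Rabs_mult.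
    apply Rsqr_le_abs_0. unfold Rsqr. nra.
Qed.

(** By the decay estimate a zero at x forces d = 0 on the whole half line to the right, and then
    everywhere by uniqueness of the initial value problem. *)
Lemma homogeneous_nonzero m d b X M B :
  0 < b -> solves m (fun _ => 0) d -> (forall x, X <= x -> b ^ 2 <= m x) ->
  (forall x, Rabs (m x) <= M) -> (forall x, X <= x -> Rabs (d x) <= B) -> nontrivial d ->
  forall x, X <= x -> d x <> 0.
Proof.
  intros Hb H Hm HM HB [x0 Hx0] x Hx E. apply Hx0.
  destruct (homogeneous_decay m d b X B Hb H Hm HB) as [_ D].
  assert (Z : forall z, x <= z -> d z = 0).
  { intros z Hz. specialize (D x z ltac:(lra)). rewrite E, Rabs_R0, Rmult_0_l in D.
    apply Rabs_eq_0. generalize (Rabs_pos (d z)); lra. }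
  (* The point x + 1 is interior to the half line where d is known to vanish, so that d' vanishes
     there as well. *)
  apply (ode_zero m d M (x + 1) H HM); [apply Z; lra |].
  rewrite (Derive_ext_loc d (fun _ => 0)); [apply Derive_const |].
  exists (mkposreal 1 Rlt_0_1). intros y Hy. apply Z.
  unfold ball in Hy; simpl in Hy; unfold AbsRing_ball, abs, minus, plus, opp in Hy; simpl in Hy.
  apply Rabs_lt_between in Hy. lra.
Qed.

(** The combination of d and k that vanishes at X is bounded on the right half line, and a
    nontrivial solution of this kind has no zero there. *)
Lemma bounded_homogeneous_multiple m d k b X M B :
  0 < b -> (forall x, X <= x -> b ^ 2 <= m x) -> (forall x, Rabs (m x) <= M) ->
  solves m (fun _ => 0) d -> solves m (fun _ => 0) k -> nontrivial k ->
  (forall x, X <= x -> Rabs (d x) <= B) -> (forall x, X <= x -> Rabs (k x) <= B) ->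
  exists c, forall x, d x = c * k x.
Proof.
  intros Hb Hm HM Hd Hk Hnt Bd Bk.
  assert (kX := homogeneous_nonzero m k b X M B Hb Hk Hm HM Bk Hnt X ltac:(lra)).
  exists (d X / k X). intros x.
  set (e := fun x => 1 * d x + - (d X / k X) * k x).
  destruct (Req_dec (e x) 0) as [E|E]; [unfold e in E; lra | exfalso].
  refine (homogeneous_nonzero m e b X M (B + Rabs (d X / k X) * B) Hb _ Hm HM _ (ex_intro _ x E) X ltac:(lra) _).
  - eapply solves_ext; [reflexivity | | reflexivity | exact (solves_lin 1 (- (d X / k X)) Hd Hk)].
    intros y; simpl; ring.
  - intros y Hy. eapply Rle_trans; [apply Rabs_triang |]. rewrite !Rabs_mult, Rabs_Ropp, Rabs_R1.
    specialize (Bd y Hy). specialize (Bk y Hy). generalize (Rabs_pos (d X / k X)); nra.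
  - unfold e. field. exact kX.
Qed.

(** * Improper integrals *)

Definition tail (f : R -> R) (x : R) : R :=
  RInt_gen f (at_point x) (Rbar_locally p_infty).

(** A class of integrands closed under linear combinations, reflection and products with bounded
    continuous functions, on which all integrals over the line converge. *)
Definition expo (f : R -> R) : Prop :=
  (forall x, continuous f x) /\
  exists C g, 0 < g /\ 0 <= C /\ forall x, Rabs (f x) <= C * exp (- g * Rabs x).

Lemma ex_RInt_cont (f : R -> R) (a b : R) : (forall x, continuous f x) -> ex_RInt f a b.
Proof. intros H. apply (ex_RInt_continuous f). intros; apply H. Qed.

Lemma RInt_chasles (f : R -> R) (a b c : R) : (forall x, continuous f x) ->
  RInt f a b + RInt f b c = RInt f a c.
Proof. intros H. apply (RInt_Chasles f a b c); apply ex_RInt_cont, H. Qed.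

Lemma der_RInt (f : R -> R) (a x : R) :
  (forall x, continuous f x) -> is_derive (fun b => RInt f a b) x (f x).
Proof.
  intros H. apply (is_derive_RInt f _ a x); [| apply H].
  apply filter_forall. intros b. apply (RInt_correct f). apply ex_RInt_cont, H.
Qed.

Lemma RInt_bound_exp (f : R -> R) (C g x a b : R) :
  0 < g -> x <= a <= b -> (forall y, continuous f y) ->
  (forall y, x <= y -> Rabs (f y) <= C * exp (- g * (y - x))) ->
  Rabs (RInt f a b) <= C / g * (exp (- g * (a - x)) - exp (- g * (b - x))).
Proof.
  intros Hg Hab Hc Hb.
  assert (HI : is_RInt (fun y => C * exp (- g * (y - x))) a b
            (minus (- (C / g) * exp (- g * (b - x))) (- (C / g) * exp (- g * (a - x))))).
  { apply (is_RInt_derive (fun y => - (C / g) * exp (- g * (y - x)))).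
    - intros y _. auto_derive; [exact I | unfold Rminus; field; lra].
    - intros y _. apply (ex_derive_continuous (fun y => C * exp (- g * (y - x)))).
      auto_derive. exact I. }
  eapply Rle_trans; [apply abs_RInt_le; [lra | apply ex_RInt_cont, Hc] |].
  eapply Rle_trans; [apply (RInt_le _ (fun y => C * exp (- g * (y - x)))); [lra | | eexists; exact HI |] |].
  - apply ex_RInt_cont. intros y. apply (continuous_comp f Rabs); [apply Hc | apply continuous_Rabs].
  - intros y Hy. apply Hb; lra.
  - rewrite (is_RInt_unique _ _ _ _ HI). unfold minus, plus, opp; simpl. right; ring.
Qed.

(** The partial integrals are Cauchy by comparison with the exponential majorant, whose integral
    from x is C / g. *)
Lemma tail_lim (f : R -> R) (C g x : R) :
  0 < g -> (forall y, continuous f y) ->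
  (forall y, x <= y -> Rabs (f y) <= C * exp (- g * (y - x))) ->
  filterlim (fun b => RInt f x b) (Rbar_locally p_infty) (locally (tail f x)) /\
  is_RInt_gen f (at_point x) (Rbar_locally p_infty) (tail f x) /\
  Rabs (tail f x) <= C / g.
Proof.
  intros Hg Hc Hb.
  assert (C0 : 0 <= C).
  { specialize (Hb x ltac:(lra)). replace (- g * (x - x)) with 0 in Hb by ring.
    rewrite exp_0 in Hb. generalize (Rabs_pos (f x)); lra. }
  assert (Cg : 0 <= C / g) by (apply Rdiv_le_0_compat; lra).
  assert (HL : exists l, filterlim (fun b => RInt f x b) (Rbar_locally p_infty) (locally l)).
  { apply (proj1 (filterlim_locally_cauchy (U := R_CompleteSpace) (F := Rbar_locally p_infty) (fun b => RInt f x b))).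
    intros eps.
    (* Chosen such that 1 + t <= exp t already makes C / g exp (- g (u - x)) smaller than eps for u
       > N. *)
    set (N := Rmax x (x + C / g / (g * eps))).
    exists (fun b => N < b). split; [exists N; intros; assumption |].
    assert (W : forall u v, N < u -> u <= v -> Rabs (RInt f x v - RInt f x u) < eps).
    { intros u v Hu Huv.
      assert (Hxu : x <= u) by (generalize (Rmax_l x (x + C / g / (g * eps))); unfold N in Hu; lra).
      assert (Hu2 : x + C / g / (g * eps) < u) by (generalize (Rmax_r x (x + C / g / (g * eps))); unfold N in Hu; lra).
      assert (E : RInt f x v - RInt f x u = RInt f u v).
      { assert (E := RInt_chasles f x u v Hc). lra. }
      rewrite E.
      eapply Rle_lt_trans; [apply (RInt_bound_exp f C g x u v Hg ltac:(lra) Hc Hb) |].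
      assert (P := exp_pos (- g * (v - x))). assert (P' := exp_pos (- g * (u - x))).
      assert (Ge := exp_growth g (u - x)).
      assert (Em : exp (- g * (u - x)) * exp (g * (u - x)) = 1).
      { rewrite <- exp_plus. replace (- g * (u - x) + g * (u - x)) with 0 by ring. apply exp_0. }
      assert (Pe := cond_pos eps).
      assert (Hge : 0 < g * eps) by nra.
      assert (Hlt : C / g < eps * (g * (u - x))).
      { apply Rmult_lt_compat_r with (r := g * eps) in Hu2; [| lra].
        replace ((x + C / g / (g * eps)) * (g * eps)) with (x * (g * eps) + C / g) in Hu2 by (field; lra).
        lra. }
      apply Rle_lt_trans with (C / g * exp (- g * (u - x))); [nra |].
      apply Rlt_le_trans with (eps * (1 + g * (u - x)) * exp (- g * (u - x))).
      - apply Rmult_lt_compat_r; lra.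
      - replace (pos eps) with (eps * (exp (g * (u - x)) * exp (- g * (u - x)))) at 2 by (rewrite (Rmult_comm (exp (g * (u - x)))), Em; ring).
        rewrite Rmult_assoc. apply Rmult_le_compat_l; [lra |]. apply Rmult_le_compat_r; lra. }
    intros u v Hu Hv. change (Rabs (RInt f x v - RInt f x u) < eps).
    destruct (Rle_or_lt u v) as [H|H].
    - apply (W u v); assumption.
    - rewrite Rabs_minus_sym. apply (W v u); [assumption | lra]. }
  destruct HL as [l Hl].
  assert (HG : is_RInt_gen f (at_point x) (Rbar_locally p_infty) l).
  { intros P HP. specialize (Hl P HP).
    apply (Filter_prod _ _ _ (fun a => a = x) (fun b => P (RInt f x b))); [reflexivity | exact Hl |].
    intros a b -> Hb'. exists (RInt f x b). split; [| exact Hb'].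
    simpl. apply (RInt_correct f), ex_RInt_cont, Hc. }
  assert (El : tail f x = l).
  { unfold tail. apply (is_RInt_gen_unique (V := R_CompleteNormedModule)). exact HG. }
  rewrite El. split; [exact Hl | split; [exact HG |]].
  assert (HA : filterlim (fun b => Rabs (RInt f x b)) (Rbar_locally p_infty) (locally (Rabs l))).
  { eapply filterlim_comp; [exact Hl |]. apply continuous_Rabs. }
  change (Rbar_le (Rabs l) (C / g)).
  apply (filterlim_le (F := Rbar_locally p_infty) (fun b => Rabs (RInt f x b)) (fun _ => C / g) (Rabs l) (C / g)).
  - exists x. intros b Hxb.
    eapply Rle_trans; [apply (RInt_bound_exp f C g x x b Hg ltac:(lra) Hc Hb) |].
    replace (- g * (x - x)) with 0 by ring. rewrite exp_0.
    assert (P := exp_pos (- g * (b - x))). nra.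
  - exact HA.
  - apply filterlim_const.
Qed.

Lemma expo_right (f : R -> R) : expo f -> exists g, 0 < g /\ forall x, exists C,
  forall y, x <= y -> Rabs (f y) <= C * exp (- g * (y - x)).
Proof.
  intros [_ [C [g [Hg [HC Hb]]]]]. exists g. split; [exact Hg |]. intros x.
  exists (C * exp (g * Rabs x)). intros y Hy. eapply Rle_trans; [apply Hb |].
  rewrite Rmult_assoc. apply Rmult_le_compat_l; [exact HC |].
  rewrite <- exp_plus.
  assert (- g * Rabs y <= g * Rabs x + - g * (y - x)).
  { generalize (Rle_abs y) (Rle_abs (- x)). rewrite Rabs_Ropp. nra. }
  destruct H as [H|H]; [left; apply exp_increasing, H | right; f_equal; exact H].
Qed.

Lemma tail_is (f : R -> R) (x : R) :
  expo f -> is_RInt_gen f (at_point x) (Rbar_locally p_infty) (tail f x).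
Proof.
  intros H. destruct (expo_right f H) as [g [Hg Hx]]. destruct (Hx x) as [C HC].
  exact (proj1 (proj2 (tail_lim f C g x Hg (proj1 H) HC))).
Qed.

Lemma tail_chasles (f : R -> R) (x y : R) : expo f -> tail f x = RInt f x y + tail f y.
Proof.
  intros H. unfold tail at 1. apply (is_RInt_gen_unique (V := R_CompleteNormedModule)).
  apply (is_RInt_gen_Chasles f y); [| apply tail_is, H].
  apply is_RInt_gen_at_point. apply (RInt_correct f), ex_RInt_cont, H.
Qed.

Lemma der_tail (f : R -> R) (x : R) : expo f -> is_derive (tail f) x (- f x).
Proof.
  intros H.
  assert (E : forall y, tail f 0 - RInt f 0 y = tail f y)
    by (intros y; rewrite (tail_chasles f 0 y H); ring).
  apply is_derive_ext with (1 := E).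
  assert (A := der_RInt f 0 x (proj1 H)). der. ring.
Qed.

Lemma tail_lin (f g : R -> R) (a b x : R) : expo f -> expo g ->
  tail (fun y => a * f y + b * g y) x = a * tail f x + b * tail g x.
Proof.
  intros Hf Hg. unfold tail at 1. apply (is_RInt_gen_unique (V := R_CompleteNormedModule)).
  apply (is_RInt_gen_plus (V := R_NormedModule) (fun y => a * f y) (fun y => b * g y)).
  - apply (is_RInt_gen_scal f a), tail_is, Hf.
  - apply (is_RInt_gen_scal g b), tail_is, Hg.
Qed.

Lemma expo_reflect (f : R -> R) : expo f -> expo (fun x => f (- x)).
Proof.
  intros [Hc [C [g [Hg [HC Hb]]]]]. split.
  - intros x. apply (continuous_comp (fun y => - y) f); [| apply Hc].
    apply (continuous_opp (fun y : R => y)), continuous_id.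
  - exists C, g. repeat split; try assumption. intros x. rewrite <- (Rabs_Ropp x). apply Hb.
Qed.

Lemma expo_lin (f h : R -> R) (a b : R) : expo f -> expo h -> expo (fun x => a * f x + b * h x).
Proof.
  intros [Hc [C [g [Hg [HC Hb]]]]] [Hc' [C' [g' [Hg' [HC' Hb']]]]]. split.
  - intros x. apply (continuous_plus (fun x => a * f x) (fun x => b * h x)).
    + apply (continuous_scal_r a f), Hc.
    + apply (continuous_scal_r b h), Hc'.
  - exists (Rabs a * C + Rabs b * C'), (Rmin g g').
    assert (Hm : 0 < Rmin g g') by (apply Rmin_glb_lt; assumption).
    split; [exact Hm |]. split; [generalize (Rabs_pos a) (Rabs_pos b); nra |].
    intros x. eapply Rle_trans; [apply Rabs_triang |]. rewrite !Rabs_mult.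
    assert (E : forall k, Rmin g g' <= k -> exp (- k * Rabs x) <= exp (- Rmin g g' * Rabs x)).
    { intros k Hk. assert (D : - k * Rabs x <= - Rmin g g' * Rabs x) by (generalize (Rabs_pos x); nra).
      destruct D as [D|D]; [left; apply exp_increasing, D | right; f_equal; exact D]. }
    assert (E1 := E g (Rmin_l _ _)). assert (E2 := E g' (Rmin_r _ _)).
    specialize (Hb x). specialize (Hb' x).
    assert (Rabs (f x) <= C * exp (- Rmin g g' * Rabs x)) by nra.
    assert (Rabs (h x) <= C' * exp (- Rmin g g' * Rabs x)) by nra.
    rewrite Rmult_plus_distr_r, !Rmult_assoc.
    apply Rplus_le_compat; apply Rmult_le_compat_l; try assumption; apply Rabs_pos.
Qed.

Lemma expo_mult (k h : R -> R) (B : R) : expo k -> (forall x, continuous h x) ->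
  (forall x, Rabs (h x) <= B) -> expo (fun x => k x * h x).
Proof.
  intros [Hc [C [g [Hg [HC Hb]]]]] Hh HB. split.
  - intros x. apply (continuous_mult k h); [apply Hc | apply Hh].
  - exists (C * B), g. split; [exact Hg |].
    assert (0 <= B) by (generalize (HB 0) (Rabs_pos (h 0)); lra).
    split; [apply Rmult_le_pos; assumption |]. intros x. rewrite Rabs_mult.
    replace (C * B * exp (- g * Rabs x)) with (C * exp (- g * Rabs x) * B) by ring.
    apply Rmult_le_compat; try apply Rabs_pos; [apply Hb | apply HB].
Qed.

Lemma RInt_reflect (f : R -> R) (a b : R) : (forall x, continuous f x) ->
  RInt (fun x => f (- x)) a b = RInt f (- b) (- a).
Proof.
  intros Hc.
  assert (E := RInt_comp_lin f (-1) 0 a b). simpl in E.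
  replace (-1 * a + 0) with (- a) in E by ring. replace (-1 * b + 0) with (- b) in E by ring.
  specialize (E (ex_RInt_cont f _ _ Hc)).
  rewrite <- (opp_RInt_swap f) by apply ex_RInt_cont, Hc. rewrite <- E.
  rewrite <- (RInt_opp (V := R_CompleteNormedModule)).
  - apply RInt_ext. intros x _. unfold opp, scal; simpl. unfold mult; simpl.
    replace (-1 * x + 0) with (- x) by ring. ring.
  - apply ex_RInt_cont. intros x. apply (continuous_scal_r (-1) (fun y => f (-1 * y + 0))).
    apply (continuous_comp (fun y => -1 * y + 0) f); [| apply Hc].
    apply (ex_derive_continuous (fun y => -1 * y + 0)). auto_derive. exact I.
Qed.

(** The left half is the tail of the reflected function, so convergence is only ever proved at +
    infinity. *)
Lemma int_line_is (f : R -> R) (x : R) : expo f ->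
  is_RInt_gen f (Rbar_locally m_infty) (Rbar_locally p_infty)
    (tail (fun y => f (- y)) (- x) + tail f x).
Proof.
  intros H. apply (is_RInt_gen_Chasles f x); [| apply tail_is, H].
  assert (H' := expo_reflect f H).
  destruct (expo_right _ H') as [g [Hg Hx]]. destruct (Hx (- x)) as [C HC].
  destruct (tail_lim _ C g (- x) Hg (proj1 H') HC) as [L _].
  intros P HP. specialize (L P HP). destruct L as [N HN].
  apply (Filter_prod _ _ _ (fun a => a < - N) (fun b => b = x)); [exists (- N); intros; assumption | reflexivity |].
  intros a b Ha ->. exists (RInt f a x). split; [apply (RInt_correct f), ex_RInt_cont, H |].
  specialize (HN (- a) ltac:(lra)). rewrite (RInt_reflect f) in HN by apply H.
  rewrite !Ropp_involutive in HN. exact HN.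
Qed.

Lemma int_line_split (f : R -> R) (x : R) : expo f ->
  int_line f = tail (fun y => f (- y)) (- x) + tail f x.
Proof.
  intros H. unfold int_line. apply (is_RInt_gen_unique (V := R_CompleteNormedModule)).
  apply int_line_is, H.
Qed.

Lemma int_line_lin (f g : R -> R) (a b : R) : expo f -> expo g ->
  int_line (fun y => a * f y + b * g y) = a * int_line f + b * int_line g.
Proof.
  intros Hf Hg.
  rewrite (int_line_split _ 0 (expo_lin f g a b Hf Hg)), (int_line_split f 0 Hf), (int_line_split g 0 Hg).
  rewrite (tail_lin f g) by assumption.
  rewrite (tail_lin (fun y => f (- y)) (fun y => g (- y))) by (apply expo_reflect; assumption).
  ring.
Qed.

Lemma int_line_odd (f : R -> R) : expo f -> (forall x, f (- x) = - f x) -> int_line f = 0.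
Proof.
  intros H Ho. rewrite (int_line_split f 0 H).
  replace (fun y => f (- y)) with (fun y => (-1) * f y + 0 * f y)
    by (apply functional_extensionality; intros y; rewrite Ho; ring).
  rewrite tail_lin by assumption. rewrite Ropp_0. ring.
Qed.

(** The constant depends on k alone: h -> int k h is a bounded functional in the sup norm. *)
Lemma int_line_bound (k : R -> R) : expo k -> exists C, 0 <= C /\
  forall h B, (forall x, continuous h x) -> (forall x, Rabs (h x) <= B) ->
  Rabs (int_line (fun x => k x * h x)) <= C * B.
Proof.
  intros [Hk [C [g [Hg [HC Hb]]]]].
  exists (2 * (C / g)). assert (0 <= C / g) by (apply Rdiv_le_0_compat; lra).
  split; [lra |]. intros h B Hh HB.
  assert (HE : expo (fun x => k x * h x)).
  { apply expo_mult with B; try assumption. split; [exact Hk |]. exists C, g; repeat split; assumption. }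
  assert (T : forall e, (forall x, continuous e x) ->
     (forall x, 0 <= x -> Rabs (e x) <= C * exp (- g * x) * B) -> Rabs (tail e 0) <= C / g * B).
  { intros e He Hbe. replace (C / g * B) with (C * B / g) by (field; lra).
    apply (proj2 (proj2 (tail_lim e (C * B) g 0 Hg He ltac:(
      intros y Hy; rewrite Rminus_0_r; eapply Rle_trans; [apply Hbe, Hy | right; ring])))). }
  rewrite (int_line_split _ 0 HE). rewrite Ropp_0.
  eapply Rle_trans; [apply Rabs_triang |].
  replace (2 * (C / g) * B) with (C / g * B + C / g * B) by ring.
  apply Rplus_le_compat; apply T.
  - apply (expo_reflect _ HE).
  - intros x Hx. rewrite Rabs_mult. apply Rmult_le_compat; try apply Rabs_pos; [| apply HB].
    eapply Rle_trans; [apply Hb |]. rewrite Rabs_Ropp, (Rabs_pos_eq x) by exact Hx. lra.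
  - apply HE.
  - intros x Hx. rewrite Rabs_mult. apply Rmult_le_compat; try apply Rabs_pos; [| apply HB].
    eapply Rle_trans; [apply Hb |]. rewrite (Rabs_pos_eq x) by exact Hx. lra.
Qed.

(** The tail is nonincreasing and nonnegative; if it vanished at x it would vanish beyond x,
    although f is positive near x by continuity. *)
Lemma tail_pos (f : R -> R) (x : R) : expo f -> (forall y, 0 <= f y) -> 0 < f x -> 0 < tail f x.
Proof.
  intros H Hp Hx.
  assert (N : forall y, 0 <= tail f y).
  { intros y. destruct (expo_right f H) as [g [Hg HC]]. destruct (HC y) as [C HC'].
    destruct (tail_lim f C g y Hg (proj1 H) HC') as [L _].
    change (Rbar_le 0 (tail f y)).
    apply (filterlim_le (F := Rbar_locally p_infty) (fun _ => 0) (fun b => RInt f y b)); [| apply filterlim_const | exact L].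
    exists y. intros b Hb. apply RInt_ge_0; [lra | apply ex_RInt_cont, H | intros; apply Hp]. }
  apply Rnot_le_lt. intros Hle.
  assert (M : forall a b, a <= b -> tail f b <= tail f a).
  { intros a b Hab. apply (nonincreasing_of_derive (tail f) (fun y => - f y)); [exact Hab | | intros y _; generalize (Hp y); lra].
    intros y _. apply der_tail, H. }
  assert (Z : forall y, x <= y -> tail f y = 0) by (intros y Hy; generalize (N y) (M x y Hy); lra).
  assert (Hx0 := Z x ltac:(lra)).
  assert (Hc := proj1 H x).
  destruct (proj1 (filterlim_locally _ _) Hc (mkposreal (f x) Hx)) as [d Hd].
  assert (Pd := cond_pos d).
  assert (S : 0 < RInt f x (x + d / 2)).
  { apply RInt_gt_0; [lra | | intros; apply H].
    intros y Hy. specialize (Hd y).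
    unfold ball in Hd; simpl in Hd; unfold AbsRing_ball, abs, minus, plus, opp in Hd; simpl in Hd.
    assert (Q : Rabs (y + - x) < d) by (apply Rabs_lt_between; lra).
    specialize (Hd Q). apply Rabs_lt_between in Hd. lra. }
  rewrite (tail_chasles f x (x + d / 2) H), (Z (x + d / 2)) in Hx0 by lra. lra.
Qed.

Lemma int_line_pos (f : R -> R) (x : R) : expo f -> (forall y, 0 <= f y) -> 0 < f x -> 0 < int_line f.
Proof.
  intros H Hp Hx. rewrite (int_line_split f x H).
  assert (A := tail_pos f x H Hp Hx).
  assert (B := tail_pos (fun y => f (- y)) (- x) (expo_reflect f H) (fun y => Hp (- y))). cbv beta in B.
  rewrite Ropp_involutive in B. lra.
Qed.

(** * Operators with a bounded kernel element and their second solution *)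

(** The properties common to the linearisations in U and in V. Positivity of m far out gives
    exponential behaviour there, and forces the bounded k to decay. *)
Record critical (m k : R -> R) : Prop := {
  crit_cont : forall x, continuous m x;
  crit_bounded : exists M, forall x, Rabs (m x) <= M;
  crit_far : exists b X, 0 < b /\ 0 <= X /\ forall x, X <= Rabs x -> b ^ 2 <= m x;
  crit_sol : solves m (fun _ => 0) k;
  crit_kb : exists K, forall x, Rabs (k x) <= K;
  crit_nontrivial : nontrivial k
}.
Arguments crit_cont {m k} _.
Arguments crit_bounded {m k} _.
Arguments crit_far {m k} _.
Arguments crit_sol {m k} _.
Arguments crit_kb {m k} _.
Arguments crit_nontrivial {m k} _.

Lemma exp_le (x y : R) : x <= y -> exp x <= exp y.
Proof. intros [H|H]; [left; apply exp_increasing, H | right; f_equal; exact H]. Qed.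

Lemma square_split (a b : R) : Rabs (a ^ 2 - b ^ 2) <= a ^ 2 + b ^ 2 /\ Rabs (a * b) <= (a ^ 2 + b ^ 2) / 2.
Proof.
  split; apply Rabs_le_between.
  - generalize (pow2_ge_0 a) (pow2_ge_0 b); lra.
  - generalize (pow2_ge_0 (a + b)) (pow2_ge_0 (a - b)); lra.
Qed.

(* In the moving frame (k, k'), (-k', k) the second solution is
   p = al k - k' / rho with rho = k^2 + k'^2, and al' = (1 + m)(k^2 - k'^2) / rho^2;
   the exponential decay of k then bounds al k^2, hence k p. *)
Lemma kernel_dichotomy m k p b X M K :
  0 < b -> 0 <= X -> 0 <= K -> (forall x, X <= x -> b ^ 2 <= m x) -> (forall x, Rabs (m x) <= M) ->
  solves m (fun _ => 0) k -> (forall x, Rabs (k x) <= K) -> nontrivial k ->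
  solves m (fun _ => 0) p ->
  (forall x, k x * Derive p x - Derive k x * p x = 1) ->
  exists C, 0 <= C /\
    (forall x, 0 <= x -> Rabs (k x) <= C * exp (- (b / 2) * x)) /\
    (forall x y, 0 <= y <= x -> Rabs (k x) * Rabs (p y) <= C * exp (- (b / 2) * (x - y))).
Proof.
  intros Hb HX HK Hm HM Hk Bk Hnt Hp HW.
  assert (M0 : 0 <= M) by (generalize (HM 0) (Rabs_pos (m 0)); lra).
  set (rho := fun x => k x ^ 2 + Derive k x ^ 2).
  assert (Pr : forall x, 0 < rho x) by (exact (rho_pos m k M Hk HM Hnt)).
  assert (N := homogeneous_nonzero m k b X M K Hb Hk Hm HM (fun x _ => Bk x) Hnt).
  destruct (homogeneous_decay m k b X K Hb Hk Hm (fun x _ => Bk x)) as [D1 D2].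
  set (al := fun x => (k x * p x + Derive k x * Derive p x) * / rho x).
  set (dal := fun x => (1 + m x) * (k x ^ 2 - Derive k x ^ 2) / rho x ^ 2).
  assert (Dk := solves_der Hk). assert (Dk2 := solves_der2 Hk).
  assert (Dp := solves_der Hp). assert (Dp2 := solves_der2 Hp).
  assert (Drho : forall x, is_derive rho x (2 * k x * Derive k x * (1 + m x))).
  { intros x. apply is_derive_ext with (fun x => k x * k x + Derive k x * Derive k x); [intros; unfold rho; simpl; ring |].
    specialize (Dk x). specialize (Dk2 x). der. ring. }
  assert (Dal : forall x, is_derive al x (dal x)).
  { intros x. assert (Hr := Pr x).
    assert (I : is_derive (fun x => / rho x) x (- (2 * k x * Derive k x * (1 + m x)) / (rho x) ^ 2))
      by (apply der_inv; [apply Drho | lra]).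
    specialize (Dk x). specialize (Dk2 x). specialize (Dp x). specialize (Dp2 x).
    unfold al. der. unfold dal.
    assert (W := HW x). unfold rho in *.
    set (a := k x) in *. set (a1 := Derive k x) in *. set (c := p x) in *. set (c1 := Derive p x) in *. set (mm := m x) in *.
    (* The quotient rule leaves the Wronskian a c1 - a1 c as a factor, and it equals 1. *)
    transitivity ((1 + mm) * ((a ^ 2 - a1 ^ 2) * (a * c1 - a1 * c)) / (a ^ 2 + a1 ^ 2) ^ 2).
    - field. lra.
    - rewrite W. field. lra. }
  assert (Bdal : forall x, X <= x -> Rabs (dal x) <= (1 + M) / k x ^ 2).
  { intros x Hx. unfold dal. specialize (Pr x). assert (Nx := pow2_gt_0 _ (N x Hx)).
    destruct (square_split (k x) (Derive k x)) as [W _].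
    unfold Rdiv. rewrite !Rabs_mult. rewrite (Rabs_pos_eq (/ rho x ^ 2)).
    2:{ left. apply Rinv_0_lt_compat. apply pow_lt, Pr. }
    apply Rle_trans with ((1 + M) * rho x * / rho x ^ 2).
    - apply Rmult_le_compat_r; [left; apply Rinv_0_lt_compat, pow_lt, Pr |].
      apply Rmult_le_compat; try apply Rabs_pos; [| exact W].
      eapply Rle_trans; [apply Rabs_triang |]. rewrite Rabs_R1. specialize (HM x). lra.
    - replace ((1 + M) * rho x * / rho x ^ 2) with ((1 + M) * / rho x) by (field; lra).
      apply Rmult_le_compat_l; [lra |]. apply Rinv_le_contravar; [exact Nx |].
      unfold rho. generalize (pow2_ge_0 (Derive k x)); lra. }
  (* With this c0 the derivative of c0 / k^2 dominates (1 + M) / k^2 >= |al'|, because (k^2)' <= - b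
     k^2; hence |al| grows at most like c0 / k^2. *)
  set (c0 := (1 + M) / b).
  assert (Hc0 : 0 <= c0) by (apply Rdiv_le_0_compat; lra).
  assert (Dy : forall x, X <= x -> is_derive (fun x => c0 * / (k x * k x)) x (c0 * (- (2 * k x * Derive k x) / (k x * k x) ^ 2))).
  { intros x Hx. assert (Nx := N x Hx).
    assert (Q : is_derive (fun x => k x * k x) x (2 * k x * Derive k x)) by (specialize (Dk x); der; ring).
    assert (I := der_inv _ _ _ Q (Rmult_integral_contrapositive_currified _ _ Nx Nx)).
    der. ring. }
  assert (By : forall x, X <= x -> (1 + M) / k x ^ 2 <= c0 * (- (2 * k x * Derive k x) / (k x * k x) ^ 2)).
  { intros x Hx. assert (Nx := N x Hx). specialize (D1 x Hx). assert (P2 := pow2_gt_0 _ Nx).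
    replace ((1 + M) / k x ^ 2) with (c0 * (b * (k x ^ 2)) / (k x ^ 2) ^ 2) by (unfold c0; field; split; [exact Nx | lra]).
    replace ((k x * k x) ^ 2) with ((k x ^ 2) ^ 2) by ring.
    unfold Rdiv. rewrite Rmult_assoc. apply Rmult_le_compat_l; [exact Hc0 |].
    apply Rmult_le_compat_r; [left; apply Rinv_0_lt_compat, pow_lt, P2 | lra]. }
  assert (Bal : forall x, X <= x -> Rabs (al x) * k x ^ 2 <= Rabs (al X) * K ^ 2 + c0).
  { intros x Hx. assert (Nx := N x Hx). assert (P2 := pow2_gt_0 _ Nx).
    assert (NX := N X ltac:(lra)).
    assert (U : Rabs (al x) <= Rabs (al X) + c0 * / (k x * k x)).
    { assert (U1 : al x - c0 * / (k x * k x) <= al X - c0 * / (k X * k X)).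
      { apply (nonincreasing_of_derive (fun x => al x - c0 * / (k x * k x))
          (fun x => dal x - c0 * (- (2 * k x * Derive k x) / (k x * k x) ^ 2))); [exact Hx | |].
        - intros y Hy. apply (der_minus al (fun x => c0 * / (k x * k x))); [apply Dal | apply Dy; lra].
        - intros y Hy. specialize (Bdal y ltac:(lra)). specialize (By y ltac:(lra)).
          generalize (Rle_abs (dal y)); lra. }
      assert (U2 : - al x - c0 * / (k x * k x) <= - al X - c0 * / (k X * k X)).
      { apply (nonincreasing_of_derive (fun x => - al x - c0 * / (k x * k x))
          (fun x => - dal x - c0 * (- (2 * k x * Derive k x) / (k x * k x) ^ 2))); [exact Hx | |].
        - intros y Hy. apply (der_minus (fun x => - al x) (fun x => c0 * / (k x * k x))); [apply der_opp, Dal | apply Dy; lra].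
        - intros y Hy. specialize (Bdal y ltac:(lra)). specialize (By y ltac:(lra)).
          generalize (Rle_abs (- dal y)); rewrite Rabs_Ropp; lra. }
      assert (U3 : 0 <= c0 * / (k X * k X)).
      { apply Rmult_le_pos; [exact Hc0 |]. left. apply Rinv_0_lt_compat. nra. }
      apply Rabs_le_between. generalize (Rle_abs (al X)) (Rle_abs (- al X)). rewrite Rabs_Ropp. lra. }
    apply Rmult_le_compat_r with (r := k x ^ 2) in U; [| lra].
    replace ((Rabs (al X) + c0 * / (k x * k x)) * k x ^ 2) with (Rabs (al X) * k x ^ 2 + c0) in U by (field; exact Nx).
    assert (Q : k x ^ 2 <= K ^ 2) by (rewrite <- (pow2_abs (k x)); apply pow_incr; split; [apply Rabs_pos | apply Bk]).
    assert (Rabs (al X) * k x ^ 2 <= Rabs (al X) * K ^ 2) by (apply Rmult_le_compat_l; [apply Rabs_pos | exact Q]).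
    lra. }
  (* The last 1 / 2 bounds k k' / rho. *)
  set (Bq := Rabs (al X) * K ^ 2 + c0 + 1 / 2).
  assert (Bkp : forall x, X <= x -> Rabs (k x) * Rabs (p x) <= Bq).
  { intros x Hx. rewrite <- Rabs_mult.
    assert (E : k x * p x = al x * k x ^ 2 + - (k x * Derive k x / rho x)).
    { assert (Hr := Pr x). unfold al. assert (W := HW x).
      transitivity ((k x * p x * rho x) / rho x); [field; lra |].
      replace (k x * p x * rho x) with ((k x * p x + Derive k x * Derive p x) * k x ^ 2 - k x * Derive k x * (k x * Derive p x - Derive k x * p x)) by (unfold rho; ring).
      rewrite W. field. lra. }
    rewrite E. eapply Rle_trans; [apply Rabs_triang |]. rewrite Rabs_Ropp, Rabs_mult, (Rabs_pos_eq (k x ^ 2)) by apply pow2_ge_0.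
    apply Rplus_le_compat; [apply Bal, Hx |].
    assert (Hr := Pr x). destruct (square_split (k x) (Derive k x)) as [_ W]. fold (rho x) in W.
    unfold Rdiv at 1. rewrite Rabs_mult, (Rabs_pos_eq (/ rho x)) by (left; apply Rinv_0_lt_compat, Pr).
    apply Rmult_le_reg_r with (rho x); [exact Hr |]. rewrite Rmult_assoc, Rinv_l by lra. lra. }
  destruct (bounded_on_segment p 0 X (solves_cont Hp)) as [P [P0 HP]].
  assert (Bq0 : 0 <= Bq).
  { specialize (Bkp X ltac:(lra)). generalize (Rabs_pos (k X)) (Rabs_pos (p X)). nra. }
  assert (E1 : 1 <= exp (b / 2 * X)).
  { rewrite <- exp_0. apply exp_le. nra. }
  assert (KE : 0 <= K * exp (b / 2 * X)) by (apply Rmult_le_pos; lra).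
  assert (KPE : 0 <= K * P * exp (b / 2 * X)) by nra.
  (* Up to X no decay is available; the factor exp (b X / 2) compensates for that segment. *)
  assert (Far : forall x y, 0 <= y <= x -> y <= X -> Rabs (k x) <= K * exp (b / 2 * X) * exp (- (b / 2) * (x - y))).
  { intros x y Hxy HyX. rewrite Rmult_assoc, <- exp_plus.
    destruct (Rle_or_lt x X) as [HxX|HxX].
    - apply Rle_trans with (K * 1); [rewrite Rmult_1_r; apply Bk |].
      apply Rmult_le_compat_l; [exact HK |]. rewrite <- exp_0. apply exp_le. nra.
    - eapply Rle_trans; [apply (D2 X x); lra |].
      apply Rmult_le_compat; [apply Rabs_pos | left; apply exp_pos | apply Bk |].
      apply exp_le. nra. }
  exists (Bq + K * P * exp (b / 2 * X) + K * exp (b / 2 * X)).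
  split; [lra |]. split.
  - intros x Hx. specialize (Far x 0 ltac:(lra) HX). rewrite Rminus_0_r in Far.
    eapply Rle_trans; [exact Far |]. apply Rmult_le_compat_r; [left; apply exp_pos | lra].
  - intros x y Hxy.
    assert (Pe := exp_pos (- (b / 2) * (x - y))).
    destruct (Rle_or_lt y X) as [HyX|HyX].
    + specialize (Far x y Hxy HyX).
      apply Rle_trans with (K * exp (b / 2 * X) * exp (- (b / 2) * (x - y)) * P).
      * apply Rmult_le_compat; try apply Rabs_pos; [exact Far | apply HP; lra].
      * replace (K * exp (b / 2 * X) * exp (- (b / 2) * (x - y)) * P) with (K * P * exp (b / 2 * X) * exp (- (b / 2) * (x - y))) by ring.
        apply Rmult_le_compat_r; lra.
    + specialize (D2 y x ltac:(lra)). specialize (Bkp y ltac:(lra)).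
      apply Rle_trans with (Rabs (k y) * exp (- (b / 2) * (x - y)) * Rabs (p y)).
      * apply Rmult_le_compat_r; [apply Rabs_pos | exact D2].
      * replace (Rabs (k y) * exp (- (b / 2) * (x - y)) * Rabs (p y)) with (Rabs (k y) * Rabs (p y) * exp (- (b / 2) * (x - y))) by ring.
        apply Rmult_le_compat_r; lra.
Qed.

(** Reduction of order in the form p = al k - k' / rho with rho = k^2 + k'^2, since the usual
    quotient by k^2 fails at zeros of k. Starting the integral al at 0 makes (p, p') orthogonal to
    (k, k') at 0, which is what gives [green] the level 0. *)
Lemma second_solution m k M :
  (forall x, continuous m x) -> (forall x, Rabs (m x) <= M) -> solves m (fun _ => 0) k -> nontrivial k ->
  exists p, solves m (fun _ => 0) p /\ (forall x, k x * Derive p x - Derive k x * p x = 1) /\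
    k 0 * p 0 + Derive k 0 * Derive p 0 = 0.
Proof.
  intros Hm HM Hk Hnt.
  set (rho := fun x => k x ^ 2 + Derive k x ^ 2).
  assert (Pr : forall x, 0 < rho x) by (exact (rho_pos m k M Hk HM Hnt)).
  assert (Dk := solves_der Hk). assert (Dk2 := solves_der2 Hk).
  assert (Drho : forall x, is_derive rho x (2 * k x * Derive k x * (1 + m x))).
  { intros x. apply is_derive_ext with (fun x => k x * k x + Derive k x * Derive k x); [intros; unfold rho; simpl; ring |].
    specialize (Dk x). specialize (Dk2 x). der. ring. }
  assert (Dinv : forall x, is_derive (fun x => / rho x) x (- (2 * k x * Derive k x * (1 + m x)) / (rho x) ^ 2)).
  { intros x. apply der_inv; [apply Drho | generalize (Pr x); lra]. }
  set (dal := fun x => (1 + m x) * (k x * k x - Derive k x * Derive k x) * (/ rho x * / rho x)).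
  assert (Cdal : forall x, continuous dal x).
  { intros x.
    assert (C1 := solves_cont Hk x). assert (C2 := solves_cont1 Hk x).
    assert (C3 := der_continuous _ _ _ (Dinv x)). specialize (Hm x).
    apply (continuous_mult (fun x => (1 + m x) * (k x * k x - Derive k x * Derive k x)) (fun x => / rho x * / rho x)).
    - apply (continuous_mult (fun x => 1 + m x) (fun x => k x * k x - Derive k x * Derive k x)).
      + apply (continuous_plus (fun _ => 1) m); [apply continuous_const | exact Hm].
      + apply (continuous_minus (fun x => k x * k x) (fun x => Derive k x * Derive k x)).
        * apply (continuous_mult k k); assumption.
        * apply (continuous_mult (Derive k) (Derive k)); assumption.
    - apply (continuous_mult (fun x => / rho x) (fun x => / rho x)); assumption. }
  set (al := fun x => RInt dal 0 x).
  assert (Dal : forall x, is_derive al x (dal x)) by (intros x; apply der_RInt, Cdal).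
  set (p1 := fun x => al x * Derive k x + k x * / rho x).
  assert (Dp : forall x, is_derive (fun x => al x * k x - Derive k x * / rho x) x (p1 x)).
  { intros x. specialize (Dal x). specialize (Dk x). specialize (Dk2 x). specialize (Dinv x). assert (Hr := Pr x).
    der. unfold p1, dal, rho in *. field. lra. }
  assert (Dp2 : forall x, is_derive p1 x (m x * (al x * k x - Derive k x * / rho x) - 0)).
  { intros x. specialize (Dal x). specialize (Dk x). specialize (Dk2 x). specialize (Dinv x). assert (Hr := Pr x).
    unfold p1. der. unfold dal, rho in *. field. lra. }
  exists (fun x => al x * k x - Derive k x * / rho x).
  assert (Ed : forall x, Derive (fun x => al x * k x - Derive k x * / rho x) x = p1 x).
  { intros x. apply is_derive_unique, Dp. }
  split; [exact (solves_intro _ _ _ _ Dp Dp2) |]. split.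
  - intros x. rewrite Ed. unfold p1. assert (Hr := Pr x). unfold rho in *. field. lra.
  - rewrite Ed. unfold p1. assert (A0 : al 0 = 0) by (unfold al; apply (RInt_point (V := R_CompleteNormedModule))).
    rewrite A0. ring.
Qed.

(** * Variation of constants *)

(** The growing p is paired with an integral of k h from infinity, and the decaying k with an
    integral of p h from 0, so that each product stays bounded to the right. *)
Definition green (k p h : R -> R) (x : R) : R :=
  p x * tail (fun y => k y * h y) x + k x * RInt (fun y => p y * h y) 0 x.

(* A coordinate along k that vanishes on [green k p h]; for k = phi12 it is d'(0). *)
Definition level (k d : R -> R) : R :=
  (k 0 * d 0 + Derive k 0 * Derive d 0) / (k 0 ^ 2 + Derive k 0 ^ 2).

Lemma green_solves m k p h :
  solves m (fun _ => 0) k -> solves m (fun _ => 0) p ->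
  (forall x, k x * Derive p x - Derive k x * p x = 1) ->
  (forall x, continuous h x) -> expo (fun y => k y * h y) ->
  solves m h (green k p h) /\
  Derive (green k p h) 0 = Derive p 0 * tail (fun y => k y * h y) 0 /\
  green k p h 0 = p 0 * tail (fun y => k y * h y) 0.
Proof.
  intros Hk Hp HW Hh HE.
  assert (Dk := solves_der Hk). assert (Dk2 := solves_der2 Hk).
  assert (Dp := solves_der Hp). assert (Dp2 := solves_der2 Hp).
  set (T := tail (fun y => k y * h y)). set (I := fun x => RInt (fun y => p y * h y) 0 x).
  assert (DT : forall x, is_derive T x (- (k x * h x))) by (intros x; exact (der_tail _ x HE)).
  assert (DI : forall x, is_derive I x (p x * h x)).
  { intros x. apply (der_RInt (fun y => p y * h y)). intros y. apply (continuous_mult p h); [apply (solves_cont Hp) | apply Hh]. }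
  set (g1 := fun x => Derive p x * T x + Derive k x * I x).
  assert (D1 : forall x, is_derive (green k p h) x (g1 x)).
  { intros x. specialize (Dk x). specialize (Dp x). specialize (DT x). specialize (DI x).
    change (is_derive (fun x => p x * T x + k x * I x) x (g1 x)). der. unfold g1. ring. }
  assert (I0 : I 0 = 0) by (unfold I; apply (RInt_point (V := R_CompleteNormedModule))).
  split; [| split].
  - apply solves_intro with g1; [exact D1 |].
    intros x. specialize (DT x). specialize (DI x). specialize (Dk2 x). specialize (Dp2 x).
    unfold g1. der. change (green k p h x) with (p x * T x + k x * I x).
    assert (W := HW x).
    transitivity (m x * (p x * T x + k x * I x) - h x * (k x * Derive p x - Derive k x * p x)); [ring | rewrite W; ring].
  - rewrite (is_derive_unique _ _ _ (D1 0)). unfold g1. rewrite I0. ring.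
  - change (p 0 * T 0 + k 0 * I 0 = p 0 * T 0). rewrite I0. ring.
Qed.

(** Both terms are integrals of h against a kernel bounded by C exp (- g |x - y|), and each
    contributes C / g. *)
Lemma green_bound_right k p h C g H :
  0 < g -> 0 <= C -> (forall x, continuous k x) -> (forall x, continuous p x) ->
  (forall x, continuous h x) -> (forall x, Rabs (h x) <= H) -> expo (fun y => k y * h y) ->
  (forall x y, 0 <= y <= x -> Rabs (k x) * Rabs (p y) <= C * exp (- g * (x - y))) ->
  forall x, 0 <= x -> Rabs (green k p h x) <= 2 * (C / g) * H.
Proof.
  intros Hg HC Ck Cp Ch HH HE D x Hx.
  eapply Rle_trans; [apply Rabs_triang |].
  replace (2 * (C / g) * H) with (C / g * H + C / g * H) by ring.
  apply Rplus_le_compat.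
  (* The factor p x is moved under the integral, so that the dichotomy applies to k y p x with the
     roles of x and y exchanged; the zero term only fits the form of [tail_lin]. *)
  - replace (p x * tail (fun y => k y * h y) x) with (tail (fun y => p x * (k y * h y) + 0 * (k y * h y)) x)
      by (rewrite (tail_lin (fun y => k y * h y) (fun y => k y * h y)) by exact HE; ring).
    replace (C / g * H) with (C * H / g) by (field; lra).
    refine (proj2 (proj2 (tail_lim _ (C * H) g x Hg _ _))).
    + intros y. apply (expo_lin (fun y => k y * h y) (fun y => k y * h y) (p x) 0 HE HE).
    + intros y Hy. replace (p x * (k y * h y) + 0 * (k y * h y)) with (k y * p x * h y) by ring.
      rewrite !Rabs_mult.
      replace (C * H * exp (- g * (y - x))) with (C * exp (- g * (y - x)) * H) by ring.
      apply Rmult_le_compat; [apply Rmult_le_pos; apply Rabs_pos | apply Rabs_pos | apply D; lra | apply HH].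
  - assert (Cf : forall y, continuous (fun y => p y * h y) y) by (intros y; apply (continuous_mult p h); auto).
    assert (E : k x * RInt (fun y => p y * h y) 0 x = RInt (fun y => k x * (p y * h y)) 0 x).
    { symmetry. apply (RInt_scal (V := R_CompleteNormedModule) (fun y => p y * h y) 0 x (k x)), ex_RInt_cont, Cf. }
    rewrite E.
    assert (HI : is_RInt (fun y => C * H * exp (- g * (x - y))) 0 x
            (minus (C * H / g * exp (- g * (x - x))) (C * H / g * exp (- g * (x - 0))))).
    { apply (is_RInt_derive (fun y => C * H / g * exp (- g * (x - y)))).
      - intros y _. auto_derive; [exact I | unfold Rminus; field; lra].
      - intros y _. apply (ex_derive_continuous (fun y => C * H * exp (- g * (x - y)))).
        auto_derive. exact I. }
    assert (Cf' : forall y, continuous (fun y => k x * (p y * h y)) y) by (intros y; apply (continuous_scal_r (k x) (fun y => p y * h y)), Cf).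
    eapply Rle_trans; [apply abs_RInt_le; [lra | apply ex_RInt_cont, Cf'] |].
    eapply Rle_trans; [apply (RInt_le _ (fun y => C * H * exp (- g * (x - y)))); [lra | | eexists; exact HI |] |].
    + apply ex_RInt_cont. intros y. apply (continuous_comp (fun y => k x * (p y * h y)) Rabs); [apply Cf' | apply continuous_Rabs].
    + intros y Hy. replace (k x * (p y * h y)) with (k x * p y * h y) by ring. rewrite !Rabs_mult.
      replace (C * H * exp (- g * (x - y))) with (C * exp (- g * (x - y)) * H) by ring.
      apply Rmult_le_compat; [apply Rmult_le_pos; apply Rabs_pos | apply Rabs_pos | apply D; lra | apply HH].
    + rewrite (is_RInt_unique _ _ _ _ HI). change (C * H / g * exp (- g * (x - x)) + - (C * H / g * exp (- g * (x - 0))) <= C / g * H).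
      replace (- g * (x - x)) with 0 by ring. rewrite exp_0.
      assert (0 <= H) by (generalize (HH 0) (Rabs_pos (h 0)); lra).
      assert (0 <= C * H / g) by (apply Rdiv_le_0_compat; [apply Rmult_le_pos |]; lra).
      assert (P := exp_pos (- g * (x - 0))).
      replace (C / g * H) with (C * H / g) by (field; lra). nra.
Qed.

(** Orthogonality to k turns the tail at - x into minus the integral from - infinity, so the formula
    based at + infinity agrees with the one based at - infinity, which is the same formula for the
    reflected data. *)
Lemma green_reflect k p h x :
  (forall x, continuous p x) -> (forall x, continuous h x) ->
  expo (fun y => k y * h y) -> int_line (fun y => k y * h y) = 0 ->
  green k p h (- x) = green (fun y => k (- y)) (fun y => - p (- y)) (fun y => h (- y)) x.
Proof.
  intros Cp Ch HE H0. unfold green.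
  assert (S := int_line_split _ (- x) HE). rewrite H0, Ropp_involutive in S.
  replace (tail (fun y => k (- y) * h (- y)) x) with (- tail (fun y => k y * h y) (- x)) by lra.
  replace (RInt (fun y => - p (- y) * h (- y)) 0 x) with (RInt (fun y => p y * h y) 0 (- x)); [ring |].
  assert (E := RInt_reflect (fun y => p y * h y) 0 x). rewrite Ropp_0 in E.
  assert (Cf : forall y, continuous (fun y => p y * h y) y) by (intros y; apply (continuous_mult p h); auto).
  specialize (E Cf).
  assert (E2 : RInt (fun y => - p (- y) * h (- y)) 0 x = - RInt (fun y => p (- y) * h (- y)) 0 x).
  { transitivity (RInt (fun y => opp (p (- y) * h (- y))) 0 x).
    - apply RInt_ext. intros y _. unfold opp; simpl. ring.
    - apply (RInt_opp (V := R_CompleteNormedModule) (fun y => p (- y) * h (- y))).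
      apply ex_RInt_cont. intros y.
      apply (continuous_comp (fun y => - y) (fun y => p y * h y)); [| apply Cf].
      apply (continuous_opp (fun y : R => y)), continuous_id. }
  assert (E3 : RInt (fun y => p y * h y) 0 (- x) = - RInt (fun y => p y * h y) (- x) 0).
  { symmetry. apply (opp_RInt_swap (fun y => p y * h y)). apply ex_RInt_cont, Cf. }
  rewrite E2, E3, E. reflexivity.
Qed.

Lemma critical_reflect {m k} : critical m k -> critical (fun x => m (- x)) (fun x => k (- x)).
Proof.
  intros [Hc [M HM] [b [X [Hb [HX Hf]]]] Hs [K HK] [x0 Hx0]]. constructor.
  - intros x. apply (continuous_comp (fun y => - y) m); [| apply Hc].
    apply (continuous_opp (fun y : R => y)), continuous_id.
  - exists M. intros x; apply HM.
  - exists b, X. repeat split; try assumption. intros x Hx. apply Hf. rewrite Rabs_Ropp. exact Hx.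
  - exact (solves_reflect Hs).
  - exists K. intros x; apply HK.
  - exists (- x0). rewrite Ropp_involutive. exact Hx0.
Qed.

(** A second solution normalised by Wronskian 1; the exponential dichotomy itself is derived from
    this in [critical_right]. *)
Record dichotomy (m k p : R -> R) : Prop := {
  dich_sol : solves m (fun _ => 0) p;
  dich_wronskian : forall x, k x * Derive p x - Derive k x * p x = 1
}.
Arguments dich_sol {m k p} _.
Arguments dich_wronskian {m k p} _.

(** Reflection reverses the sign of the Wronskian; the minus sign in front of p restores it. *)
Lemma dichotomy_reflect m k p : solves m (fun _ => 0) k -> dichotomy m k p ->
  dichotomy (fun x => m (- x)) (fun x => k (- x)) (fun x => - p (- x)).
Proof.
  intros Hk [Hs Hw].
  assert (H1 := solves_reflect Hs).
  assert (H2 : solves (fun x => m (- x)) (fun _ => 0) (fun x => - p (- x))).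
  { eapply solves_ext; [reflexivity | | | exact (solves_lin (-1) 0 H1 H1)]; intros x; simpl; ring. }
  constructor; [exact H2 |]. intros x.
  replace (Derive (fun x => - p (- x)) x) with (Derive p (- x)).
  2:{ symmetry. apply is_derive_unique.
      eapply is_derive_eq; [apply der_opp, (der_comp p (fun t => - t)); [apply (solves_der Hs) | der; reflexivity] |]. ring. }
  rewrite (Derive_reflect k) by apply Hk. rewrite <- (Hw (- x)). ring.
Qed.

Lemma critical_right m k p : critical m k -> dichotomy m k p ->
  exists C g, 0 < g /\ 0 <= C /\ (forall x, 0 <= x -> Rabs (k x) <= C * exp (- g * x)) /\
    (forall x y, 0 <= y <= x -> Rabs (k x) * Rabs (p y) <= C * exp (- g * (x - y))).
Proof.
  intros [Hc [M HM] [b [X [Hb [HX Hf]]]] Hs [K HK] Hn] [Hp Hw].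
  assert (K0 : 0 <= K) by (generalize (HK 0) (Rabs_pos (k 0)); lra).
  destruct (kernel_dichotomy m k p b X M K Hb HX K0) as [C [HC [D1 D2]]]; try assumption.
  - intros x Hx. apply Hf. rewrite Rabs_pos_eq; lra.
  - exists C, (b / 2). split; [lra |]. auto.
Qed.

Lemma critical_second {m k} : critical m k -> exists p, dichotomy m k p /\
  k 0 * p 0 + Derive k 0 * Derive p 0 = 0.
Proof.
  intros [Hc [M HM] _ Hs _ Hn].
  destruct (second_solution m k M Hc HM Hs Hn) as [p [H1 [H2 H3]]].
  exists p. split; [constructor |]; assumption.
Qed.

Lemma critical_expo {m k} : critical m k -> expo k.
Proof.
  intros H. assert (H' := critical_reflect H).
  destruct (critical_second H) as [p [Hp _]]. destruct (critical_second H') as [p' [Hp' _]].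
  destruct (critical_right _ _ _ H Hp) as [C [g [Hg [HC [D _]]]]].
  destruct (critical_right _ _ _ H' Hp') as [C' [g' [Hg' [HC' [D' _]]]]].
  split; [apply (solves_cont (crit_sol H)) |].
  assert (Hm : 0 < Rmin g g') by (apply Rmin_glb_lt; assumption).
  exists (C + C'), (Rmin g g'). split; [exact Hm |]. split; [lra |]. intros x.
  assert (E : forall c, Rmin g g' <= c -> exp (- c * Rabs x) <= exp (- Rmin g g' * Rabs x)).
  { intros c Hcc. apply exp_le. generalize (Rabs_pos x); nra. }
  assert (E1 := E g (Rmin_l _ _)). assert (E2 := E g' (Rmin_r _ _)).
  assert (P := exp_pos (- Rmin g g' * Rabs x)).
  destruct (Rle_or_lt 0 x) as [Hx|Hx].
  - rewrite (Rabs_pos_eq x) in * by exact Hx. specialize (D x Hx). nra.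
  - rewrite (Rabs_left x) in * by exact Hx. specialize (D' (- x) ltac:(lra)).
    rewrite Ropp_involutive in D'. nra.
Qed.

Lemma critical_product_expo m k h H : critical m k -> (forall x, continuous h x) ->
  (forall x, Rabs (h x) <= H) -> expo (fun x => k x * h x).
Proof. intros Hc Ch HH. exact (expo_mult k h H (critical_expo Hc) Ch HH). Qed.

(** The right half line is direct. The left one is reduced to it by reflection, and there the
    condition int k h = 0 enters: it keeps the growing p multiplied by a decaying integral. *)
Lemma green_bound m k p : critical m k -> dichotomy m k p ->
  exists C, 0 <= C /\ forall h H, (forall x, continuous h x) -> (forall x, Rabs (h x) <= H) ->
    int_line (fun x => k x * h x) = 0 -> forall x, Rabs (green k p h x) <= C * H.
Proof.
  intros Hc Hd.
  assert (Hc' := critical_reflect Hc). assert (Hd' := dichotomy_reflect _ _ _ (crit_sol Hc) Hd).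
  destruct (critical_right _ _ _ Hc Hd) as [C [g [Hg [HC [_ D]]]]].
  destruct (critical_right _ _ _ Hc' Hd') as [C' [g' [Hg' [HC' [_ D']]]]].
  assert (Q : 0 <= C / g) by (apply Rdiv_le_0_compat; lra).
  assert (Q' : 0 <= C' / g') by (apply Rdiv_le_0_compat; lra).
  exists (2 * (C / g) + 2 * (C' / g')). split; [lra |].
  intros h H Ch HH H0 x.
  assert (H00 : 0 <= H) by (generalize (HH 0) (Rabs_pos (h 0)); lra).
  assert (HE := critical_product_expo m k h H Hc Ch HH).
  assert (Cp := solves_cont (dich_sol Hd)).
  destruct (Rle_or_lt 0 x) as [Hx|Hx].
  - apply Rle_trans with (2 * (C / g) * H); [| nra].
    apply (green_bound_right k p h C g H); try assumption. apply (solves_cont (crit_sol Hc)).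
  - rewrite <- (Ropp_involutive x). rewrite (green_reflect k p h (- x)) by assumption.
    apply Rle_trans with (2 * (C' / g') * H); [| nra].
    apply (green_bound_right _ _ _ C' g' H); try assumption; try lra.
    + apply (solves_cont (crit_sol Hc')).
    + apply (solves_cont (dich_sol Hd')).
    + intros y. apply (continuous_comp (fun y => - y) h); [| apply Ch].
      apply (continuous_opp (fun y : R => y)), continuous_id.
    + intros y. apply HH.
    + exact (expo_reflect _ HE).
Qed.

(** * Solvability condition and the bounded right inverse *)

Lemma small_exp_zero (a C g : R) : 0 < g -> (forall b, 0 <= b -> Rabs a <= C * exp (- g * b)) -> a = 0.
Proof.
  intros Hg H. apply Rabs_eq_0. apply Rle_antisym; [| apply Rabs_pos].
  apply Rnot_lt_le. intros Hpos.
  assert (C0 : 0 < C). { specialize (H 0 ltac:(lra)). replace (- g * 0) with 0 in H by ring. rewrite exp_0 in H. lra. }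
  (* With this b the inequality |a| (1 + g b) <= C reads |a| + C <= C. *)
  set (b := C / (Rabs a * g)).
  assert (Hag : 0 < Rabs a * g) by nra.
  assert (Hb : 0 <= b) by (apply Rdiv_le_0_compat; lra).
  specialize (H b Hb). assert (G := exp_growth g b).
  assert (E : exp (- g * b) * exp (g * b) = 1).
  { rewrite <- exp_plus. replace (- g * b + g * b) with 0 by ring. apply exp_0. }
  assert (P := exp_pos (g * b)).
  apply Rmult_le_compat_r with (r := exp (g * b)) in H; [| lra].
  rewrite Rmult_assoc, E, Rmult_1_r in H.
  assert (Rabs a * (g * b) = C) by (unfold b; field; lra).
  nra.
Qed.

(** Lagrange's identity: w = k d' - k' d has derivative - k f, so the tail of k f minus w is
    constant. It tends to 0, since k and k' decay exponentially while d and d' are bounded, the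
    latter by Landau's inequality. *)
Lemma half_line_identity m k d f D Hf :
  critical m k -> (forall x, continuous f x) -> (forall x, Rabs (f x) <= Hf) ->
  (forall x, Rabs (d x) <= D) -> solves m f d ->
  tail (fun x => k x * f x) 0 = k 0 * Derive d 0 - Derive k 0 * d 0.
Proof.
  intros Hc Cf Bf Bd Hd.
  assert (HE := critical_product_expo m k f Hf Hc Cf Bf).
  destruct (critical_second Hc) as [p [Hp _]].
  destruct (critical_right _ _ _ Hc Hp) as [C [g [Hg [HC [Dk _]]]]].
  assert (Hk := crit_sol Hc). destruct (crit_bounded Hc) as [M HM].
  set (w := fun x => k x * Derive d x - Derive k x * d x).
  assert (Dw : forall x, is_derive w x (- (k x * f x))).
  { intros x. assert (A1 := solves_der Hk x). assert (A2 := solves_der2 Hk x).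
    assert (A3 := solves_der Hd x). assert (A4 := solves_der2 Hd x).
    unfold w. der. ring. }
  assert (Bd1 : forall x, Rabs (Derive d x) <= 2 * D + (M * D + Hf)).
  { intros x. apply (derive_bound d (Derive d) (fun x => m x * d x - f x)).
    - intros y _. apply (solves_der Hd).
    - intros y _. apply (solves_der2 Hd).
    - intros y _. apply Bd.
    - intros y _. eapply Rle_trans; [apply Rabs_triang |]. rewrite Rabs_Ropp, Rabs_mult.
      apply Rplus_le_compat; [apply Rmult_le_compat; try apply Rabs_pos; auto | apply Bf]. }
  assert (Bk1 : forall x, 0 <= x -> Rabs (Derive k x) <= (2 + M) * (C * exp (- g * x))).
  { intros x Hx.
    assert (Mon : forall y, x <= y -> Rabs (k y) <= C * exp (- g * x)).
    { intros y Hy. eapply Rle_trans; [apply Dk; lra |]. apply Rmult_le_compat_l; [exact HC |]. apply exp_le. nra. }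
    replace ((2 + M) * (C * exp (- g * x))) with (2 * (C * exp (- g * x)) + M * (C * exp (- g * x))) by ring.
    apply (derive_bound k (Derive k) (fun x => m x * k x)).
    - intros y _. apply (solves_der Hk).
    - intros y _. eapply is_derive_eq; [apply (solves_der2 Hk) | ring].
    - intros y Hy. apply Mon; lra.
    - intros y Hy. rewrite Rabs_mult. apply Rmult_le_compat; try apply Rabs_pos; [apply HM | apply Mon; lra]. }
  assert (Cst : forall x, 0 <= x -> tail (fun x => k x * f x) x - w x = tail (fun x => k x * f x) 0 - w 0).
  { intros x Hx.
    destruct (mvt_le (fun x => tail (fun x => k x * f x) x - w x) (fun x => - (k x * f x) - - (k x * f x)) 0 x Hx) as [c [_ Ec]].
    - intros y _. apply (der_minus (tail (fun x => k x * f x)) w); [exact (der_tail _ y HE) | apply Dw].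
    - lra. }
  apply Rminus_diag_uniq.
  apply (small_exp_zero _ (C * Hf / g + C * (2 * D + (M * D + Hf)) + (2 + M) * C * D) g Hg).
  intros x Hx. fold (w 0). rewrite <- (Cst x Hx).
  eapply Rle_trans; [apply Rabs_triang |]. rewrite Rabs_Ropp.
  assert (T : Rabs (tail (fun x => k x * f x) x) <= C * Hf / g * exp (- g * x)).
  { replace (C * Hf / g * exp (- g * x)) with (C * Hf * exp (- g * x) / g) by (field; lra).
    refine (proj2 (proj2 (tail_lim _ (C * Hf * exp (- g * x)) g x Hg (proj1 HE) _))).
    intros y Hy. rewrite Rabs_mult.
    replace (C * Hf * exp (- g * x) * exp (- g * (y - x))) with (C * (exp (- g * x) * exp (- g * (y - x))) * Hf) by ring.
    rewrite <- exp_plus. replace (- g * x + - g * (y - x)) with (- g * y) by ring.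
    apply Rmult_le_compat; try apply Rabs_pos; [apply Dk; lra | apply Bf]. }
  assert (W : Rabs (w x) <= C * exp (- g * x) * (2 * D + (M * D + Hf)) + (2 + M) * (C * exp (- g * x)) * D).
  { eapply Rle_trans; [apply Rabs_triang |]. rewrite Rabs_Ropp, !Rabs_mult.
    apply Rplus_le_compat; apply Rmult_le_compat; try apply Rabs_pos; auto. }
  lra.
Qed.

(** The identity on the two half lines, the left one by reflection, produces opposite boundary terms
    at 0. *)
Lemma solvability m k d f D Hf :
  critical m k -> (forall x, continuous f x) -> (forall x, Rabs (f x) <= Hf) ->
  (forall x, Rabs (d x) <= D) -> solves m f d -> int_line (fun x => k x * f x) = 0.
Proof.
  intros Hc Cf Bf Bd Hd.
  assert (HE := critical_product_expo m k f Hf Hc Cf Bf).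
  rewrite (int_line_split _ 0 HE), Ropp_0.
  rewrite (half_line_identity m k d f D Hf) by assumption.
  assert (RL := half_line_identity _ _ (fun x => d (- x)) (fun x => f (- x)) D Hf (critical_reflect Hc)).
  rewrite RL.
  - rewrite (Derive_reflect d), (Derive_reflect k), Ropp_0; [ring | apply Hc | apply Hd].
  - intros y. apply (continuous_comp (fun y => - y) f); [| apply Cf].
    apply (continuous_opp (fun y : R => y)), continuous_id.
  - intros y; apply Bf.
  - intros y; apply Bd.
  - exact (solves_reflect Hd).
Qed.

Lemma critical_rho {m k} : critical m k -> 0 < k 0 ^ 2 + Derive k 0 ^ 2.
Proof.
  intros Hc. destruct (crit_bounded Hc) as [M HM].
  exact (rho_pos m k M (crit_sol Hc) HM (crit_nontrivial Hc) 0).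
Qed.

Lemma critical_norm_pos {m k} : critical m k -> 0 < int_line (fun x => k x * k x).
Proof.
  intros Hc. destruct (crit_nontrivial Hc) as [x Hx]. destruct (crit_kb Hc) as [K HK].
  apply (int_line_pos _ x).
  - exact (critical_product_expo m k k K Hc (solves_cont (crit_sol Hc)) HK).
  - intros y. nra.
  - nra.
Qed.

Lemma level_lin (k d1 d2 : R -> R) (a b : R) : ex_derive d1 0 -> ex_derive d2 0 ->
  level k (fun x => a * d1 x + b * d2 x) = a * level k d1 + b * level k d2.
Proof.
  intros H1 H2. unfold level. rewrite (Derive_lin d1 d2 a b 0 H1 H2). unfold Rdiv. ring.
Qed.

Lemma level_self {m k} : critical m k -> level k k = 1.
Proof. intros H. assert (P := critical_rho H). unfold level. field. lra. Qed.

Lemma critical_bounded_zero m k d D :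
  critical m k -> solves m (fun _ => 0) d -> (forall x, Rabs (d x) <= D) -> level k d = 0 ->
  forall x, d x = 0.
Proof.
  intros Hc Hd HD H0. assert (Hl := level_self Hc).
  destruct Hc as [Cm [M HM] [b [X [Hb [HX Hf]]]] Hs [K HK] Hn].
  destruct (bounded_homogeneous_multiple m d k b X M (D + K)) as [c Ec]; try assumption.
  - intros x Hx. apply Hf. rewrite Rabs_pos_eq; lra.
  - intros x _. generalize (HD x) (HK 0) (Rabs_pos (k 0)); lra.
  - intros x _. generalize (HK x) (HD 0) (Rabs_pos (d 0)); lra.
  - assert (Ed : d = fun x => c * k x + 0 * k x) by (apply functional_extensionality; intros x; rewrite Ec; ring).
    rewrite Ed, level_lin in H0 by apply Hs. rewrite Hl in H0.
    intros x. rewrite Ec. replace c with 0 by lra. ring.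
Qed.

(** At 0 the term with k drops out, since its integral starts there; what remains is a multiple of
    (p, p') at 0, orthogonal to (k, k') by the choice of p. *)
Lemma green_level m k p h H : critical m k -> dichotomy m k p ->
  k 0 * p 0 + Derive k 0 * Derive p 0 = 0 ->
  (forall x, continuous h x) -> (forall x, Rabs (h x) <= H) ->
  solves m h (green k p h) /\ level k (green k p h) = 0.
Proof.
  intros Hc [Hp Hw] H0 Ch HH.
  destruct (green_solves m k p h (crit_sol Hc) Hp Hw Ch (critical_product_expo m k h H Hc Ch HH)) as [E1 [E2 E3]].
  split; [exact E1 |]. unfold level. rewrite E2, E3.
  set (T := tail _ 0).
  replace (k 0 * (p 0 * T) + Derive k 0 * (Derive p 0 * T)) with ((k 0 * p 0 + Derive k 0 * Derive p 0) * T) by ring.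
  rewrite H0. unfold Rdiv. ring.
Qed.

Definition bounded_by (B : R) (f : R -> R) : Prop := forall x, Rabs (f x) <= B.

Definition cont (f : R -> R) : Prop := forall x, continuous f x.

Lemma cont_lin (f g : R -> R) (a b : R) : cont f -> cont g -> cont (fun x => a * f x + b * g x).
Proof.
  intros Hf Hg x. apply (continuous_plus (fun x => a * f x) (fun x => b * g x)).
  - apply (continuous_scal_r a f), Hf.
  - apply (continuous_scal_r b g), Hg.
Qed.

(** A bounded solution exists only for l = int k h / int k^2, so the multiplier is determined by h.
    In the second part D is a qualitative bound: the solution is identified with the constructed
    one, and its estimate then involves H alone. *)
Theorem linear_theory m k : critical m k -> exists C, 0 <= C /\
  (forall h H, cont h -> bounded_by H h ->
     exists d l, solves m (fun x => h x - l * k x) d /\ bounded_by (C * H) d /\ level k d = 0) /\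
  (forall d h H D l, cont h -> bounded_by H h -> bounded_by D d ->
     solves m (fun x => h x - l * k x) d -> level k d = 0 ->
     bounded_by (C * H) d /\ l * int_line (fun x => k x * k x) = int_line (fun x => k x * h x)).
Proof.
  intros Hc.
  assert (Ck : cont k) by exact (solves_cont (crit_sol Hc)).
  destruct (crit_kb Hc) as [K HK]. assert (K0 : 0 <= K) by (generalize (HK 0) (Rabs_pos (k 0)); lra).
  destruct (critical_second Hc) as [p [Hd H0]].
  destruct (green_bound _ _ _ Hc Hd) as [C [HC HG]].
  destruct (int_line_bound k (critical_expo Hc)) as [C1 [HC1 HI]].
  assert (Np := critical_norm_pos Hc). set (n := int_line (fun x => k x * k x)) in *.
  assert (Eint : forall h H l, cont h -> bounded_by H h ->
            int_line (fun x => k x * (h x - l * k x)) = int_line (fun x => k x * h x) - l * n).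
  { intros h H l Ch HH. unfold n.
    replace (fun x => k x * (h x - l * k x)) with (fun x => 1 * (k x * h x) + (- l) * (k x * k x))
      by fext.
    rewrite (int_line_lin (fun x => k x * h x) (fun x => k x * k x)); [ring | |].
    - exact (critical_product_expo m k h H Hc Ch HH).
    - exact (critical_product_expo m k k K Hc Ck HK). }
  assert (Hsub : forall h H l, cont h -> bounded_by H h ->
            cont (fun x => h x - l * k x) /\ bounded_by (H + Rabs l * K) (fun x => h x - l * k x)).
  { intros h H l Ch HH. split.
    - replace (fun x => h x - l * k x) with (fun x => 1 * h x + (- l) * k x) by fext.
      apply cont_lin; assumption.
    - intros x. eapply Rle_trans; [apply Rabs_triang |]. rewrite Rabs_Ropp, Rabs_mult.
      apply Rplus_le_compat; [apply HH |]. apply Rmult_le_compat_l; [apply Rabs_pos | apply HK]. }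
  (* The corrected source h - l k is bounded by (1 + C1 K / n) H, because |l| <= C1 H / n. *)
  set (C2 := C * (1 + C1 / n * K)).
  assert (Q : 0 <= C1 / n) by (apply Rdiv_le_0_compat; lra).
  assert (HC2 : 0 <= C2) by (apply Rmult_le_pos; [exact HC |]; nra).
  assert (PartA : forall h H, cont h -> bounded_by H h ->
     exists d l, solves m (fun x => h x - l * k x) d /\ bounded_by (C2 * H) d /\ level k d = 0).
  { intros h H Ch HH.
    set (l := int_line (fun x => k x * h x) / n).
    destruct (Hsub h H l Ch HH) as [Cs Bs].
    assert (Bl : Rabs l <= C1 / n * H).
    { unfold l, Rdiv. rewrite Rabs_mult, (Rabs_pos_eq (/ n)) by (left; apply Rinv_0_lt_compat, Np).
      replace (C1 * / n * H) with (C1 * H * / n) by ring.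
      apply Rmult_le_compat_r; [left; apply Rinv_0_lt_compat, Np |]. apply HI; assumption. }
    destruct (green_level m k p _ _ Hc Hd H0 Cs Bs) as [S1 S2].
    exists (green k p (fun x => h x - l * k x)), l. split; [exact S1 |]. split; [| exact S2].
    intros x. eapply Rle_trans; [apply (HG _ _ Cs Bs) |].
    - rewrite (Eint h H l Ch HH). unfold l. field. lra.
    - unfold C2. rewrite Rmult_assoc. apply Rmult_le_compat_l; [exact HC |].
      replace ((1 + C1 / n * K) * H) with (H + C1 / n * H * K) by ring.
      apply Rplus_le_compat_l. apply Rmult_le_compat_r; assumption. }
  exists C2. split; [exact HC2 |]. split; [exact PartA |].
  assert (Lam : forall d h H D l, cont h -> bounded_by H h -> bounded_by D d ->
     solves m (fun x => h x - l * k x) d -> l * n = int_line (fun x => k x * h x)).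
  { intros d h H D l Ch HH HD Hs.
    destruct (Hsub h H l Ch HH) as [Cs Bs].
    assert (S := solvability m k d _ D _ Hc Cs Bs HD Hs). cbv beta in S. rewrite (Eint h H l Ch HH) in S. lra. }
  intros d h H D l Ch HH HD Hs Hl. split; [| exact (Lam d h H D l Ch HH HD Hs)].
  destruct (PartA h H Ch HH) as [d0 [l0 [Hs0 [HD0 Hl0]]]].
  assert (El : l = l0).
  { assert (E1 := Lam _ _ _ _ _ Ch HH HD Hs). assert (E2 := Lam _ _ _ _ _ Ch HH HD0 Hs0).
    apply Rmult_eq_reg_r with n; lra. }
  subst l0.
  assert (Z : forall x, 1 * d x + (-1) * d0 x = 0).
  { apply (critical_bounded_zero m k _ (D + C2 * H) Hc).
    - eapply solves_ext; [reflexivity | | reflexivity | exact (solves_lin 1 (-1) Hs Hs0)].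
      intros x; simpl; ring.
    - intros x. eapply Rle_trans; [apply Rabs_triang |].
      replace (Rabs (1 * d x)) with (Rabs (d x)) by (f_equal; ring).
      replace (Rabs (-1 * d0 x)) with (Rabs (d0 x)) by (rewrite <- (Rabs_Ropp (d0 x)); f_equal; ring).
      apply Rplus_le_compat; [apply HD | apply HD0].
    - rewrite level_lin; [rewrite Hl, Hl0; ring | apply Hs | apply Hs0]. }
  intros x. replace (d x) with (d0 x) by (generalize (Z x); lra). apply HD0.
Qed.

(** * Estimates for functions of three variables *)

Lemma of_class_C_S {k F} : of_class_C (S k) F -> of_class_C k F.
Proof.
  revert F; induction k as [|k IH]; intros F H; [split; [apply H | exact I] |].
  destruct H as [H0 [H1 [H2 [H3 H4]]]]. split; [exact H0 |]. split; [exact H1 |].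
  split; [| split]; apply IH; assumption.
Qed.

Lemma continuous_pair {T U V : UniformSpace} (f : T -> U) (g : T -> V) (x : T) :
  continuous f x -> continuous g x -> continuous (fun t => (f t, g t)) x.
Proof.
  intros Hf Hg P [eps He].
  assert (A1 := Hf _ (locally_ball (f x) eps)). assert (A2 := Hg _ (locally_ball (g x) eps)).
  unfold filtermap in *.
  apply (filter_imp (fun t => ball (f x) eps (f t) /\ ball (g x) eps (g t))); [| apply filter_and; assumption].
  intros t [B1 B2]. apply He. split; assumption.
Qed.

Lemma jc_comp (F : R -> R -> R -> R) (f g h : R -> R) :
  jointly_continuous F -> cont f -> cont g -> cont h -> cont (fun x => F (f x) (g x) (h x)).
Proof.
  intros HF Hf Hg Hh x.
  apply (continuous_comp (fun x => ((f x, g x), h x)) (fun q : R * R * R => F (fst (fst q)) (snd (fst q)) (snd q))); [| apply HF].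
  apply continuous_pair; [apply continuous_pair; [apply Hf | apply Hg] | apply Hh].
Qed.

(** Every point has a neighbourhood in which F varies by less than 1, and a finite cover of the cube
    bounds F. *)
Lemma bounded_on_box F r : jointly_continuous F ->
  exists B, 0 <= B /\ forall a b c, Rabs a <= r -> Rabs b <= r -> Rabs c <= r -> Rabs (F a b c) <= B.
Proof.
  intros HF.
  pose (f := fun t : Compactness.Tn 3 R => F (fst t) (fst (snd t)) (fst (snd (snd t)))).
  assert (HD : forall t : Compactness.Tn 3 R, exists d : posreal, forall x, close_n 3 d x t -> Rabs (f x - f t) < 1).
  { intros [t1 [t2 [t3 []]]].
    destruct (proj1 (filterlim_locally _ _) (HF ((t1, t2), t3)) (mkposreal 1 Rlt_0_1)) as [d Hd].
    exists d. intros [x1 [x2 [x3 []]]] [H1 [H2 [H3 _]]].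
    apply (Hd ((x1, x2), x3)). repeat split; assumption. }
  pose (delta := fun t => proj1_sig (constructive_indefinite_description _ (HD t))).
  assert (Hdelta : forall t x, close_n 3 (delta t) x t -> Rabs (f x - f t) < 1)
    by (intros t; exact (proj2_sig (constructive_indefinite_description _ (HD t)))).
  pose (lo := (- r, (- r, (- r, tt))) : Compactness.Tn 3 R).
  pose (hi := (r, (r, (r, tt))) : Compactness.Tn 3 R).
  (* The finite cover is provided under a double negation. *)
  destruct (NNPP _ (compactness_list 3 lo hi delta)) as [l Hl].
  assert (Hmax : exists B, 0 <= B /\ forall t, List.In t l -> Rabs (f t) + 1 <= B).
  { clear Hl. induction l as [|t l [B [B0 HB]]]; [exists 0; split; [lra | intros t []] |].
    exists (Rmax B (Rabs (f t) + 1)). split; [eapply Rle_trans; [exact B0 | apply Rmax_l] |].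
    intros u [<- | Hu]; [apply Rmax_r | eapply Rle_trans; [apply HB, Hu | apply Rmax_l]]. }
  destruct Hmax as [B [B0 HB]]. exists B. split; [exact B0 |]. intros a b c Ha Hb Hc.
  apply Rabs_le_between in Ha. apply Rabs_le_between in Hb. apply Rabs_le_between in Hc.
  destruct (Hl (a, (b, (c, tt)))) as [t [Ht [_ Hclose]]]; [simpl; repeat split; lra |].
  specialize (Hdelta t _ Hclose). specialize (HB t Ht).
  change (F a b c) with (f (a, (b, (c, tt)))).
  generalize (Rabs_triang (f (a, (b, (c, tt))) - f t) (f t)).
  replace (f (a, (b, (c, tt))) - f t + f t) with (f (a, (b, (c, tt)))) by ring. lra.
Qed.

Lemma mvt_between (f : R -> R) (a b : R) : (forall x, ex_derive f x) ->
  exists c, Rmin a b <= c <= Rmax a b /\ f a - f b = Derive f c * (a - b).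
Proof.
  intros H. destruct (MVT_gen f b a (Derive f)) as [c [Hc Ec]].
  - intros x _. apply Derive_correct, H.
  - intros x _. apply cont_pt. apply (ex_derive_continuous f), H.
  - exists c. rewrite Rmin_comm, Rmax_comm. split; assumption.
Qed.

Lemma mvt_coordinates F a1 a2 a3 b1 b2 b3 : of_class_C 1 F ->
  exists c1 c2 c3,
    Rmin a1 b1 <= c1 <= Rmax a1 b1 /\ Rmin a2 b2 <= c2 <= Rmax a2 b2 /\
    Rmin a3 b3 <= c3 <= Rmax a3 b3 /\
    F a1 a2 a3 - F b1 b2 b3 =
      D1 F c1 a2 a3 * (a1 - b1) + D2 F b1 c2 a3 * (a2 - b2) + Dmu F b1 b2 c3 * (a3 - b3).
Proof.
  intros [_ [H _]].
  destruct (mvt_between (fun z => F z a2 a3) a1 b1) as [c1 [Hc1 E1]]; [intros x; exact (proj1 (H x a2 a3)) |].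
  destruct (mvt_between (fun z => F b1 z a3) a2 b2) as [c2 [Hc2 E2]]; [intros x; exact (proj1 (proj2 (H b1 x a3))) |].
  destruct (mvt_between (fun z => F b1 b2 z) a3 b3) as [c3 [Hc3 E3]]; [intros x; exact (proj2 (proj2 (H b1 b2 x))) |].
  exists c1, c2, c3. split; [exact Hc1 |]. split; [exact Hc2 |]. split; [exact Hc3 |].
  unfold D1, D2, Dmu. rewrite <- E1, <- E2, <- E3. ring.
Qed.

Lemma between_abs a b c r : Rmin a b <= c <= Rmax a b -> Rabs a <= r -> Rabs b <= r -> Rabs c <= r.
Proof.
  intros [H1 H2] Ha Hb. apply Rabs_le_between in Ha. apply Rabs_le_between in Hb. apply Rabs_le_between.
  revert H1 H2. unfold Rmin, Rmax. destruct (Rle_dec a b); lra.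
Qed.

Lemma between_dist a b c q : Rmin a b <= c <= Rmax a b -> Rabs (c - q) <= Rabs (a - q) + Rabs (b - q).
Proof.
  intros H. apply (between_abs (a - q) (b - q)).
  - revert H. unfold Rmin, Rmax. destruct (Rle_dec a b), (Rle_dec (a - q) (b - q)); lra.
  - generalize (Rabs_pos (b - q)); lra.
  - generalize (Rabs_pos (a - q)); lra.
Qed.

Definition dist3 (a1 a2 a3 b1 b2 b3 : R) : R := Rabs (a1 - b1) + Rabs (a2 - b2) + Rabs (a3 - b3).

Definition in_box (r a b c : R) : Prop := Rabs a <= r /\ Rabs b <= r /\ Rabs c <= r.

Lemma lipschitz_on_box F r : of_class_C 1 F -> exists L, 0 <= L /\
  forall a1 a2 a3 b1 b2 b3, in_box r a1 a2 a3 -> in_box r b1 b2 b3 ->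
  Rabs (F a1 a2 a3 - F b1 b2 b3) <= L * dist3 a1 a2 a3 b1 b2 b3.
Proof.
  intros HF. assert (HF' := HF). destruct HF' as [_ [_ [[H1 _] [[H2 _] [H3 _]]]]].
  destruct (bounded_on_box _ r H1) as [B1 [P1 Q1]].
  destruct (bounded_on_box _ r H2) as [B2 [P2 Q2]].
  destruct (bounded_on_box _ r H3) as [B3 [P3 Q3]].
  exists (B1 + B2 + B3). split; [lra |].
  intros a1 a2 a3 b1 b2 b3 [Ha1 [Ha2 Ha3]] [Hb1 [Hb2 Hb3]].
  destruct (mvt_coordinates F a1 a2 a3 b1 b2 b3 HF) as [c1 [c2 [c3 [I1 [I2 [I3 ->]]]]]].
  assert (J1 := Q1 c1 a2 a3 (between_abs _ _ _ _ I1 Ha1 Hb1) Ha2 Ha3).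
  assert (J2 := Q2 b1 c2 a3 Hb1 (between_abs _ _ _ _ I2 Ha2 Hb2) Ha3).
  assert (J3 := Q3 b1 b2 c3 Hb1 Hb2 (between_abs _ _ _ _ I3 Ha3 Hb3)).
  unfold dist3.
  eapply Rle_trans; [apply Rabs_triang |].
  eapply Rle_trans; [apply Rplus_le_compat_r, Rabs_triang |]. rewrite !Rabs_mult.
  generalize (Rabs_pos (a1 - b1)) (Rabs_pos (a2 - b2)) (Rabs_pos (a3 - b3)). nra.
Qed.

(** The base point q of the linearisation differs from both arguments, and the error carries the
    factor dist (a, b); separate expansions of F at a and at b would lose it. Coordinatewise mean
    values leave increments of the first derivatives, which are Lipschitz on the box. *)
Lemma taylor_on_box F r : of_class_C 2 F -> exists L, 0 <= L /\
  forall a1 a2 a3 b1 b2 b3 q1 q2 q3,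
  in_box r a1 a2 a3 -> in_box r b1 b2 b3 -> in_box r q1 q2 q3 ->
  Rabs (F a1 a2 a3 - F b1 b2 b3
        - (D1 F q1 q2 q3 * (a1 - b1) + D2 F q1 q2 q3 * (a2 - b2) + Dmu F q1 q2 q3 * (a3 - b3)))
  <= L * (dist3 a1 a2 a3 q1 q2 q3 + dist3 b1 b2 b3 q1 q2 q3) * dist3 a1 a2 a3 b1 b2 b3.
Proof.
  intros HF. assert (HF1 := of_class_C_S HF). destruct HF as [_ [_ [H1 [H2 H3]]]].
  destruct (lipschitz_on_box _ r H1) as [L1 [P1 Q1]].
  destruct (lipschitz_on_box _ r H2) as [L2 [P2 Q2]].
  destruct (lipschitz_on_box _ r H3) as [L3 [P3 Q3]].
  exists (L1 + L2 + L3). split; [lra |].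
  intros a1 a2 a3 b1 b2 b3 q1 q2 q3 [Ha1 [Ha2 Ha3]] [Hb1 [Hb2 Hb3]] Hq.
  destruct (mvt_coordinates F a1 a2 a3 b1 b2 b3 HF1) as [c1 [c2 [c3 [I1 [I2 [I3 ->]]]]]].
  assert (J1 := Q1 c1 a2 a3 q1 q2 q3 (conj (between_abs _ _ _ _ I1 Ha1 Hb1) (conj Ha2 Ha3)) Hq).
  assert (J2 := Q2 b1 c2 a3 q1 q2 q3 (conj Hb1 (conj (between_abs _ _ _ _ I2 Ha2 Hb2) Ha3)) Hq).
  assert (J3 := Q3 b1 b2 c3 q1 q2 q3 (conj Hb1 (conj Hb2 (between_abs _ _ _ _ I3 Ha3 Hb3))) Hq).
  set (S := dist3 a1 a2 a3 q1 q2 q3 + dist3 b1 b2 b3 q1 q2 q3).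
  assert (K1 := between_dist _ _ _ q1 I1). assert (K2 := between_dist _ _ _ q2 I2). assert (K3 := between_dist _ _ _ q3 I3).
  assert (S1 : dist3 c1 a2 a3 q1 q2 q3 <= S).
  { unfold S, dist3. generalize (Rabs_pos (b2 - q2)) (Rabs_pos (b3 - q3)); lra. }
  assert (S2 : dist3 b1 c2 a3 q1 q2 q3 <= S).
  { unfold S, dist3. generalize (Rabs_pos (a1 - q1)) (Rabs_pos (b3 - q3)); lra. }
  assert (S3 : dist3 b1 b2 c3 q1 q2 q3 <= S).
  { unfold S, dist3. generalize (Rabs_pos (a1 - q1)) (Rabs_pos (a2 - q2)); lra. }
  replace (D1 F c1 a2 a3 * (a1 - b1) + D2 F b1 c2 a3 * (a2 - b2) + Dmu F b1 b2 c3 * (a3 - b3) -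
     (D1 F q1 q2 q3 * (a1 - b1) + D2 F q1 q2 q3 * (a2 - b2) + Dmu F q1 q2 q3 * (a3 - b3)))
    with ((D1 F c1 a2 a3 - D1 F q1 q2 q3) * (a1 - b1) + (D2 F b1 c2 a3 - D2 F q1 q2 q3) * (a2 - b2)
          + (Dmu F b1 b2 c3 - Dmu F q1 q2 q3) * (a3 - b3)) by ring.
  assert (T1 : Rabs (D1 F c1 a2 a3 - D1 F q1 q2 q3) <= L1 * S) by nra.
  assert (T2 : Rabs (D2 F b1 c2 a3 - D2 F q1 q2 q3) <= L2 * S) by nra.
  assert (T3 : Rabs (Dmu F b1 b2 c3 - Dmu F q1 q2 q3) <= L3 * S) by nra.
  assert (S0 : 0 <= S) by (eapply Rle_trans; [| exact S1]; unfold dist3; generalize (Rabs_pos (c1 - q1)) (Rabs_pos (a2 - q2)) (Rabs_pos (a3 - q3)); lra).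
  eapply Rle_trans; [apply Rabs_triang |].
  eapply Rle_trans; [apply Rplus_le_compat_r, Rabs_triang |]. rewrite !Rabs_mult.
  set (x1 := Rabs (a1 - b1)) in *. set (x2 := Rabs (a2 - b2)) in *. set (x3 := Rabs (a3 - b3)) in *.
  assert (X1 : 0 <= x1) by apply Rabs_pos. assert (X2 : 0 <= x2) by apply Rabs_pos. assert (X3 : 0 <= x3) by apply Rabs_pos.
  apply Rle_trans with (L1 * S * x1 + L2 * S * x2 + L3 * S * x3).
  - apply Rplus_le_compat; [apply Rplus_le_compat |]; apply Rmult_le_compat_r; assumption.
  - unfold dist3. fold x1 x2 x3.
    assert (A1 : 0 <= L1 * S) by nra.
    assert (A2 : 0 <= L2 * S) by nra.
    assert (A3 : 0 <= L3 * S) by nra.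
    replace ((L1 + L2 + L3) * S * (x1 + x2 + x3)) with ((L1 * S + L2 * S + L3 * S) * (x1 + x2 + x3)) by ring.
    nra.
Qed.

Lemma jc_2d_12 F mu x y : jointly_continuous F -> continuity_2d_pt (fun a b => F a b mu) x y.
Proof.
  intros HF. apply continuity_2d_pt_filterlim.
  apply (continuous_comp (fun z : R * R => (z, mu)) (fun q : R * R * R => F (fst (fst q)) (snd (fst q)) (snd q)) (x, y)); [| apply HF].
  apply continuous_pair; [apply continuous_id | apply continuous_const].
Qed.

Lemma jc_2d_23 F z x y : jointly_continuous F -> continuity_2d_pt (fun a b => F z a b) x y.
Proof.
  intros HF. apply continuity_2d_pt_filterlim.
  apply (continuous_comp (fun w : R * R => ((z, fst w), snd w)) (fun q : R * R * R => F (fst (fst q)) (snd (fst q)) (snd q)) (x, y)); [| apply HF].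
  apply continuous_pair; [apply continuous_pair; [apply continuous_const | apply continuous_fst] | apply continuous_snd].
Qed.

(** Linearising D1 F in v^2 produces [D2 (D1 F)], whereas [U2] is built from [D1 (D2 F)]. *)
Lemma D1_D2_comm F z1 z2 mu : of_class_C 2 F -> D1 (D2 F) z1 z2 mu = D2 (D1 F) z1 z2 mu.
Proof.
  intros [_ [H0 [[_ [H1 [_ [H12 _]]]] [[_ [H2 [H21 _]]] _]]]].
  apply (Schwarz (fun a b => F a b mu) z1 z2).
  - exists (mkposreal 1 Rlt_0_1). intros u v _ _.
    split; [exact (proj1 (H0 u v mu)) | split; [exact (proj1 (proj2 (H0 u v mu))) | split]].
    + exact (proj1 (H2 u v mu)).
    + exact (proj1 (proj2 (H1 u v mu))).
  - exact (jc_2d_12 (D1 (D2 F)) mu z1 z2 (proj1 H21)).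
  - exact (jc_2d_12 (D2 (D1 F)) mu z1 z2 (proj1 H12)).
Qed.

(** In [a2bar] the derivative in mu is taken first; the expansion of D2 F in mu yields the opposite
    order. *)
Lemma D2_Dmu_comm F z1 z2 mu : of_class_C 2 F -> D2 (Dmu F) z1 z2 mu = Dmu (D2 F) z1 z2 mu.
Proof.
  intros [_ [H0 [_ [[_ [H2 [_ [_ H23]]]] [_ [H3 [_ [H32 _]]]]]]]].
  apply (Schwarz (fun a b => F z1 a b) z2 mu).
  - exists (mkposreal 1 Rlt_0_1). intros u v _ _.
    split; [exact (proj1 (proj2 (H0 z1 u v))) | split; [exact (proj2 (proj2 (H0 z1 u v))) | split]].
    + exact (proj1 (proj2 (H3 z1 u v))).
    + exact (proj2 (proj2 (H2 z1 u v))).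
  - exact (jc_2d_23 (D2 (Dmu F)) z1 z2 mu (proj1 H32)).
  - exact (jc_2d_23 (Dmu (D2 F)) z1 z2 mu (proj1 H23)).
Qed.

(** * The projected equations *)

(* The unknowns are W = U - U0 and V.  The right-hand sides are N(x, W, V, mu) and
   G(x, W, V, mu) V; near (0, 0, 0) the increments of N and G are, up to second-order
   terms, gam d(v^2) and al dw + be d(v^2) + ka dmu. *)
Record problem := {
  m1 : R -> R; m2 : R -> R; k1 : R -> R; k2 : R -> R; W2 : R -> R;
  gam : R -> R; al : R -> R; be : R -> R; ka : R -> R;
  NN : R -> R -> R -> R -> R; GG : R -> R -> R -> R -> R;
  a2 : R; b2 : R; L0 : R;
  crit1 : critical m1 k1;
  crit2 : critical m2 k2;
  gam_cont : cont gam; al_cont : cont al; be_cont : cont be; ka_cont : cont ka;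
  gam_bd : bounded_by L0 gam; al_bd : bounded_by L0 al; be_bd : bounded_by L0 be; ka_bd : bounded_by L0 ka;
  W2_sol : solves m1 (fun x => gam x * k2 x ^ 2) W2;
  W2_bd : bounded_by L0 W2;
  W2_level : level k1 W2 = 0;
  NN_cont : forall W V mu, cont W -> cont V -> cont (fun x => NN x (W x) (V x) mu);
  GG_cont : forall W V mu, cont W -> cont V -> cont (fun x => GG x (W x) (V x) mu);
  NN_zero : forall x mu, NN x 0 0 mu = 0;
  GG_zero : forall x, GG x 0 0 0 = 0;
  NN_est : forall x w v w' v' mu, Rabs w <= 1 -> Rabs v <= 1 -> Rabs w' <= 1 -> Rabs v' <= 1 -> Rabs mu <= 1 ->
    Rabs (NN x w v mu - NN x w' v' mu - gam x * (v ^ 2 - v' ^ 2))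
    <= L0 * (Rabs w + v ^ 2 + Rabs mu + (Rabs w' + v' ^ 2 + Rabs mu)) * (Rabs (w - w') + Rabs (v ^ 2 - v' ^ 2));
  GG_est : forall x w v mu w' v' mu', Rabs w <= 1 -> Rabs v <= 1 -> Rabs w' <= 1 -> Rabs v' <= 1 ->
    Rabs mu <= 1 -> Rabs mu' <= 1 ->
    Rabs (GG x w v mu - GG x w' v' mu' - (al x * (w - w') + be x * (v ^ 2 - v' ^ 2) + ka x * (mu - mu')))
    <= L0 * (Rabs w + v ^ 2 + Rabs mu + (Rabs w' + v' ^ 2 + Rabs mu'))
         * (Rabs (w - w') + Rabs (v ^ 2 - v' ^ 2) + Rabs (mu - mu'));
  a2_eq : int_line (fun x => k2 x * (ka x * k2 x)) = - a2;
  b2_eq : int_line (fun x => k2 x * ((al x * W2 x + be x * k2 x ^ 2) * k2 x)) = - b2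
}.

(** Stationary solutions are the case l1 = l2 = 0; for general (a, mu) the multipliers absorb the
    components that the ranges of the linear operators miss. *)
Definition projected (P : problem) (a mu : R) (W V : R -> R) (l1 l2 : R) : Prop :=
  solves (m1 P) (fun x => NN P x (W x) (V x) mu - l1 * k1 P x) W /\
  solves (m2 P) (fun x => GG P x (W x) (V x) mu * V x - l2 * k2 P x) V /\
  level (k1 P) W = 0 /\ level (k2 P) V = a.

Definition small (r mu : R) (W V : R -> R) : Prop :=
  bounded_by r W /\ bounded_by r V /\ Rabs mu <= r.

Lemma cont_mult (f g : R -> R) : cont f -> cont g -> cont (fun x => f x * g x).
Proof. intros Hf Hg x. apply (continuous_mult f g); auto. Qed.

Lemma cont_plus (f g : R -> R) : cont f -> cont g -> cont (fun x => f x + g x).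
Proof. intros Hf Hg x. apply (continuous_plus f g); auto. Qed.

Lemma cont_minus (f g : R -> R) : cont f -> cont g -> cont (fun x => f x - g x).
Proof. intros Hf Hg x. apply (continuous_minus f g); auto. Qed.

Lemma cont_const (c : R) : cont (fun _ => c).
Proof. intros x. apply continuous_const. Qed.

Lemma cont_sqr (f : R -> R) : cont f -> cont (fun x => f x ^ 2).
Proof.
  intros H. replace (fun x => f x ^ 2) with (fun x => f x * f x) by fext.
  apply cont_mult; exact H.
Qed.

Lemma Rabs_mult_le (x y a b : R) : Rabs x <= a -> Rabs y <= b -> Rabs (x * y) <= a * b.
Proof. intros Hx Hy. rewrite Rabs_mult. apply Rmult_le_compat; try apply Rabs_pos; assumption. Qed.

Lemma Rabs_plus_le (x y a b : R) : Rabs x <= a -> Rabs y <= b -> Rabs (x + y) <= a + b.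
Proof. intros Hx Hy. eapply Rle_trans; [apply Rabs_triang | lra]. Qed.

Lemma Rabs_minus_le (x y a b : R) : Rabs x <= a -> Rabs y <= b -> Rabs (x - y) <= a + b.
Proof. intros Hx Hy. apply Rabs_plus_le; [exact Hx | rewrite Rabs_Ropp; exact Hy]. Qed.

Lemma bounded_by_pos {B f} : bounded_by B f -> 0 <= B.
Proof. intros H. generalize (H 0) (Rabs_pos (f 0)); lra. Qed.

(** Absorbing a small multiple of a norm into itself requires the least bound, not merely some
    bound. *)
Lemma sup_norm B f : bounded_by B f ->
  exists S, 0 <= S /\ bounded_by S f /\ forall T, bounded_by T f -> S <= T.
Proof.
  intros H.
  destruct (completeness (fun y => exists x, y = Rabs (f x))) as [S [HS1 HS2]].
  - exists B. intros y [x ->]. apply H.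
  - exists (Rabs (f 0)), 0. reflexivity.
  - assert (HS : bounded_by S f) by (intros x; apply HS1; exists x; reflexivity).
    exists S. split; [exact (bounded_by_pos HS) |]. split; [exact HS |].
    intros T HT. apply HS2. intros y [x ->]. apply HT.
Qed.

Lemma solves_minus {m h1 h2 d1 d2} : solves m h1 d1 -> solves m h2 d2 ->
  solves m (fun x => h1 x - h2 x) (fun x => d1 x - d2 x).
Proof.
  intros H1 H2. eapply solves_ext; [reflexivity | | | exact (solves_lin 1 (-1) H1 H2)]; intros x; simpl; ring.
Qed.

Lemma level_minus (k d1 d2 : R -> R) : ex_derive d1 0 -> ex_derive d2 0 ->
  level k (fun x => d1 x - d2 x) = level k d1 - level k d2.
Proof.
  intros H1 H2. replace (fun x => d1 x - d2 x) with (fun x => 1 * d1 x + (-1) * d2 x) by fext.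
  rewrite level_lin by assumption. ring.
Qed.

Lemma level_scal (k d : R -> R) (c : R) : ex_derive d 0 -> level k (fun x => c * d x) = c * level k d.
Proof.
  intros H. replace (fun x => c * d x) with (fun x => c * d x + 0 * d x) by fext.
  rewrite level_lin by assumption. ring.
Qed.

Lemma solves_scal {m h d} c : solves m h d -> solves m (fun x => c * h x) (fun x => c * d x).
Proof.
  intros H. eapply solves_ext; [reflexivity | | | exact (solves_lin c 0 H H)]; intros x; simpl; ring.
Qed.

(** One L >= 1 dominates the data and the constants of both linear problems, so that the estimates
    below are polynomial in L. *)
Record constants (P : problem) (L : R) : Prop := {
  L_ge1 : 1 <= L;
  L_L0 : L0 P <= L;
  L_k2 : bounded_by L (k2 P);
  L_lin1 : forall d h H D l, cont h -> bounded_by H h -> bounded_by D d ->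
     solves (m1 P) (fun x => h x - l * k1 P x) d -> level (k1 P) d = 0 -> bounded_by (L * H) d;
  L_lin2 : forall d h H D l, cont h -> bounded_by H h -> bounded_by D d ->
     solves (m2 P) (fun x => h x - l * k2 P x) d -> level (k2 P) d = 0 ->
     bounded_by (L * H) d /\ l * int_line (fun x => k2 P x * k2 P x) = int_line (fun x => k2 P x * h x);
  L_int : forall h H, cont h -> bounded_by H h -> Rabs (int_line (fun x => k2 P x * h x)) <= L * H
}.
Arguments L_ge1 {P L} _.
Arguments L_L0 {P L} _.
Arguments L_k2 {P L} _.
Arguments L_lin1 {P L} _.
Arguments L_lin2 {P L} _.
Arguments L_int {P L} _.

Lemma constants_exist P : exists L, constants P L.
Proof.
  destruct (linear_theory _ _ (crit1 P)) as [C1 [HC1 [_ HL1]]].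
  destruct (linear_theory _ _ (crit2 P)) as [C2 [HC2 [_ HL2]]].
  destruct (int_line_bound _ (critical_expo (crit2 P))) as [C3 [HC3 HI]].
  destruct (crit_kb (crit2 P)) as [K HK].
  assert (K0 := bounded_by_pos HK).
  assert (L00 := bounded_by_pos (W2_bd P)).
  exists (1 + L0 P + K + C1 + C2 + C3). constructor; try lra.
  - intros x. generalize (HK x); lra.
  - intros d h H D l Ch HH HD Hs Hl x. assert (H0 := bounded_by_pos HH).
    eapply Rle_trans; [apply (proj1 (HL1 d h H D l Ch HH HD Hs Hl)) |]. apply Rmult_le_compat_r; lra.
  - intros d h H D l Ch HH HD Hs Hl. assert (H0 := bounded_by_pos HH).
    destruct (HL2 d h H D l Ch HH HD Hs Hl) as [E1 E2]. split; [| exact E2].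
    intros x. eapply Rle_trans; [apply E1 |]. apply Rmult_le_compat_r; lra.
  - intros h H Ch HH. assert (H0 := bounded_by_pos HH).
    eapply Rle_trans; [apply HI; eassumption |]. apply Rmult_le_compat_r; lra.
Qed.

Lemma projected_cont P a mu W V l1 l2 : projected P a mu W V l1 l2 -> cont W /\ cont V.
Proof. intros [H1 [H2 _]]. split; [exact (solves_cont H1) | exact (solves_cont H2)]. Qed.

Lemma projected_zero P mu : projected P 0 mu (fun _ => 0) (fun _ => 0) 0 0.
Proof.
  assert (Z : forall m h, (forall x, h x = 0) -> solves m h (fun _ => 0)).
  { intros m h Hh. apply solves_intro with (fun _ => 0); intros x; [apply der_const |].
    rewrite Hh. eapply is_derive_eq; [apply der_const | ring]. }
  split; [| split; [| split]].
  - apply Z. intros x. rewrite NN_zero. ring.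
  - apply Z. intros x. ring.
  - unfold level. rewrite Derive_const. unfold Rdiv. ring.
  - unfold level. rewrite Derive_const. unfold Rdiv. ring.
Qed.

(** * Lipschitz bounds for the nonlinearities *)

Lemma NN_diff P L : constants P L -> forall x w v w' v' mu tau,
  Rabs w <= 1 -> Rabs v <= 1 -> Rabs w' <= 1 -> Rabs v' <= 1 -> Rabs mu <= 1 ->
  Rabs w + v ^ 2 + Rabs mu <= tau -> Rabs w' + v' ^ 2 + Rabs mu <= tau ->
  Rabs (NN P x w v mu - NN P x w' v' mu - gam P x * (v ^ 2 - v' ^ 2))
    <= 2 * L * tau * (Rabs (w - w') + Rabs (v ^ 2 - v' ^ 2)).
Proof.
  intros HL x w v w' v' mu tau Hw Hv Hw' Hv' Hmu T1 T2.
  assert (L1 := L_ge1 HL). assert (L2 := L_L0 HL).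
  eapply Rle_trans; [apply (NN_est P); assumption |].
  apply Rmult_le_compat_r; [generalize (Rabs_pos (w - w')) (Rabs_pos (v ^ 2 - v' ^ 2)); lra |].
  assert (A0 : 0 <= Rabs w + v ^ 2 + Rabs mu + (Rabs w' + v' ^ 2 + Rabs mu)).
  { generalize (Rabs_pos w) (Rabs_pos w') (Rabs_pos mu) (pow2_ge_0 v) (pow2_ge_0 v'); lra. }
  apply Rle_trans with (L * (Rabs w + v ^ 2 + Rabs mu + (Rabs w' + v' ^ 2 + Rabs mu))).
  - apply Rmult_le_compat_r; assumption.
  - replace (2 * L * tau) with (L * (2 * tau)) by ring. apply Rmult_le_compat_l; lra.
Qed.

Lemma GG_diff P L : constants P L -> forall x w v mu w' v' mu' tau,
  Rabs w <= 1 -> Rabs v <= 1 -> Rabs w' <= 1 -> Rabs v' <= 1 -> Rabs mu <= 1 -> Rabs mu' <= 1 ->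
  Rabs w + v ^ 2 + Rabs mu <= tau -> Rabs w' + v' ^ 2 + Rabs mu' <= tau ->
  Rabs (GG P x w v mu - GG P x w' v' mu' - (al P x * (w - w') + be P x * (v ^ 2 - v' ^ 2) + ka P x * (mu - mu')))
    <= 2 * L * tau * (Rabs (w - w') + Rabs (v ^ 2 - v' ^ 2) + Rabs (mu - mu')).
Proof.
  intros HL x w v mu w' v' mu' tau Hw Hv Hw' Hv' Hmu Hmu' T1 T2.
  assert (L1 := L_ge1 HL). assert (L2 := L_L0 HL).
  eapply Rle_trans; [apply (GG_est P); assumption |].
  apply Rmult_le_compat_r; [generalize (Rabs_pos (w - w')) (Rabs_pos (v ^ 2 - v' ^ 2)) (Rabs_pos (mu - mu')); lra |].
  assert (A0 : 0 <= Rabs w + v ^ 2 + Rabs mu + (Rabs w' + v' ^ 2 + Rabs mu')).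
  { generalize (Rabs_pos w) (Rabs_pos w') (Rabs_pos mu) (Rabs_pos mu') (pow2_ge_0 v) (pow2_ge_0 v'); lra. }
  apply Rle_trans with (L * (Rabs w + v ^ 2 + Rabs mu + (Rabs w' + v' ^ 2 + Rabs mu'))).
  - apply Rmult_le_compat_r; assumption.
  - replace (2 * L * tau) with (L * (2 * tau)) by ring. apply Rmult_le_compat_l; lra.
Qed.

Lemma coeff_bounds P L x : constants P L ->
  Rabs (gam P x) <= L /\ Rabs (al P x) <= L /\ Rabs (be P x) <= L /\ Rabs (ka P x) <= L /\
  Rabs (W2 P x) <= L /\ Rabs (k2 P x) <= L.
Proof.
  intros HL. assert (L2 := L_L0 HL).
  repeat split; try apply (L_k2 HL); eapply Rle_trans; try exact L2;
  [apply gam_bd | apply al_bd | apply be_bd | apply ka_bd | apply W2_bd].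
Qed.

(* tau is the size of w, v^2 and mu, and rho that of v. *)
Lemma NN_lip P L : constants P L -> forall x w v w' v' mu tau rho,
  Rabs w <= 1 -> Rabs v <= 1 -> Rabs w' <= 1 -> Rabs v' <= 1 -> Rabs mu <= 1 -> tau <= 1 ->
  Rabs w + v ^ 2 + Rabs mu <= tau -> Rabs w' + v' ^ 2 + Rabs mu <= tau ->
  Rabs v <= rho -> Rabs v' <= rho ->
  Rabs (NN P x w v mu - NN P x w' v' mu) <= 6 * L * rho * Rabs (v - v') + 2 * L * tau * Rabs (w - w').
Proof.
  intros HL x w v w' v' mu tau rho Hw Hv Hw' Hv' Hmu Ht T1 T2 Hr Hr'.
  assert (L1 := L_ge1 HL). destruct (coeff_bounds P L x HL) as [Bg _].
  assert (E := NN_diff P L HL x w v w' v' mu tau Hw Hv Hw' Hv' Hmu T1 T2).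
  assert (Eta : Rabs (v ^ 2 - v' ^ 2) <= 2 * rho * Rabs (v - v')).
  { replace (v ^ 2 - v' ^ 2) with ((v + v') * (v - v')) by ring. rewrite Rabs_mult.
    apply Rmult_le_compat_r; [apply Rabs_pos |]. eapply Rle_trans; [apply Rabs_triang | lra]. }
  set (eta := v ^ 2 - v' ^ 2) in *.
  assert (B1 := Rabs_mult_le _ _ _ _ Bg (Rle_refl (Rabs eta))).
  replace (NN P x w v mu - NN P x w' v' mu) with ((NN P x w v mu - NN P x w' v' mu - gam P x * eta) + gam P x * eta) by ring.
  eapply Rle_trans; [apply (Rabs_plus_le _ _ _ _ E B1) |].
  assert (0 <= Rabs eta) by apply Rabs_pos.
  assert (2 * L * tau * Rabs eta <= 2 * L * 1 * Rabs eta) by (apply Rmult_le_compat_r; [lra | apply Rmult_le_compat_l; lra]).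
  assert (3 * L * Rabs eta <= 3 * L * (2 * rho * Rabs (v - v'))) by nra.
  lra.
Qed.

Lemma GG_bound P L : constants P L -> forall x w v mu tau,
  Rabs w <= 1 -> Rabs v <= 1 -> Rabs mu <= 1 -> tau <= 1 ->
  Rabs w + v ^ 2 + Rabs mu <= tau -> Rabs (GG P x w v mu) <= 3 * L * tau.
Proof.
  intros HL x w v mu tau Hw Hv Hmu Ht T1.
  assert (L1 := L_ge1 HL). destruct (coeff_bounds P L x HL) as [_ [Ba [Bb [Bk _]]]].
  assert (T0 : 0 <= tau) by (generalize (Rabs_pos w) (Rabs_pos mu) (pow2_ge_0 v); lra).
  assert (R0 : Rabs 0 <= 1) by (rewrite Rabs_R0; lra).
  assert (E := GG_diff P L HL x w v mu 0 0 0 tau Hw Hv R0 R0 Hmu R0 T1 ltac:(rewrite Rabs_R0; simpl; lra)).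
  rewrite GG_zero in E. replace (w - 0) with w in E by ring. replace (mu - 0) with mu in E by ring.
  replace (v ^ 2 - 0 ^ 2) with (v ^ 2) in E by ring. rewrite (Rabs_pos_eq (v ^ 2)) in E by apply pow2_ge_0.
  assert (C1 := Rabs_mult_le _ _ _ _ Ba (Rle_refl (Rabs w))).
  assert (C2 := Rabs_mult_le _ _ _ _ Bb (Rle_refl (Rabs (v ^ 2)))).
  assert (C3 := Rabs_mult_le _ _ _ _ Bk (Rle_refl (Rabs mu))).
  rewrite (Rabs_pos_eq (v ^ 2)) in C2 by apply pow2_ge_0.
  assert (S := Rabs_plus_le _ _ _ _ (Rabs_plus_le _ _ _ _ C1 C2) C3).
  set (q := al P x * w + be P x * v ^ 2 + ka P x * mu) in *.
  replace (GG P x w v mu) with ((GG P x w v mu - 0 - q) + q) by ring.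
  eapply Rle_trans; [apply (Rabs_plus_le _ _ _ _ E S) |].
  assert (2 * L * tau * (Rabs w + v ^ 2 + Rabs mu) <= 2 * L * tau * 1) by (apply Rmult_le_compat_l; [| lra]; apply Rmult_le_pos; lra).
  assert (L * (Rabs w + v ^ 2 + Rabs mu) <= L * tau) by nra.
  lra.
Qed.

Lemma GG_lip P L : constants P L -> forall x w v w' v' mu tau rho,
  Rabs w <= 1 -> Rabs v <= 1 -> Rabs w' <= 1 -> Rabs v' <= 1 -> Rabs mu <= 1 -> tau <= 1 ->
  Rabs w + v ^ 2 + Rabs mu <= tau -> Rabs w' + v' ^ 2 + Rabs mu <= tau ->
  Rabs v <= rho -> Rabs v' <= rho -> rho ^ 2 <= tau ->
  Rabs (GG P x w v mu * v - GG P x w' v' mu * v')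
    <= 9 * L * tau * Rabs (v - v') + 3 * L * rho * Rabs (w - w').
Proof.
  intros HL x w v w' v' mu tau rho Hw Hv Hw' Hv' Hmu Ht T1 T2 Hr Hr' Hrt.
  assert (L1 := L_ge1 HL). destruct (coeff_bounds P L x HL) as [_ [Ba [Bb [Bk _]]]].
  assert (Eta : Rabs (v ^ 2 - v' ^ 2) <= 2 * rho * Rabs (v - v')).
  { replace (v ^ 2 - v' ^ 2) with ((v + v') * (v - v')) by ring. rewrite Rabs_mult.
    apply Rmult_le_compat_r; [apply Rabs_pos |]. eapply Rle_trans; [apply Rabs_triang | lra]. }
  assert (E := GG_diff P L HL x w v mu w' v' mu tau Hw Hv Hw' Hv' Hmu Hmu T1 T2).
  replace (mu - mu) with 0 in E by ring. rewrite Rabs_R0, Rmult_0_r, !Rplus_0_r in E.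
  set (eta := v ^ 2 - v' ^ 2) in *. set (dw := w - w') in *. set (dv := v - v') in *.
  assert (C1 := Rabs_mult_le _ _ _ _ Ba (Rle_refl (Rabs dw))).
  assert (C2 := Rabs_mult_le _ _ _ _ Bb (Rle_refl (Rabs eta))).
  assert (S := Rabs_plus_le _ _ _ _ C1 C2).
  assert (Pw : 0 <= Rabs dw) by apply Rabs_pos. assert (Pv : 0 <= Rabs dv) by apply Rabs_pos.
  assert (Pe : 0 <= Rabs eta) by apply Rabs_pos.
  assert (D : Rabs (GG P x w v mu - GG P x w' v' mu) <= 3 * L * (Rabs dw + 2 * rho * Rabs dv)).
  { replace (GG P x w v mu - GG P x w' v' mu) with ((GG P x w v mu - GG P x w' v' mu - (al P x * dw + be P x * eta)) + (al P x * dw + be P x * eta)) by ring.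
    eapply Rle_trans; [apply (Rabs_plus_le _ _ _ _ E S) |].
    assert (2 * L * tau * (Rabs dw + Rabs eta) <= 2 * L * 1 * (Rabs dw + Rabs eta)) by (apply Rmult_le_compat_r; [lra | apply Rmult_le_compat_l; lra]).
    assert (3 * L * (Rabs dw + Rabs eta) <= 3 * L * (Rabs dw + 2 * rho * Rabs dv)) by nra.
    lra. }
  replace (GG P x w v mu * v - GG P x w' v' mu * v') with (GG P x w v mu * dv + (GG P x w v mu - GG P x w' v' mu) * v') by (unfold dv; ring).
  assert (Gb := GG_bound P L HL x w v mu tau Hw Hv Hmu Ht T1).
  eapply Rle_trans; [apply Rabs_plus_le; [exact (Rabs_mult_le _ _ _ _ Gb (Rle_refl (Rabs dv))) | exact (Rabs_mult_le _ _ _ _ D Hr')] |].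
  (* One rho comes from v' and one from v^2 - v'^2; rho^2 <= tau brings this term to the order of
     the first. *)
  assert (rho ^ 2 * (6 * L * Rabs dv) <= tau * (6 * L * Rabs dv)).
  { apply Rmult_le_compat_r; [| exact Hrt]. apply Rmult_le_pos; lra. }
  lra.
Qed.

(** * Differences of two projected solutions *)

Definition sized (rho tau mu : R) (W V : R -> R) : Prop :=
  bounded_by rho V /\ forall x, Rabs (W x) + V x ^ 2 + Rabs mu <= tau.

Lemma small_sized r mu W V : 0 <= r <= 1 -> small r mu W V -> sized r (3 * r) mu W V.
Proof.
  intros Hr [HW [HV Hmu]]. split; [exact HV |]. intros x.
  specialize (HW x). specialize (HV x).
  assert (V x ^ 2 <= r) by (rewrite <- pow2_abs; generalize (Rabs_pos (V x)); nra).
  lra.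
Qed.

(** The ball supplies the absolute smallness needed for absorption, the given bounds supply the
    sharp orders; the minimum has both. *)
Lemma sized_min r rho tau mu W V : 0 <= r <= 1 -> small r mu W V -> sized rho tau mu W V ->
  sized (Rmin r rho) (Rmin (3 * r) tau) mu W V.
Proof.
  intros Hr Hs [H1 H2]. destruct (small_sized r mu W V Hr Hs) as [H3 H4].
  split; intros x; apply Rmin_glb; auto.
Qed.

(** Let s1 and s2 be the sup norms of W - W' and V - V'. The W equation gives s1 = O(rho s2), its
    own term tau s1 being absorbed; inserted into the V equation this leaves a source of size tau
    s2, because rho^2 <= tau. Since V - V' - (a - a') k2 has level 0, the linear estimate bounds it
    by that source, and a second absorption gives s2 = O(|a - a'|). *)
Lemma projected_difference P L : constants P L ->
  let r := / (600 * L ^ 4) in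
  forall a a' mu W V l1 l2 W' V' l1' l2' rho tau,
  projected P a mu W V l1 l2 -> projected P a' mu W' V' l1' l2' ->
  small r mu W V -> small r mu W' V' ->
  sized rho tau mu W V -> sized rho tau mu W' V' -> rho ^ 2 <= tau ->
  bounded_by (2 * L * Rabs (a - a')) (fun x => V x - V' x) /\
  bounded_by (200 * L ^ 5 * tau * Rabs (a - a')) (fun x => V x - V' x - (a - a') * k2 P x) /\
  bounded_by (200 * L ^ 5 * rho * Rabs (a - a')) (fun x => W x - W' x).
Proof.
  intros HL r a a' mu W V l1 l2 W' V' l1' l2' rho0 tau0 HP HP' Hs Hs' Hz0 Hz0' Hrt0.
  assert (L1 := L_ge1 HL).
  assert (L4 : 1 <= L ^ 4) by (apply pow_R1_Rle, L1).
  assert (Hr : 0 < r) by (apply Rinv_0_lt_compat; lra).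
  (* The factor 600 serves the absorptions: with tau <= 3 r it yields 200 L^4 tau <= 1. *)
  assert (Er : 600 * L ^ 4 * r = 1) by (unfold r; field; lra).
  assert (Hr1 : r <= 1) by nra.
  assert (Hz := sized_min r rho0 tau0 mu W V ltac:(lra) Hs Hz0).
  assert (Hz' := sized_min r rho0 tau0 mu W' V' ltac:(lra) Hs' Hz0').
  assert (P0 := bounded_by_pos (proj1 Hz0)).
  set (rho := Rmin r rho0) in *. set (tau := Rmin (3 * r) tau0) in *.
  assert (Hrho : 0 <= rho <= rho0) by (split; [apply Rmin_glb; lra | apply Rmin_r]).
  assert (Hrhor : rho <= r) by apply Rmin_l.
  assert (Htau : tau <= 3 * r) by apply Rmin_l. assert (Htau0 : tau <= tau0) by apply Rmin_r.
  assert (Hrt : rho ^ 2 <= tau) by (apply Rmin_glb; nra).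
  assert (T0 : 0 <= tau) by nra.
  assert (Ht1 : 200 * L ^ 4 * tau <= 1) by nra.
  assert (Htau1 : tau <= 1) by nra.
  assert (Bnd : forall x, (Rabs (W x) <= 1 /\ Rabs (V x) <= 1) /\ (Rabs (W' x) <= 1 /\ Rabs (V' x) <= 1)).
  { intros x. destruct Hs as [A1 [A2 _]], Hs' as [A3 [A4 _]].
    specialize (A1 x). specialize (A2 x). specialize (A3 x). specialize (A4 x). lra. }
  assert (Bmu : Rabs mu <= 1) by (destruct Hs as [_ [_ A]]; lra).
  destruct (projected_cont _ _ _ _ _ _ _ HP) as [CW CV]. destruct (projected_cont _ _ _ _ _ _ _ HP') as [CW' CV'].
  destruct HP as [S1 [S2 [S3 S4]]]. destruct HP' as [S1' [S2' [S3' S4']]].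
  set (d1 := fun x => W x - W' x). set (d2 := fun x => V x - V' x).
  assert (Bd1 : bounded_by (r + r) d1) by (intros x; apply Rabs_minus_le; [apply (proj1 Hs) | apply (proj1 Hs')]).
  assert (Bd2 : bounded_by (r + r) d2) by (intros x; apply Rabs_minus_le; [apply (proj1 (proj2 Hs)) | apply (proj1 (proj2 Hs'))]).
  destruct (sup_norm _ _ Bd1) as [s1 [s1p [Hs1 Hs1min]]]. destruct (sup_norm _ _ Bd2) as [s2 [s2p [Hs2 Hs2min]]].
  set (h1 := fun x => NN P x (W x) (V x) mu - NN P x (W' x) (V' x) mu).
  assert (Ch1 : cont h1) by (apply cont_minus; apply NN_cont; assumption).
  assert (Bh1 : bounded_by (6 * L * rho * s2 + 2 * L * tau * s1) h1).
  { intros x. destruct (Bnd x) as [[B1 B2] [B3 B4]].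
    eapply Rle_trans; [apply (NN_lip P L HL x _ _ _ _ mu tau rho B1 B2 B3 B4 Bmu Htau1 (proj2 Hz x) (proj2 Hz' x) (proj1 Hz x) (proj1 Hz' x)) |].
    apply Rplus_le_compat; apply Rmult_le_compat_l; [| apply Hs2 | | apply Hs1]; apply Rmult_le_pos; lra. }
  assert (Sd1 : solves (m1 P) (fun x => h1 x - (l1 - l1') * k1 P x) d1).
  { eapply solves_ext; [reflexivity | | | exact (solves_minus S1 S1')]; intros x; unfold h1; [ring | reflexivity]. }
  assert (Ld1 : level (k1 P) d1 = 0).
  { unfold d1. rewrite level_minus; [rewrite S3, S3'; ring | apply S1 | apply S1']. }
  assert (E1 := L_lin1 HL d1 h1 _ _ _ Ch1 Bh1 Bd1 Sd1 Ld1).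
  assert (E1' : s1 <= 12 * L ^ 2 * rho * s2).
  { assert (Q := Hs1min _ E1).
    assert (4 * L ^ 2 * tau <= 1) by nra.
    assert (2 * L ^ 2 * tau * s1 <= 1 / 2 * s1) by nra.
    replace (L * (6 * L * rho * s2 + 2 * L * tau * s1)) with (6 * L ^ 2 * rho * s2 + 2 * L ^ 2 * tau * s1) in Q by ring.
    lra. }
  set (h2 := fun x => GG P x (W x) (V x) mu * V x - GG P x (W' x) (V' x) mu * V' x).
  assert (Ch2 : cont h2) by (apply cont_minus; apply cont_mult; try assumption; apply GG_cont; assumption).
  (* Here 45 = 9 + 36: the bound on s1 turns the second term of the Lipschitz estimate into 36 L^3
     rho^2 s2, and rho^2 <= tau. *)
  assert (Bh2 : bounded_by (45 * L ^ 3 * tau * s2) h2).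
  { intros x. destruct (Bnd x) as [[B1 B2] [B3 B4]].
    eapply Rle_trans; [apply (GG_lip P L HL x _ _ _ _ mu tau rho B1 B2 B3 B4 Bmu Htau1 (proj2 Hz x) (proj2 Hz' x) (proj1 Hz x) (proj1 Hz' x) Hrt) |].
    apply Rle_trans with (9 * L * tau * s2 + 3 * L * rho * (12 * L ^ 2 * rho * s2)).
    - apply Rplus_le_compat; apply Rmult_le_compat_l.
      + apply Rmult_le_pos; lra.
      + apply Hs2.
      + apply Rmult_le_pos; lra.
      + eapply Rle_trans; [apply Hs1 | exact E1'].
    - assert (L <= L ^ 3) by nra.
      assert (0 <= tau * s2) by nra.
      assert (L * (tau * s2) <= L ^ 3 * (tau * s2)) by nra.
      assert (rho ^ 2 * (36 * L ^ 3 * s2) <= tau * (36 * L ^ 3 * s2)).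
      { apply Rmult_le_compat_r; [| exact Hrt]. apply Rmult_le_pos; [| exact s2p]. generalize (pow_le L 3); lra. }
      lra. }
  set (z := fun x => V x - V' x - (a - a') * k2 P x).
  assert (K2 := crit_sol (crit2 P)).
  assert (Sd2 : solves (m2 P) (fun x => h2 x - (l2 - l2') * k2 P x) z).
  { eapply solves_ext; [reflexivity | | | exact (solves_minus (solves_minus S2 S2') (solves_scal (a - a') K2))];
      intros x; unfold h2, z; [ring | reflexivity]. }
  assert (Bz : bounded_by (r + r + Rabs (a - a') * L) z).
  { intros x. apply Rabs_minus_le; [apply Bd2 | apply Rabs_mult_le; [lra | apply (L_k2 HL)]]. }
  assert (Lz : level (k2 P) z = 0).
  { unfold z. rewrite (level_minus (k2 P) (fun x => V x - V' x) (fun x => (a - a') * k2 P x)).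
    - rewrite level_minus; [| apply S2 | apply S2']. rewrite S4, S4', level_scal by apply K2.
      rewrite (level_self (crit2 P)). ring.
    - apply (solves_minus S2 S2').
    - apply (solves_scal (a - a') K2). }
  assert (E2 := proj1 (L_lin2 HL z h2 _ _ _ Ch2 Bh2 Bz Sd2 Lz)).
  set (D := Rabs (a - a')) in *.
  assert (E2' : s2 <= 2 * L * D).
  { assert (Q : bounded_by (L * (45 * L ^ 3 * tau * s2) + D * L) d2).
    { intros x. replace (d2 x) with (z x + (a - a') * k2 P x) by (unfold d2, z; ring).
      apply Rabs_plus_le; [apply E2 |]. apply Rabs_mult_le; [unfold D; lra | apply (L_k2 HL)]. }
    assert (Q' := Hs2min _ Q).
    replace (L * (45 * L ^ 3 * tau * s2)) with (45 * L ^ 4 * tau * s2) in Q' by ring.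
    assert (45 * L ^ 4 * tau * s2 <= 1 / 2 * s2) by nra.
    lra. }
  split; [intros x; eapply Rle_trans; [apply Hs2 | exact E2'] |]. split.
  - intros x. eapply Rle_trans; [apply E2 |].
    apply Rle_trans with (L * (45 * L ^ 3 * tau * (2 * L * D))).
    + apply Rmult_le_compat_l; [lra |]. apply Rmult_le_compat_l; [| exact E2'].
      apply Rmult_le_pos; [| exact T0]. generalize (pow_le L 3); lra.
    + replace (L * (45 * L ^ 3 * tau * (2 * L * D))) with (90 * L ^ 5 * D * tau) by ring.
      replace (200 * L ^ 5 * tau0 * D) with (200 * L ^ 5 * D * tau0) by ring.
      assert (0 <= L ^ 5 * D) by nra.
      assert (L ^ 5 * D * tau <= L ^ 5 * D * tau0) by nra.
      assert (0 <= L ^ 5 * D * tau) by nra. lra.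
  - intros x. eapply Rle_trans; [apply Hs1 |]. eapply Rle_trans; [exact E1' |].
    assert (0 <= L ^ 2 * rho) by nra.
    apply Rle_trans with (12 * L ^ 2 * rho * (2 * L * D)); [apply Rmult_le_compat_l; lra |].
    replace (12 * L ^ 2 * rho * (2 * L * D)) with (24 * (L ^ 3 * D) * rho) by ring.
    replace (200 * L ^ 5 * rho0 * D) with (200 * (L ^ 5 * D) * rho0) by ring.
    assert (0 <= L ^ 3 * D) by nra.
    assert (L ^ 3 * D <= L ^ 5 * D) by nra.
    assert (L ^ 3 * D * rho <= L ^ 5 * D * rho0) by nra.
    assert (0 <= L ^ 3 * D * rho) by (apply Rmult_le_pos; lra). lra.
Qed.

(** Three comparisons with the zero solution, each feeding the next: the crude sizes r and 3 r give
    V = O(a); rho = M |a| then gives W = O(a^2); finally tau = O(a^2 + |mu|) gives V - a k2 of that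
    order times |a|. *)
Lemma projected_apriori P L : constants P L ->
  let r := / (600 * L ^ 4) in let M := 200 * L ^ 5 in
  forall a mu W V l1 l2, projected P a mu W V l1 l2 -> small r mu W V ->
  bounded_by (M * Rabs a) V /\ bounded_by (M ^ 2 * a ^ 2) W /\
  bounded_by (2 * M ^ 3 * (a ^ 2 + Rabs mu) * Rabs a) (fun x => V x - a * k2 P x).
Proof.
  intros HL r M a mu W V l1 l2 HP Hs.
  assert (L1 := L_ge1 HL).
  assert (L4 : 1 <= L ^ 4) by (apply pow_R1_Rle, L1).
  assert (L5 : L <= L ^ 5) by nra.
  assert (M1 : 1 <= M) by (unfold M; lra).
  assert (Hr : 0 < r) by (apply Rinv_0_lt_compat; lra).
  assert (Er : 600 * L ^ 4 * r = 1) by (unfold r; field; lra).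
  assert (Hr1 : r <= 1) by nra.
  assert (Hs0 : small r mu (fun _ => 0) (fun _ => 0)).
  { destruct Hs as [_ [_ A]]. repeat split; try exact A; intros x; rewrite Rabs_R0; lra. }
  assert (Hz0 : forall rho tau, 0 <= rho -> Rabs mu <= tau -> sized rho tau mu (fun _ => 0) (fun _ => 0)).
  { intros rho tau H1 H2. split; intros x; rewrite Rabs_R0; [exact H1 | simpl; lra]. }
  assert (D0 : 0 <= Rabs a) by apply Rabs_pos.
  assert (B1 : bounded_by (M * Rabs a) V).
  { destruct (projected_difference P L HL a 0 mu W V l1 l2 _ _ 0 0 r (3 * r) HP (projected_zero P mu) Hs Hs0) as [Q _].
    - apply small_sized; [lra | exact Hs].
    - apply Hz0; [lra | destruct Hs as [_ [_ A]]; lra].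
    - nra.
    - intros x. specialize (Q x). rewrite !Rminus_0_r in Q. eapply Rle_trans; [exact Q |].
      apply Rmult_le_compat_r; [exact D0 | unfold M; lra]. }
  assert (B2 : bounded_by (M ^ 2 * a ^ 2) W).
  { destruct (projected_difference P L HL a 0 mu W V l1 l2 _ _ 0 0 (M * Rabs a) (M ^ 2 * a ^ 2 + 3 * r) HP (projected_zero P mu) Hs Hs0) as [_ [_ Q]].
    - split; [exact B1 |]. intros x. destruct (small_sized r mu W V ltac:(lra) Hs) as [_ A]. specialize (A x).
      generalize (pow2_ge_0 (M * a)). rewrite Rpow_mult_distr. lra.
    - apply Hz0; [nra | destruct Hs as [_ [_ A]]; generalize (pow2_ge_0 (M * a)); rewrite Rpow_mult_distr; lra].
    - rewrite Rpow_mult_distr, pow2_abs. lra.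
    - intros x. specialize (Q x). rewrite !Rminus_0_r in Q. eapply Rle_trans; [exact Q |].
      fold M. right. rewrite <- (pow2_abs a). ring. }
  split; [exact B1 |]. split; [exact B2 |].
  destruct (projected_difference P L HL a 0 mu W V l1 l2 _ _ 0 0 (M * Rabs a) (2 * M ^ 2 * (a ^ 2 + Rabs mu)) HP (projected_zero P mu) Hs Hs0) as [_ [Q _]].
  - split; [exact B1 |]. intros x. specialize (B1 x). specialize (B2 x).
    assert (V x ^ 2 <= M ^ 2 * a ^ 2).
    { rewrite <- (pow2_abs (V x)), <- (pow2_abs a), <- Rpow_mult_distr. apply pow_incr. split; [apply Rabs_pos | exact B1]. }
    assert (1 <= M ^ 2) by nra. generalize (Rabs_pos mu). nra.
  - apply Hz0; [nra |]. assert (1 <= M ^ 2) by nra. generalize (Rabs_pos mu) (pow2_ge_0 a). nra.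
  - rewrite Rpow_mult_distr, pow2_abs. generalize (Rabs_pos mu) (pow2_ge_0 a). nra.
  - intros x. specialize (Q x). rewrite !Rminus_0_r in Q. eapply Rle_trans; [exact Q |].
    fold M. right. ring.
Qed.

(** * Expansions to second order in the amplitude *)

(** The common order of W, V^2 and mu for two solutions of amplitudes a and a'. *)
Definition theta (a a' mu : R) : R := a ^ 2 + a' ^ 2 + Rabs mu.

Record first_estimates (P : problem) (L Q a a' mu : R) (W V W' V' : R -> R) : Prop := {
  fe_V : bounded_by (Q * Rabs a) V;
  fe_V' : bounded_by (Q * Rabs a') V';
  fe_size : forall x, Rabs (W x) + V x ^ 2 + Rabs mu <= Q * theta a a' mu;
  fe_size' : forall x, Rabs (W' x) + V' x ^ 2 + Rabs mu <= Q * theta a a' mu;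
  fe_k : bounded_by (Q * theta a a' mu * Rabs a) (fun x => V x - a * k2 P x);
  fe_k' : bounded_by (Q * theta a a' mu * Rabs a') (fun x => V' x - a' * k2 P x);
  fe_d2 : bounded_by (Q * Rabs (a - a')) (fun x => V x - V' x);
  fe_z : bounded_by (Q * theta a a' mu * Rabs (a - a')) (fun x => V x - V' x - (a - a') * k2 P x);
  fe_d1 : bounded_by (Q * (Rabs a + Rabs a') * Rabs (a - a')) (fun x => W x - W' x)
}.
Arguments fe_V {P L Q a a' mu W V W' V'} _.
Arguments fe_V' {P L Q a a' mu W V W' V'} _.
Arguments fe_size {P L Q a a' mu W V W' V'} _.
Arguments fe_size' {P L Q a a' mu W V W' V'} _.
Arguments fe_k {P L Q a a' mu W V W' V'} _.
Arguments fe_k' {P L Q a a' mu W V W' V'} _.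
Arguments fe_d2 {P L Q a a' mu W V W' V'} _.
Arguments fe_z {P L Q a a' mu W V W' V'} _.
Arguments fe_d1 {P L Q a a' mu W V W' V'} _.

(** Both solutions are measured with rho = M (|a| + |a'|) and tau = 2 M^2 theta; the condition rho^2
    <= tau is (|a| + |a'|)^2 <= 2 theta. *)
Lemma first_estimates_hold P L : constants P L -> exists r Q, 0 < r <= 1 /\ L <= Q /\
  forall a a' mu W V l1 l2 W' V' l1' l2',
  projected P a mu W V l1 l2 -> projected P a' mu W' V' l1' l2' ->
  small r mu W V -> small r mu W' V' -> first_estimates P L Q a a' mu W V W' V'.
Proof.
  intros HL.
  assert (L1 := L_ge1 HL).
  assert (L4 : 1 <= L ^ 4) by (apply pow_R1_Rle, L1).
  assert (L5 : L <= L ^ 5) by nra.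
  set (r := / (600 * L ^ 4)). set (M := 200 * L ^ 5).
  assert (M1 : 200 <= M) by (unfold M; lra).
  assert (Hr : 0 < r) by (apply Rinv_0_lt_compat; lra).
  assert (Er : 600 * L ^ 4 * r = 1) by (unfold r; field; lra).
  assert (Hr1 : r <= 1) by nra.
  assert (M2 : M <= M ^ 2) by nra. assert (M3 : M ^ 2 <= M ^ 3) by nra.
  set (Q := 2 * M ^ 3).
  exists r, Q. split; [lra |]. split; [unfold Q, M in *; lra |].
  intros a a' mu W V l1 l2 W' V' l1' l2' HP HP' Hs Hs'.
  destruct (projected_apriori P L HL a mu W V l1 l2 HP Hs) as [A1 [A2 A3]].
  destruct (projected_apriori P L HL a' mu W' V' l1' l2' HP' Hs') as [A1' [A2' A3']].
  fold M in A1, A2, A3, A1', A2', A3'.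
  assert (Pa := Rabs_pos a). assert (Pa' := Rabs_pos a'). assert (Pm := Rabs_pos mu).
  assert (Sa := pow2_ge_0 a). assert (Sa' := pow2_ge_0 a'). assert (PD := Rabs_pos (a - a')).
  assert (Th : 0 <= theta a a' mu) by (unfold theta; lra).
  set (sg := Rabs a + Rabs a').
  assert (Hsg : sg ^ 2 <= 2 * theta a a' mu).
  { unfold sg, theta. rewrite <- (pow2_abs a), <- (pow2_abs a'). generalize (pow2_ge_0 (Rabs a - Rabs a')). lra. }
  assert (Sq : forall (Z : R -> R) c, bounded_by (M * Rabs c) Z -> forall x, Z x ^ 2 <= M ^ 2 * c ^ 2).
  { intros Z c HZ x. rewrite <- (pow2_abs (Z x)), <- (pow2_abs c), <- Rpow_mult_distr. apply pow_incr.
    split; [apply Rabs_pos | apply HZ]. }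
  assert (T : forall x, Rabs (W x) + V x ^ 2 + Rabs mu <= 2 * M ^ 2 * theta a a' mu).
  { intros x. specialize (A2 x). specialize (Sq V a A1 x). unfold theta. nra. }
  assert (T' : forall x, Rabs (W' x) + V' x ^ 2 + Rabs mu <= 2 * M ^ 2 * theta a a' mu).
  { intros x. specialize (A2' x). specialize (Sq V' a' A1' x). unfold theta. nra. }
  assert (HrT : (M * sg) ^ 2 <= 2 * M ^ 2 * theta a a' mu) by nra.
  destruct (projected_difference P L HL a a' mu W V l1 l2 W' V' l1' l2' (M * sg) (2 * M ^ 2 * theta a a' mu) HP HP' Hs Hs') as [B1 [B2 B3]].
  - split; [| exact T]. intros x. eapply Rle_trans; [apply A1 |]. unfold sg. nra.
  - split; [| exact T']. intros x. eapply Rle_trans; [apply A1' |]. unfold sg. nra.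
  - exact HrT.
  - fold M in B2, B3.
    assert (QM2 : 2 * M ^ 2 <= Q) by (unfold Q; lra).
    constructor.
    + intros x. eapply Rle_trans; [apply A1 |]. apply Rmult_le_compat_r; lra.
    + intros x. eapply Rle_trans; [apply A1' |]. apply Rmult_le_compat_r; lra.
    + intros x. eapply Rle_trans; [apply T |]. apply Rmult_le_compat_r; lra.
    + intros x. eapply Rle_trans; [apply T' |]. apply Rmult_le_compat_r; lra.
    + intros x. eapply Rle_trans; [apply A3 |]. apply Rmult_le_compat_r; [exact Pa |].
      apply Rmult_le_compat_l; [unfold Q; lra |]. unfold theta; lra.
    + intros x. eapply Rle_trans; [apply A3' |]. apply Rmult_le_compat_r; [exact Pa' |].
      apply Rmult_le_compat_l; [unfold Q; lra |]. unfold theta; lra.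
    + intros x. eapply Rle_trans; [apply B1 |]. apply Rmult_le_compat_r; [exact PD |]. unfold M in *; lra.
    + intros x. eapply Rle_trans; [apply B2 |]. right. unfold Q. ring.
    + intros x. eapply Rle_trans; [apply B3 |]. apply Rmult_le_compat_r; [exact PD |].
      replace (M * (M * sg)) with (M ^ 2 * sg) by ring. apply Rmult_le_compat_r; [unfold sg |]; lra.
Qed.

Lemma small_bounds r mu W V : r <= 1 -> small r mu W V ->
  (forall x, Rabs (W x) <= 1 /\ Rabs (V x) <= 1) /\ Rabs mu <= 1.
Proof.
  intros Hr [A1 [A2 A3]]. split; [| lra]. intros x. specialize (A1 x). specialize (A2 x). lra.
Qed.

Lemma sum_sq_le (a a' mu : R) : (Rabs a + Rabs a') ^ 2 <= 2 * theta a a' mu.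
Proof.
  unfold theta. rewrite <- (pow2_abs a), <- (pow2_abs a').
  generalize (pow2_ge_0 (Rabs a - Rabs a')) (Rabs_pos mu). lra.
Qed.

Lemma theta_pos (a a' mu : R) : 0 <= theta a a' mu.
Proof. unfold theta. generalize (pow2_ge_0 a) (pow2_ge_0 a') (Rabs_pos mu). lra. Qed.

(** V^2 - V'^2 factors as (V + V') (V - V'). Replacing the two factors by (a + a') k2 and (a - a')
    k2 costs a relative factor theta each time and keeps the factor a - a'. *)
Lemma eta_expansion P L Q a a' mu W V W' V' : 1 <= L -> L <= Q -> constants P L ->
  first_estimates P L Q a a' mu W V W' V' ->
  let s := Rabs a + Rabs a' in let D := Rabs (a - a') in
  (forall x, Rabs (V x ^ 2 - V' x ^ 2) <= 2 * Q ^ 2 * s * D) /\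
  (forall x, Rabs (V x ^ 2 - V' x ^ 2 - (a ^ 2 - a' ^ 2) * k2 P x ^ 2) <= 2 * Q ^ 2 * theta a a' mu * s * D).
Proof.
  intros L1 LQ HL HF s D. destruct HF as [V1 V1' Sz Sz' K K' D2 Z D1].
  assert (Pa := Rabs_pos a). assert (Pa' := Rabs_pos a'). assert (Th := theta_pos a a' mu).
  assert (PD : 0 <= D) by apply Rabs_pos. assert (Ps : 0 <= s) by (unfold s; lra).
  set (t := theta a a' mu) in *. fold D in D2, Z.
  split; intros x.
  - replace (V x ^ 2 - V' x ^ 2) with ((V x + V' x) * (V x - V' x)) by ring.
    eapply Rle_trans; [apply Rabs_mult_le; [apply Rabs_plus_le; [apply V1 | apply V1'] | apply D2] |].
    replace ((Q * Rabs a + Q * Rabs a') * (Q * D)) with (Q ^ 2 * s * D) by (unfold s; ring).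
    assert (0 <= Q ^ 2 * s * D) by (apply Rmult_le_pos; [apply Rmult_le_pos; [apply pow2_ge_0 |] |]; assumption). lra.
  - replace (V x ^ 2 - V' x ^ 2 - (a ^ 2 - a' ^ 2) * k2 P x ^ 2)
      with (((V x - a * k2 P x) + (V' x - a' * k2 P x)) * (V x - V' x)
            + ((a + a') * k2 P x) * (V x - V' x - (a - a') * k2 P x)) by ring.
    eapply Rle_trans; [apply Rabs_plus_le; apply Rabs_mult_le |].
    + apply Rabs_plus_le; [apply K | apply K'].
    + apply D2.
    + apply Rabs_mult_le; [apply Rabs_triang | apply (L_k2 HL)].
    + apply Z.
    + fold s. replace ((Q * t * Rabs a + Q * t * Rabs a') * (Q * D)) with (Q * Q * (t * s * D)) by (unfold s; ring).
      replace (s * L * (Q * t * D)) with (L * Q * (t * s * D)) by ring.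
      replace (2 * Q ^ 2 * t * s * D) with (Q * Q * (t * s * D) + Q * Q * (t * s * D)) by ring.
      assert (0 <= t * s * D) by (apply Rmult_le_pos; [apply Rmult_le_pos |]; assumption).
      apply Rplus_le_compat_l. apply Rmult_le_compat_r; [assumption |]. apply Rmult_le_compat_r; lra.
Qed.

(** Since W2 solves the equation with source gam k2^2, subtracting (a^2 - a'^2) W2 from W - W'
    removes the leading part of the source. The rest is of higher order, and the linear estimate
    applies because all functions involved have level 0. *)
Lemma W_expansion P L : constants P L -> exists r Q, 0 < r <= 1 /\ L <= Q /\
  forall a a' mu W V l1 l2 W' V' l1' l2',
  projected P a mu W V l1 l2 -> projected P a' mu W' V' l1' l2' ->
  small r mu W V -> small r mu W' V' -> first_estimates P L Q a a' mu W V W' V' /\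
  bounded_by (8 * Q ^ 5 * theta a a' mu * (Rabs a + Rabs a') * Rabs (a - a'))
    (fun x => W x - W' x - (a ^ 2 - a' ^ 2) * W2 P x).
Proof.
  intros HL. destruct (first_estimates_hold P L HL) as [r [Q [Hr [LQ H]]]].
  exists r, Q. split; [exact Hr |]. split; [exact LQ |].
  intros a a' mu W V l1 l2 W' V' l1' l2' HP HP' Hs Hs'.
  assert (FE := H _ _ _ _ _ _ _ _ _ _ _ HP HP' Hs Hs'). split; [exact FE |].
  assert (L1 := L_ge1 HL).
  destruct (eta_expansion P L Q a a' mu W V W' V' L1 LQ HL FE) as [Et1 Et2].
  destruct (small_bounds r mu W V (proj2 Hr) Hs) as [B Bmu]. destruct (small_bounds r mu W' V' (proj2 Hr) Hs') as [B' _].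
  destruct (projected_cont _ _ _ _ _ _ _ HP) as [CW CV]. destruct (projected_cont _ _ _ _ _ _ _ HP') as [CW' CV'].
  destruct HP as [S1 [_ [S3 _]]]. destruct HP' as [S1' [_ [S3' _]]].
  assert (Th := theta_pos a a' mu).
  set (t := theta a a' mu) in *. set (s := Rabs a + Rabs a') in *.
  assert (Ps : 0 <= s) by (unfold s; generalize (Rabs_pos a) (Rabs_pos a'); lra).
  set (D := Rabs (a - a')) in *. assert (PD : 0 <= D) by apply Rabs_pos.
  assert (PtsD : 0 <= t * s * D) by (apply Rmult_le_pos; [apply Rmult_le_pos |]; assumption).
  assert (Q2 : Q <= Q ^ 2) by nra. assert (Q3 : Q ^ 2 <= Q ^ 3) by nra.
  assert (Q4 : Q ^ 3 <= Q ^ 4) by nra.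
  set (h := fun x => NN P x (W x) (V x) mu - NN P x (W' x) (V' x) mu - (a ^ 2 - a' ^ 2) * (gam P x * k2 P x ^ 2)).
  assert (Ck2 : cont (k2 P)) by exact (solves_cont (crit_sol (crit2 P))).
  assert (Ch : cont h).
  { apply cont_minus; [apply cont_minus; apply NN_cont; assumption |].
    apply cont_mult; [apply cont_const | apply cont_mult; [apply gam_cont | apply cont_sqr, Ck2]]. }
  assert (Bh : bounded_by (8 * Q ^ 4 * t * s * D) h).
  { intros x. destruct (B x) as [B1 B2], (B' x) as [B3 B4].
    assert (E := NN_diff P L HL x _ _ _ _ mu _ B1 B2 B3 B4 Bmu (fe_size FE x) (fe_size' FE x)).
    fold t in E.
    destruct (coeff_bounds P L x HL) as [Bg _].
    set (eta := V x ^ 2 - V' x ^ 2) in *.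
    replace (h x) with ((NN P x (W x) (V x) mu - NN P x (W' x) (V' x) mu - gam P x * eta)
       + gam P x * (eta - (a ^ 2 - a' ^ 2) * k2 P x ^ 2)) by (unfold h; ring).
    eapply Rle_trans; [apply Rabs_plus_le; [exact E | apply Rabs_mult_le; [exact Bg | apply Et2]] |].
    assert (D1 := fe_d1 FE x). fold s D in D1.
    specialize (Et1 x). fold eta s D in Et1.
    apply Rle_trans with (2 * Q * (Q * t) * (Q * s * D + 2 * Q ^ 2 * s * D) + Q * (2 * Q ^ 2 * t * s * D)).
    - apply Rplus_le_compat.
      + apply Rmult_le_compat.
        * apply Rmult_le_pos; [lra |]. apply Rmult_le_pos; lra.
        * apply Rplus_le_le_0_compat; apply Rabs_pos.
        * apply Rmult_le_compat_r; [apply Rmult_le_pos |]; lra.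
        * lra.
      + apply Rmult_le_compat_r; [| lra].
        replace (2 * Q ^ 2 * t * s * D) with (2 * Q ^ 2 * (t * s * D)) by ring.
        apply Rmult_le_pos; [|exact PtsD]. generalize (pow2_ge_0 Q); lra.
    - replace (2 * Q * (Q * t) * (Q * s * D + 2 * Q ^ 2 * s * D) + Q * (2 * Q ^ 2 * t * s * D))
        with ((4 * Q ^ 3 + 4 * Q ^ 4) * (t * s * D)) by ring.
      replace (8 * Q ^ 4 * t * s * D) with (8 * Q ^ 4 * (t * s * D)) by ring.
      apply Rmult_le_compat_r; [exact PtsD | lra]. }
  assert (Sd : solves (m1 P) (fun x => h x - (l1 - l1') * k1 P x) (fun x => W x - W' x - (a ^ 2 - a' ^ 2) * W2 P x)).
  { eapply solves_ext; [reflexivity | | | exact (solves_minus (solves_minus S1 S1') (solves_scal (a ^ 2 - a' ^ 2) (W2_sol P)))];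
      intros x; unfold h; [ring | reflexivity]. }
  assert (Bd : bounded_by (Q * s * D + Rabs (a ^ 2 - a' ^ 2) * L) (fun x => W x - W' x - (a ^ 2 - a' ^ 2) * W2 P x)).
  { intros x. apply Rabs_minus_le; [apply (fe_d1 FE x) |].
    apply Rabs_mult_le; [lra | apply (coeff_bounds P L x HL)]. }
  assert (Ld : level (k1 P) (fun x => W x - W' x - (a ^ 2 - a' ^ 2) * W2 P x) = 0).
  { rewrite (level_minus (k1 P) (fun x => W x - W' x) (fun x => (a ^ 2 - a' ^ 2) * W2 P x)).
    - rewrite level_minus; [| apply S1 | apply S1']. rewrite S3, S3', level_scal by apply (W2_sol P).
      rewrite W2_level. ring.
    - apply (solves_minus S1 S1').
    - apply (solves_scal (a ^ 2 - a' ^ 2) (W2_sol P)). }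
  intros x. eapply Rle_trans; [apply (L_lin1 HL _ h _ _ _ Ch Bh Bd Sd Ld) |].
  replace (L * (8 * Q ^ 4 * t * s * D)) with (L * (8 * Q ^ 4 * (t * s * D))) by ring.
  replace (8 * Q ^ 5 * t * s * D) with (Q * (8 * Q ^ 4 * (t * s * D))) by ring.
  apply Rmult_le_compat_r; [| exact LQ]. apply Rmult_le_pos; [lra | exact PtsD].
Qed.

Lemma small_zero r mu W V : small r mu W V -> 0 <= r -> small r mu (fun _ => 0) (fun _ => 0).
Proof. intros [_ [_ H]] Hr. repeat split; try exact H; intros x; rewrite Rabs_R0; exact Hr. Qed.

(* Subtracting the trivial solution (a' = 0), the last estimate is the reduced
   bifurcation equation n l2 = - a (b2 a^2 + a2 mu) + h.o.t. *)
Theorem projected_expansion P L : constants P L -> exists r Q, 0 < r <= 1 /\ 1 <= Q /\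
  forall a a' mu W V l1 l2 W' V' l1' l2',
  projected P a mu W V l1 l2 -> projected P a' mu W' V' l1' l2' ->
  small r mu W V -> small r mu W' V' ->
  bounded_by (Q * Rabs a) V /\ bounded_by (Q * theta a a' mu) W /\
  bounded_by (Q * theta a a' mu * Rabs (a - a')) (fun x => V x - V' x - (a - a') * k2 P x) /\
  bounded_by (Q * theta a a' mu * (Rabs a + Rabs a') * Rabs (a - a'))
    (fun x => W x - W' x - (a ^ 2 - a' ^ 2) * W2 P x) /\
  Rabs ((l2 - l2') * int_line (fun x => k2 P x * k2 P x)
        + (a - a') * (b2 P * (a ^ 2 + a * a' + a' ^ 2) + a2 P * mu))
    <= Q * theta a a' mu ^ 2 * Rabs (a - a').
Proof.
  intros HL. destruct (W_expansion P L HL) as [r [Q0 [Hr [LQ0 H]]]].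
  assert (L1 := L_ge1 HL).
  assert (LQ5 : Q0 <= Q0 ^ 5) by (rewrite <- (pow_1 Q0) at 1; apply Rle_pow; [lra | auto]).
  set (Q := 8 * Q0 ^ 5). assert (Q0Q : Q0 <= Q) by (unfold Q; lra).
  assert (Q1 : 1 <= Q) by lra. assert (LQ : L <= Q) by lra.
  assert (Q2 : Q <= Q ^ 2) by nra. assert (Q3 : Q ^ 2 <= Q ^ 3) by nra.
  assert (Q4 : Q ^ 3 <= Q ^ 4) by nra.
  assert (Q5 : Q ^ 4 <= Q ^ 5) by nra.
  assert (Q6 : Q ^ 5 <= Q ^ 6) by nra.
  exists r, (40 * Q ^ 6). split; [exact Hr |]. split; [lra |].
  intros a a' mu W V l1 l2 W' V' l1' l2' HP HP' Hs Hs'.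
  (* A second comparison, with the zero solution, supplies the expansion of W itself in addition to
     that of W - W'. *)
  assert (Hs0 := small_zero r mu W V Hs ltac:(lra)).
  destruct (H _ _ _ _ _ _ _ _ _ _ _ HP HP' Hs Hs') as [FE WE].
  destruct (H _ _ _ _ _ _ _ _ _ _ _ HP (projected_zero P mu) Hs Hs0) as [_ WE0].
  destruct (eta_expansion P L Q0 a a' mu W V W' V' L1 LQ0 HL FE) as [Et1 Et2].
  destruct (small_bounds r mu W V (proj2 Hr) Hs) as [B Bmu]. destruct (small_bounds r mu W' V' (proj2 Hr) Hs') as [B' _].
  destruct (projected_cont _ _ _ _ _ _ _ HP) as [CW CV]. destruct (projected_cont _ _ _ _ _ _ _ HP') as [CW' CV'].
  assert (Th := theta_pos a a' mu). assert (Ssq := sum_sq_le a a' mu).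
  assert (Ta : a ^ 2 + Rabs mu <= theta a a' mu) by (unfold theta; generalize (pow2_ge_0 a'); lra).
  destruct FE as [V1 V1' Sz Sz' K K' D2 Z D1].
  set (t := theta a a' mu) in *. set (s := Rabs a + Rabs a') in *.
  assert (Pa := Rabs_pos a). assert (Pa' := Rabs_pos a').
  assert (Ps : 0 <= s) by (unfold s; lra). assert (Psa : Rabs a <= s) by (unfold s; lra). assert (Psa' : Rabs a' <= s) by (unfold s; lra).
  set (D := Rabs (a - a')) in *. assert (PD : 0 <= D) by apply Rabs_pos.
  assert (Pmu := Rabs_pos mu). assert (Pa2 := pow2_ge_0 a).
  assert (PtD : 0 <= t * D) by nra.
  assert (PtsD : 0 <= t * s * D) by nra.
  assert (PttD : 0 <= t * t * D) by nra.
  assert (QQ : forall x c c' , 0 <= x -> 0 <= c <= c' -> c * x <= c' * x) by (intros; apply Rmult_le_compat_r; lra).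
  assert (Q02 : 0 <= Q0 ^ 2 <= Q ^ 2) by nra.
  assert (V1'q : bounded_by (Q * Rabs a') V') by (intros x; eapply Rle_trans; [apply V1' | apply QQ; lra]).
  assert (Szq : forall x, Rabs (W x) + V x ^ 2 + Rabs mu <= Q * t) by (intros x; eapply Rle_trans; [apply Sz | apply QQ; lra]).
  assert (Szq' : forall x, Rabs (W' x) + V' x ^ 2 + Rabs mu <= Q * t) by (intros x; eapply Rle_trans; [apply Sz' | apply QQ; lra]).
  assert (Kq : bounded_by (Q * (t * Rabs a)) (fun x => V x - a * k2 P x)).
  { intros x; eapply Rle_trans; [apply K |]. rewrite Rmult_assoc. apply QQ; [apply Rmult_le_pos |]; lra. }
  assert (Kq' : bounded_by (Q * (t * Rabs a')) (fun x => V' x - a' * k2 P x)).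
  { intros x; eapply Rle_trans; [apply K' |]. rewrite Rmult_assoc. apply QQ; [apply Rmult_le_pos |]; lra. }
  assert (D2q : bounded_by (Q * D) (fun x => V x - V' x)) by (intros x; eapply Rle_trans; [apply D2 | apply QQ; lra]).
  assert (Zq : bounded_by (Q * (t * D)) (fun x => V x - V' x - (a - a') * k2 P x)).
  { intros x; eapply Rle_trans; [apply Z |]. rewrite Rmult_assoc. apply QQ; lra. }
  assert (D1q : bounded_by (Q * (s * D)) (fun x => W x - W' x)).
  { intros x; eapply Rle_trans; [apply D1 |]. rewrite Rmult_assoc. apply QQ; [apply Rmult_le_pos |]; lra. }
  assert (WEq : bounded_by (Q * (t * s * D)) (fun x => W x - W' x - (a ^ 2 - a' ^ 2) * W2 P x)).
  { intros x; eapply Rle_trans; [apply WE |]. fold Q. right. ring. }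
  assert (WE0q : bounded_by (Q * (t * a ^ 2)) (fun x => W x - a ^ 2 * W2 P x)).
  { intros x. specialize (WE0 x). fold Q in WE0.
    replace (W x - a ^ 2 * W2 P x) with (W x - 0 - (a ^ 2 - 0 ^ 2) * W2 P x) by ring.
    eapply Rle_trans; [exact WE0 |]. rewrite Rabs_R0, Rplus_0_r, Rminus_0_r.
    unfold theta. replace (Q * (a ^ 2 + 0 ^ 2 + Rabs mu) * Rabs a * Rabs a) with (Q * ((a ^ 2 + Rabs mu) * Rabs a ^ 2)) by ring.
    rewrite pow2_abs. apply Rmult_le_compat_l; [lra |]. apply Rmult_le_compat_r; lra. }
  assert (Et1q : forall x, Rabs (V x ^ 2 - V' x ^ 2) <= 2 * Q ^ 2 * (s * D)).
  { intros x. eapply Rle_trans; [apply Et1 |]. rewrite Rmult_assoc. apply QQ; [apply Rmult_le_pos |]; lra. }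
  assert (Et2q : forall x, Rabs (V x ^ 2 - V' x ^ 2 - (a ^ 2 - a' ^ 2) * k2 P x ^ 2) <= 2 * Q ^ 2 * (t * s * D)).
  { intros x. eapply Rle_trans; [apply Et2 |].
    replace (2 * Q0 ^ 2 * t * s * D) with (2 * Q0 ^ 2 * (t * s * D)) by ring. apply QQ; lra. }
  clear V1' Sz Sz' K K' D2 Z D1 WE WE0 Et1 Et2.
  split; [intros x; eapply Rle_trans; [apply V1 | apply QQ; lra] |].
  split; [intros x; apply Rle_trans with (Q * t); [generalize (Szq x) (pow2_ge_0 (V x)); lra | apply QQ; lra] |].
  split; [intros x; eapply Rle_trans; [apply Zq |]; rewrite Rmult_assoc; apply QQ; lra |].
  split.
  { intros x; eapply Rle_trans; [apply WEq |].
    replace (40 * Q ^ 6 * t * s * D) with (40 * Q ^ 6 * (t * s * D)) by ring. apply QQ; lra. }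
  (* Along a solution of amplitude a one has GG = a^2 PP + ka mu to leading order; the integrals of
     PP k2^2 and of ka k2^2 are - b2 and - a2. *)
  set (PP := fun x => al P x * W2 P x + be P x * k2 P x ^ 2).
  set (h := fun x => GG P x (W x) (V x) mu * V x - GG P x (W' x) (V' x) mu * V' x).
  (* Here cb = a^3 - a'^3: the leading part of h is the difference of a (a^2 PP + ka mu) k2 at the
     two amplitudes. *)
  set (cb := (a - a') * (a ^ 2 + a * a' + a' ^ 2)). set (ck := (a - a') * mu).
  set (rm := fun x => h x - (cb * (PP x * k2 P x) + ck * (ka P x * k2 P x))).
  assert (Ck2 : cont (k2 P)) by exact (solves_cont (crit_sol (crit2 P))).
  assert (CPP : cont PP).
  { apply cont_plus; apply cont_mult; [apply al_cont | exact (solves_cont (W2_sol P)) | apply be_cont | apply cont_sqr, Ck2]. }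
  assert (Ch : cont h) by (apply cont_minus; apply cont_mult; try assumption; apply GG_cont; assumption).
  assert (Chb : cont (fun x => PP x * k2 P x)) by (apply cont_mult; assumption).
  assert (Cha : cont (fun x => ka P x * k2 P x)) by (apply cont_mult; [apply ka_cont | assumption]).
  assert (Crm : cont rm).
  { apply cont_minus; [exact Ch |]. apply (cont_lin _ _ cb ck Chb Cha). }
  assert (CB : forall x, Rabs (al P x) <= Q /\ Rabs (be P x) <= Q /\ Rabs (ka P x) <= Q /\ Rabs (W2 P x) <= Q /\ Rabs (k2 P x) <= Q).
  { intros x. destruct (coeff_bounds P L x HL) as [_ [X1 [X2 [X3 [X4 X5]]]]]. lra. }
  assert (BPP : bounded_by (2 * Q ^ 3) PP).
  { intros x. destruct (CB x) as [X1 [X2 [X3 [X4 X5]]]].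
    eapply Rle_trans; [apply Rabs_plus_le; apply Rabs_mult_le; [exact X1 | exact X4 | exact X2 |] |].
    - rewrite <- RPow_abs. apply pow_incr. split; [apply Rabs_pos | exact X5].
    - replace (Q * Q ^ 2) with (Q ^ 3) by ring. replace (Q * Q) with (Q ^ 2) by ring. lra. }
  assert (Brm : bounded_by (40 * Q ^ 5 * (t * t * D)) rm).
  { intros x. destruct (CB x) as [X1 [X2 [X3 [X4 X5]]]]. destruct (B x) as [B1 B2], (B' x) as [B3 B4].
    assert (R0 : Rabs 0 <= 1) by (rewrite Rabs_R0; lra).
    assert (EG := GG_diff P L HL x (W x) (V x) mu 0 0 0 (Q * t) B1 B2 R0 R0 Bmu R0 (Szq x)
                  ltac:(rewrite Rabs_R0; simpl; replace (0 + 0 * (0 * 1) + 0) with 0 by ring; apply Rmult_le_pos; lra)).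
    rewrite GG_zero in EG. replace (W x - 0) with (W x) in EG by ring. replace (mu - 0) with mu in EG by ring.
    replace (V x ^ 2 - 0 ^ 2) with (V x ^ 2) in EG by ring. rewrite (Rabs_pos_eq (V x ^ 2)) in EG by apply pow2_ge_0.
    set (g := GG P x (W x) (V x) mu) in *. set (g' := GG P x (W' x) (V' x) mu) in *.
    set (gm := a ^ 2 * PP x + ka P x * mu).
    assert (Egm : Rabs (g - gm) <= 8 * Q ^ 3 * (t * t)).
    { replace (g - gm) with ((g - 0 - (al P x * W x + be P x * V x ^ 2 + ka P x * mu))
        + (al P x * (W x - a ^ 2 * W2 P x) + be P x * ((V x - a * k2 P x) * (V x + a * k2 P x)))) by (unfold gm, PP; ring).
      assert (Y1 : Rabs (V x + a * k2 P x) <= 2 * Q * s).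
      { eapply Rle_trans; [apply Rabs_plus_le; [apply V1 | apply Rabs_mult_le; [apply Rle_refl | exact X5]] |].
        assert (Q0 * Rabs a <= Q * s) by (apply Rmult_le_compat; lra).
        assert (Rabs a * Q <= s * Q) by (apply Rmult_le_compat_r; lra). lra. }
      eapply Rle_trans; [apply Rabs_plus_le; [exact EG | apply Rabs_plus_le; [exact (Rabs_mult_le _ _ _ _ X1 (WE0q x)) | exact (Rabs_mult_le _ _ _ _ X2 (Rabs_mult_le _ _ _ _ (Kq x) Y1))]] |].
      assert (Z1 : 2 * L * (Q * t) * (Rabs (W x) + V x ^ 2 + Rabs mu) <= 2 * Q * (Q * t) * (Q * t)).
      { apply Rmult_le_compat.
        - apply Rmult_le_pos; [lra |]. apply Rmult_le_pos; lra.
        - generalize (Rabs_pos (W x)) (pow2_ge_0 (V x)); lra.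
        - apply Rmult_le_compat_r; [apply Rmult_le_pos |]; lra.
        - apply Szq. }
      assert (Z2 : Q * (Q * (t * a ^ 2)) <= Q ^ 2 * (t * t)).
      { replace (Q * (Q * (t * a ^ 2))) with (Q ^ 2 * (t * a ^ 2)) by ring.
        apply Rmult_le_compat_l; [lra |]. apply Rmult_le_compat_l; lra. }
      assert (Z3 : Q * (Q * (t * Rabs a) * (2 * Q * s)) <= 4 * Q ^ 3 * (t * t)).
      { replace (Q * (Q * (t * Rabs a) * (2 * Q * s))) with (2 * Q ^ 3 * (t * (Rabs a * s))) by ring.
        replace (4 * Q ^ 3 * (t * t)) with (2 * Q ^ 3 * (t * (2 * t))) by ring.
        apply Rmult_le_compat_l; [lra |]. apply Rmult_le_compat_l; [exact Th |].
        apply Rle_trans with (s * s); [apply Rmult_le_compat_r; lra |]. simpl in Ssq. lra. }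
      assert (Ptt : 0 <= t * t) by (apply Rmult_le_pos; assumption).
      assert (Z2' : Q ^ 2 * (t * t) <= Q ^ 3 * (t * t)) by (apply Rmult_le_compat_r; lra).
      replace (2 * Q * (Q * t) * (Q * t)) with (2 * (Q ^ 3 * (t * t))) in Z1 by ring.
      assert (0 <= Q ^ 3 * (t * t)) by (apply Rmult_le_pos; lra).
      lra. }
    assert (Bgm : Rabs gm <= 2 * Q ^ 3 * t).
    { eapply Rle_trans; [apply Rabs_plus_le; apply Rabs_mult_le; [apply Rle_refl | apply BPP | exact X3 | apply Rle_refl] |].
      rewrite (Rabs_pos_eq (a ^ 2)) by exact Pa2.
      assert (Q * Rabs mu <= 2 * Q ^ 3 * Rabs mu) by (apply Rmult_le_compat_r; lra).
      assert (2 * Q ^ 3 * (a ^ 2 + Rabs mu) <= 2 * Q ^ 3 * t) by (apply Rmult_le_compat_l; lra). lra. }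
    assert (ED := GG_diff P L HL x _ _ mu _ _ mu (Q * t) B1 B2 B3 B4 Bmu Bmu (Szq x) (Szq' x)).
    replace (mu - mu) with 0 in ED by ring. rewrite Rabs_R0, Rmult_0_r, !Rplus_0_r in ED.
    assert (D1x := D1q x). assert (Et1x := Et1q x). assert (Et2x := Et2q x). assert (WEx := WEq x).
    set (eta := V x ^ 2 - V' x ^ 2) in *. set (dw := W x - W' x) in *.
    assert (EDm : Rabs (g - g' - (a ^ 2 - a' ^ 2) * PP x) <= 9 * Q ^ 4 * (t * s * D)).
    { replace (g - g' - (a ^ 2 - a' ^ 2) * PP x) with ((g - g' - (al P x * dw + be P x * eta))
        + (al P x * (dw - (a ^ 2 - a' ^ 2) * W2 P x) + be P x * (eta - (a ^ 2 - a' ^ 2) * k2 P x ^ 2))) by (unfold PP; ring).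
      eapply Rle_trans; [apply Rabs_plus_le; [exact ED | apply Rabs_plus_le; [exact (Rabs_mult_le _ _ _ _ X1 WEx) | exact (Rabs_mult_le _ _ _ _ X2 Et2x)]] |].
      assert (Z1 : 2 * L * (Q * t) * (Rabs dw + Rabs eta) <= 2 * Q * (Q * t) * (Q * (s * D) + 2 * Q ^ 2 * (s * D))).
      { apply Rmult_le_compat.
        - apply Rmult_le_pos; [lra |]. apply Rmult_le_pos; lra.
        - apply Rplus_le_le_0_compat; apply Rabs_pos.
        - apply Rmult_le_compat_r; [apply Rmult_le_pos |]; lra.
        - lra. }
      replace (2 * Q * (Q * t) * (Q * (s * D) + 2 * Q ^ 2 * (s * D))) with ((2 * Q ^ 3 + 4 * Q ^ 4) * (t * s * D)) in Z1 by ring.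
      replace (Q * (Q * (t * s * D))) with (Q ^ 2 * (t * s * D)) by ring.
      replace (Q * (2 * Q ^ 2 * (t * s * D))) with (2 * Q ^ 3 * (t * s * D)) by ring.
      assert ((2 * Q ^ 3 + 4 * Q ^ 4 + Q ^ 2 + 2 * Q ^ 3) * (t * s * D) <= 9 * Q ^ 4 * (t * s * D)) by (apply Rmult_le_compat_r; lra).
      lra. }
    (* In each of the four products one factor carries |a - a'| and the remaining order is theta^2;
       for the last two this uses (|a| + |a'|) |a'| <= 2 theta. *)
    replace (rm x) with (((g - gm) * (V x - V' x) + gm * (V x - V' x - (a - a') * k2 P x))
       + ((g - g' - (a ^ 2 - a' ^ 2) * PP x) * V' x + ((a + a') * (a - a') * PP x) * (V' x - a' * k2 P x)))
      by (unfold rm, h, gm, cb, ck; fold g g'; ring).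
    eapply Rle_trans; [apply Rabs_plus_le; apply Rabs_plus_le |].
    - exact (Rabs_mult_le _ _ _ _ Egm (D2q x)).
    - exact (Rabs_mult_le _ _ _ _ Bgm (Zq x)).
    - exact (Rabs_mult_le _ _ _ _ EDm (V1'q x)).
    - apply Rabs_mult_le; [apply Rabs_mult_le; [apply Rabs_mult_le; [apply Rabs_triang | apply Rle_refl] | apply BPP] | apply Kq'].
    - fold s D.
      replace (8 * Q ^ 3 * (t * t) * (Q * D)) with (8 * Q ^ 4 * (t * t * D)) by ring.
      replace (2 * Q ^ 3 * t * (Q * (t * D))) with (2 * Q ^ 4 * (t * t * D)) by ring.
      assert (Y : t * s * D * Rabs a' <= 2 * (t * t * D)).
      { replace (t * s * D * Rabs a') with (t * D * (s * Rabs a')) by ring.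
        replace (2 * (t * t * D)) with (t * D * (2 * t)) by ring.
        apply Rmult_le_compat_l; [exact PtD |].
        apply Rle_trans with (s * s); [apply Rmult_le_compat_l; lra |]. simpl in Ssq. lra. }
      replace (9 * Q ^ 4 * (t * s * D) * (Q * Rabs a')) with (9 * Q ^ 5 * (t * s * D * Rabs a')) by ring.
      replace (s * D * (2 * Q ^ 3) * (Q * (t * Rabs a'))) with (2 * Q ^ 4 * (t * s * D * Rabs a')) by ring.
      assert (Y1 : 9 * Q ^ 5 * (t * s * D * Rabs a') <= 9 * Q ^ 5 * (2 * (t * t * D))) by (apply Rmult_le_compat_l; lra).
      assert (Y2 : 2 * Q ^ 4 * (t * s * D * Rabs a') <= 2 * Q ^ 4 * (2 * (t * t * D))) by (apply Rmult_le_compat_l; lra).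
      assert ((8 * Q ^ 4 + 2 * Q ^ 4 + 18 * Q ^ 5 + 4 * Q ^ 4) * (t * t * D) <= 40 * Q ^ 5 * (t * t * D)) by (apply Rmult_le_compat_r; lra).
      lra. }
  assert (HP2 := HP). destruct HP2 as [_ [S2 [_ S4]]]. assert (HP2' := HP'). destruct HP2' as [_ [S2' [_ S4']]].
  assert (K2 := crit_sol (crit2 P)).
  assert (Sd2 : solves (m2 P) (fun x => h x - (l2 - l2') * k2 P x) (fun x => V x - V' x - (a - a') * k2 P x)).
  { eapply solves_ext; [reflexivity | | | exact (solves_minus (solves_minus S2 S2') (solves_scal (a - a') K2))];
      intros x; unfold h; [ring | reflexivity]. }
  assert (Lz : level (k2 P) (fun x => V x - V' x - (a - a') * k2 P x) = 0).
  { rewrite (level_minus (k2 P) (fun x => V x - V' x) (fun x => (a - a') * k2 P x)).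
    - rewrite level_minus; [| apply S2 | apply S2']. rewrite S4, S4', level_scal by apply K2.
      rewrite (level_self (crit2 P)). ring.
    - apply (solves_minus S2 S2').
    - apply (solves_scal (a - a') K2). }
  assert (Bhb : bounded_by (2 * Q ^ 3 * Q) (fun x => PP x * k2 P x)) by (intros x; apply Rabs_mult_le; [apply BPP | apply (CB x)]).
  assert (Bha : bounded_by (Q * Q) (fun x => ka P x * k2 P x)) by (intros x; apply Rabs_mult_le; apply (CB x)).
  assert (Bh : bounded_by (40 * Q ^ 5 * (t * t * D) + (Rabs cb * (2 * Q ^ 3 * Q) + Rabs ck * (Q * Q))) h).
  { intros x. replace (h x) with (rm x + (cb * (PP x * k2 P x) + ck * (ka P x * k2 P x))) by (unfold rm; ring).
    apply Rabs_plus_le; [apply Brm |]. apply Rabs_plus_le; apply Rabs_mult_le; [apply Rle_refl | apply Bhb | apply Rle_refl | apply Bha]. }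
  destruct (L_lin2 HL _ h _ _ _ Ch Bh Zq Sd2 Lz) as [_ EI].
  rewrite EI.
  assert (X : forall f H', cont f -> bounded_by H' f -> expo (fun x => k2 P x * f x))
    by (intros f H' Cf Bf; exact (critical_product_expo _ _ f H' (crit2 P) Cf Bf)).
  assert (Eh : int_line (fun x => k2 P x * h x) = int_line (fun x => k2 P x * rm x) + (cb * (- b2 P) + ck * (- a2 P))).
  { replace (fun x => k2 P x * h x) with (fun x => 1 * (k2 P x * rm x) + 1 * (cb * (k2 P x * (PP x * k2 P x)) + ck * (k2 P x * (ka P x * k2 P x))))
      by (apply functional_extensionality; intros x; unfold rm; ring).
    rewrite (int_line_lin (fun x => k2 P x * rm x) (fun x => cb * (k2 P x * (PP x * k2 P x)) + ck * (k2 P x * (ka P x * k2 P x))));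
      [| apply (X _ _ Crm Brm) | apply expo_lin; [apply (X _ _ Chb Bhb) | apply (X _ _ Cha Bha)]].
    rewrite (int_line_lin (fun x => k2 P x * (PP x * k2 P x)) (fun x => k2 P x * (ka P x * k2 P x)));
      [| apply (X _ _ Chb Bhb) | apply (X _ _ Cha Bha)].
    rewrite b2_eq, a2_eq. ring. }
  rewrite Eh.
  replace (int_line (fun x => k2 P x * rm x) + (cb * - b2 P + ck * - a2 P) + (a - a') * (b2 P * (a ^ 2 + a * a' + a' ^ 2) + a2 P * mu))
    with (int_line (fun x => k2 P x * rm x)) by (unfold cb, ck; ring).
  eapply Rle_trans; [apply (L_int HL rm _ Crm Brm) |].
  replace (40 * Q ^ 6 * t ^ 2 * D) with (Q * (40 * Q ^ 5 * (t * t * D))) by ring.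
  apply Rmult_le_compat_r; [| exact LQ]. apply Rmult_le_pos; lra.
Qed.

(** * Existence by contraction *)

Definition uniform_limit {I : Type} (u : nat -> I -> R) (f : I -> R) : Prop :=
  forall e, 0 < e -> exists n, forall i, Rabs (u n i - f i) <= e.

Lemma half_pow_small (c e : R) : 0 <= c -> 0 < e ->
  exists N, forall n, (N <= n)%nat -> c * (1 / 2) ^ n < e.
Proof.
  intros Hc He.
  destruct (pow_lt_1_zero (1 / 2) ltac:(rewrite Rabs_pos_eq; lra) (e / (c + 1)) ltac:(apply Rdiv_lt_0_compat; lra)) as [N HN].
  exists N. intros n Hn. specialize (HN n Hn).
  assert (P : 0 < (1 / 2) ^ n) by (apply pow_lt; lra). rewrite Rabs_pos_eq in HN by lra.
  apply Rmult_lt_compat_r with (r := c + 1) in HN; [| lra].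
  replace (e / (c + 1) * (c + 1)) with e in HN by (field; lra). lra.
Qed.

(** Banach's theorem for real functions on an index type with the uniform distance. X is closed
    under uniform limits, and distances occur only through upper bounds, so no complete function
    space has to be constructed. *)
Lemma contraction_fixed_point {I : Type} (T : (I -> R) -> I -> R) (X : (I -> R) -> Prop) (f0 : I -> R) (d : R) :
  (forall u f, (forall n, X (u n)) -> uniform_limit u f -> X f) ->
  X f0 -> (forall f, X f -> X (T f)) ->
  (forall i, Rabs (T f0 i - f0 i) <= d) ->
  (forall f g c, X f -> X g -> (forall i, Rabs (f i - g i) <= c) -> forall i, Rabs (T f i - T g i) <= c / 2) ->
  exists f, X f /\ forall i, T f i = f i.
Proof.
  intros Hcl H0 HT Hd HL.
  destruct (classic (inhabited I)) as [[i0]|Hno].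
  2:{ exists f0. split; [exact H0 |]. intros i. exfalso. apply Hno. constructor. exact i. }
  assert (d0 : 0 <= d) by (generalize (Hd i0) (Rabs_pos (T f0 i0 - f0 i0)); lra).
  set (u := fix u n := match n with O => f0 | S n => T (u n) end).
  assert (HX : forall n, X (u n)) by (induction n; simpl; auto).
  assert (Step : forall n i, Rabs (u (S n) i - u n i) <= d * (1 / 2) ^ n).
  { induction n as [|n IH]; intros i; [simpl; rewrite Rmult_1_r; apply Hd |].
    replace (d * (1 / 2) ^ S n) with (d * (1 / 2) ^ n / 2) by (simpl; field).
    apply (HL (u (S n)) (u n)); auto. }
  assert (Far : forall k n i, Rabs (u (n + k)%nat i - u n i) <= 2 * d * (1 / 2) ^ n - 2 * d * (1 / 2) ^ (n + k)).
  { induction k as [|k IH]; intros n i.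
    - rewrite Nat.add_0_r, Rminus_diag, Rabs_R0. lra.
    - rewrite Nat.add_succ_r. specialize (IH n i). specialize (Step (n + k)%nat i).
      replace (u (S (n + k)) i - u n i) with ((u (S (n + k)) i - u (n + k)%nat i) + (u (n + k)%nat i - u n i)) by ring.
      eapply Rle_trans; [apply (Rabs_plus_le _ _ _ _ Step IH) |]. simpl. lra. }
  assert (Far' : forall n m i, (n <= m)%nat -> Rabs (u m i - u n i) <= 2 * d * (1 / 2) ^ n).
  { intros n m i Hnm. replace m with (n + (m - n))%nat by lia. eapply Rle_trans; [apply Far |].
    assert (0 < (1 / 2) ^ (n + (m - n))) by (apply pow_lt; lra). nra. }
  assert (Cau : forall i, Cauchy_crit (fun n => u n i)).
  { intros i e He. destruct (half_pow_small (4 * d) e ltac:(lra) He) as [N HN].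
    exists N. intros n m Hn Hm. unfold Rdist.
    replace (u n i - u m i) with ((u n i - u N i) - (u m i - u N i)) by ring.
    eapply Rle_lt_trans; [apply Rabs_minus_le; apply Far'; assumption |]. specialize (HN N ltac:(lia)). lra. }
  set (f := fun i => proj1_sig (Rcomplete.R_complete _ (Cau i))).
  assert (Hf : forall n i, Rabs (u n i - f i) <= 2 * d * (1 / 2) ^ n).
  { intros n i. unfold f. destruct (Rcomplete.R_complete _ (Cau i)) as [l Hl]. simpl.
    apply le_epsilon. intros e He. destruct (Hl e He) as [N HN].
    specialize (HN (n + N)%nat ltac:(lia)).
    replace (u n i - l) with (- (u (n + N)%nat i - u n i) + (u (n + N)%nat i - l)) by ring.
    eapply Rle_trans; [apply Rabs_plus_le; [rewrite Rabs_Ropp; apply Far'; lia | left; exact HN] |]. lra. }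
  assert (HXf : X f).
  { apply (Hcl u); [exact HX |]. intros e He.
    destruct (half_pow_small (2 * d) e ltac:(lra) He) as [N HN]. exists N. intros i.
    specialize (HN N ltac:(lia)). specialize (Hf N i). lra. }
  exists f. split; [exact HXf |]. intros i.
  apply Rminus_diag_uniq, Rabs_eq_0, Rle_antisym; [| apply Rabs_pos].
  apply Rnot_lt_le. intros Hpos.
  (* The tolerance is |T f i - f i| itself, assumed positive. The two terms that bound it below are
     at most d (1/2)^N each, against 4 d (1/2)^N. *)
  destruct (half_pow_small (4 * d) _ ltac:(lra) Hpos) as [N HN]. specialize (HN N ltac:(lia)).
  assert (A1 : Rabs (T f i - u (S N) i) <= 2 * d * (1 / 2) ^ N / 2).
  { apply (HL f (u N)); auto. intros j. rewrite Rabs_minus_sym. apply Hf. }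
  assert (A2 := Hf (S N) i). simpl pow in A2.
  assert (A3 := Rabs_plus_le _ _ _ _ A1 A2).
  replace (T f i - u (S N) i + (u (S N) i - f i)) with (T f i - f i) in A3 by ring.
  assert (0 < (1 / 2) ^ N) by (apply pow_lt; lra). nra.
Qed.

Lemma cont_uniform_limit (u : nat -> R -> R) (f : R -> R) :
  (forall n, cont (u n)) -> uniform_limit u f -> cont f.
Proof.
  intros Hu Hf x. apply filterlim_locally. intros e.
  assert (Pe := cond_pos e).
  destruct (Hf (e / 4) ltac:(lra)) as [n Hn].
  assert (He2 : 0 < e / 4) by lra.
  assert (C := proj1 (filterlim_locally _ _) (Hu n x) (mkposreal _ He2)).
  apply (filter_imp (F := locally x)) with (2 := C). intros y Hy.
  change (Rabs (f y - f x) < e). change (Rabs (u n y - u n x) < e / 4) in Hy.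
  replace (f y - f x) with ((u n y - u n x) - (u n y - f y) + (u n x - f x)) by ring.
  eapply Rle_lt_trans; [apply Rabs_plus_le; [apply Rabs_minus_le; [left; exact Hy | apply Hn] | apply Hn] |]. lra.
Qed.

(** Choice turns the solutions of the linear problem into a total operator, as the contraction map
    requires; the linear estimate applied to a difference of two solutions gives its Lipschitz
    bound. *)
Lemma right_inverse m k : critical m k -> exists C (S : (R -> R) -> R -> R), 0 <= C /\
  (forall h H, cont h -> bounded_by H h ->
     (exists l, solves m (fun x => h x - l * k x) (S h)) /\ bounded_by (C * H) (S h) /\ level k (S h) = 0) /\
  (forall h h' H H' B, cont h -> bounded_by H h -> cont h' -> bounded_by H' h' ->
     bounded_by B (fun x => h x - h' x) -> bounded_by (C * B) (fun x => S h x - S h' x)).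
Proof.
  intros Hc. destruct (linear_theory m k Hc) as [C [HC [HA HB]]].
  (* d is chosen before H, so that it depends on h alone and satisfies the estimate for every bound
     of h; for inadmissible h it is arbitrary. *)
  assert (Ex : forall h, exists d, forall H, cont h -> bounded_by H h ->
     (exists l, solves m (fun x => h x - l * k x) d) /\ bounded_by (C * H) d /\ level k d = 0).
  { intros h. destruct (classic (cont h /\ exists H, bounded_by H h)) as [[Ch [H0 HH0]]|Hn].
    - destruct (HA h H0 Ch HH0) as [d [l [S1 [S2 S3]]]]. exists d. intros H _ HH.
      split; [exists l; exact S1 |]. split; [| exact S3].
      apply (HB d h H (C * H0) l); assumption.
    - exists h. intros H Ch HH. exfalso. apply Hn. split; [exact Ch | exists H; exact HH]. }
  pose (S := fun h => proj1_sig (constructive_indefinite_description _ (Ex h))).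
  assert (HS : forall h H, cont h -> bounded_by H h ->
     (exists l, solves m (fun x => h x - l * k x) (S h)) /\ bounded_by (C * H) (S h) /\ level k (S h) = 0)
    by (intros h; exact (proj2_sig (constructive_indefinite_description _ (Ex h)))).
  exists C, S. split; [exact HC |]. split; [exact HS |].
  intros h h' H H' B Ch HH Ch' HH' HB'.
  destruct (HS h H Ch HH) as [[l S1] [S2 S3]]. destruct (HS h' H' Ch' HH') as [[l' S1'] [S2' S3']].
  apply (HB (fun x => S h x - S h' x) (fun x => h x - h' x) B (C * H + C * H') (l - l')).
  - apply cont_minus; assumption.
  - exact HB'.
  - intros x. apply Rabs_minus_le; [apply S2 | apply S2'].
  - eapply solves_ext; [reflexivity | | | exact (solves_minus S1 S1')]; intros x; simpl; ring.
  - rewrite level_minus; [rewrite S3, S3'; ring | apply S1 | apply S1'].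
Qed.

(** In the ball of radius r the right-hand sides have Lipschitz constant O(r), so W -> S1 h1, V -> a
    k2 + S2 h2 is a contraction. The level conditions hold by construction: the right inverses have
    level 0 and k2 has level 1. *)
Lemma projected_exists P : exists r1, 0 < r1 <= 1 /\ forall r, 0 < r <= r1 -> exists alpha, 0 < alpha /\
  forall a mu, Rabs a <= alpha -> Rabs mu <= r ->
  exists W V l1 l2, projected P a mu W V l1 l2 /\ small r mu W V.
Proof.
  destruct (constants_exist P) as [L HL]. assert (L1 := L_ge1 HL).
  destruct (right_inverse _ _ (crit1 P)) as [C1 [S1 [HC1 [HS1 HD1]]]].
  destruct (right_inverse _ _ (crit2 P)) as [C2 [S2 [HC2 [HS2 HD2]]]].
  set (K := L * (1 + C1 + C2)).
  assert (K1 : 1 <= K) by (unfold K; nra).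
  assert (KC1 : L * C1 <= K) by (unfold K; nra). assert (KC2 : L * C2 <= K) by (unfold K; nra).
  assert (LK : L <= K) by (unfold K; nra).
  (* The right-hand sides have Lipschitz constants at most 30 L r, and K bounds L C1 and L C2, so 60
     K r <= 1 makes the contraction factor at most 1/2. *)
  exists (/ (60 * K)). split.
  { split; [apply Rinv_0_lt_compat; lra |]. rewrite <- Rinv_1. apply Rinv_le_contravar; lra. }
  intros r [Hr Hr1].
  assert (HKr : 60 * K * r <= 1).
  { apply Rmult_le_compat_l with (r := 60 * K) in Hr1; [| lra]. rewrite Rinv_r in Hr1 by lra. exact Hr1. }
  assert (Hr2 : 60 * r <= 1) by nra.
  (* Half of the radius is left to a k2, the other half to the nonlinear part, which is at most 30 K
     r^2. *)
  exists (r / (2 * K)). split; [apply Rdiv_lt_0_compat; lra |].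
  intros a mu Ha Hmu.
  assert (HaL : Rabs a * L <= r / 2).
  { apply Rle_trans with (r / (2 * K) * K); [apply Rmult_le_compat; try apply Rabs_pos; lra | right; field; lra]. }
  (* The pair (W, V) is encoded as one function on bool * R, so that a single sup norm covers both
     components. *)
  set (Wf := fun (f : bool * R -> R) x => f (true, x)). set (Vf := fun (f : bool * R -> R) x => f (false, x)).
  set (h1 := fun f x => NN P x (Wf f x) (Vf f x) mu). set (h2 := fun f x => GG P x (Wf f x) (Vf f x) mu * Vf f x).
  set (T := fun (f : bool * R -> R) (i : bool * R) =>
       if fst i then S1 (h1 f) (snd i) else a * k2 P (snd i) + S2 (h2 f) (snd i)).
  set (X := fun f => cont (Wf f) /\ cont (Vf f) /\ forall i, Rabs (f i) <= r).
  assert (Diff : forall f g c, X f -> X g -> (forall i, Rabs (f i - g i) <= c) ->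
     bounded_by (12 * L * r * c) (fun x => h1 f x - h1 g x) /\ bounded_by (30 * L * r * c) (fun x => h2 f x - h2 g x)).
  { intros f g c [_ [_ Bf]] [_ [_ Bg]] Hc.
    assert (Bd : forall f, (forall i, Rabs (f i) <= r) -> forall x, Rabs (Wf f x) + Vf f x ^ 2 + Rabs mu <= 3 * r).
    { intros e Be x. assert (A1 := Be (true, x)). assert (A2 := Be (false, x)). fold (Wf e x) in A1. fold (Vf e x) in A2.
      assert (Vf e x ^ 2 <= r) by (rewrite <- pow2_abs; generalize (Rabs_pos (Vf e x)); nra). lra. }
    assert (LR : 0 <= L * r) by (apply Rmult_le_pos; lra).
    split; intros x.
    - assert (A1 := Bf (true, x)). assert (A2 := Bf (false, x)). assert (A3 := Bg (true, x)). assert (A4 := Bg (false, x)).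
      assert (A5 := Hc (true, x)). assert (A6 := Hc (false, x)).
      eapply Rle_trans; [apply (NN_lip P L HL x _ _ _ _ mu (3 * r) r); try (apply Bd; assumption); try assumption; unfold Wf, Vf; lra |].
      unfold Wf, Vf.
      assert (6 * (L * r) * Rabs (f (false, x) - g (false, x)) <= 6 * (L * r) * c) by nra.
      assert (6 * (L * r) * Rabs (f (true, x) - g (true, x)) <= 6 * (L * r) * c) by nra.
      lra.
    - assert (A1 := Bf (true, x)). assert (A2 := Bf (false, x)). assert (A3 := Bg (true, x)). assert (A4 := Bg (false, x)).
      assert (A5 := Hc (true, x)). assert (A6 := Hc (false, x)).
      eapply Rle_trans; [apply (GG_lip P L HL x _ _ _ _ mu (3 * r) r); try (apply Bd; assumption); try assumption; unfold Wf, Vf; try lra; nra |].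
      unfold Wf, Vf.
      assert (27 * (L * r) * Rabs (f (false, x) - g (false, x)) <= 27 * (L * r) * c) by nra.
      assert (3 * (L * r) * Rabs (f (true, x) - g (true, x)) <= 3 * (L * r) * c) by nra.
      lra. }
  assert (X0 : X (fun _ => 0)).
  { split; [apply cont_const | split; [apply cont_const |]]. intros i. rewrite Rabs_R0. lra. }
  assert (Hcont : forall f, X f -> cont (h1 f) /\ cont (h2 f)).
  { intros f [CW [CV _]]. split; [apply NN_cont; assumption | apply cont_mult; [apply GG_cont |]; assumption]. }
  assert (Hbd : forall f, X f -> bounded_by (12 * L * r * r) (h1 f) /\ bounded_by (30 * L * r * r) (h2 f)).
  { intros f Hf. destruct (Diff f (fun _ => 0) r Hf X0) as [D1 D2].
    - intros i. rewrite Rminus_0_r. apply Hf.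
    - split; intros x.
      + specialize (D1 x). unfold h1 at 2 in D1. rewrite NN_zero, Rminus_0_r in D1. exact D1.
      + specialize (D2 x). unfold h2 at 2 in D2. rewrite Rmult_0_r, Rminus_0_r in D2. exact D2. }
  assert (Sol : forall f, X f -> exists l1 l2,
     solves (m1 P) (fun x => h1 f x - l1 * k1 P x) (S1 (h1 f)) /\ level (k1 P) (S1 (h1 f)) = 0 /\
     solves (m2 P) (fun x => h2 f x - l2 * k2 P x) (fun x => a * k2 P x + S2 (h2 f) x) /\
     level (k2 P) (fun x => a * k2 P x + S2 (h2 f) x) = a).
  { intros f Hf. destruct (Hcont f Hf) as [Ch1 Ch2]. destruct (Hbd f Hf) as [Bh1 Bh2].
    destruct (HS1 _ _ Ch1 Bh1) as [[l1 Q1] [_ Q3]]. destruct (HS2 _ _ Ch2 Bh2) as [[l2 R1] [_ R3]].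
    exists l1, l2. split; [exact Q1 |]. split; [exact Q3 |].
    assert (K2 := crit_sol (crit2 P)). split.
    - eapply solves_ext; [reflexivity | | | exact (solves_lin a 1 K2 R1)]; intros x; simpl; ring.
    - replace (fun x => a * k2 P x + S2 (h2 f) x) with (fun x => a * k2 P x + 1 * S2 (h2 f) x) by fext.
      rewrite level_lin; [| apply K2 | apply R1]. rewrite R3, (level_self (crit2 P)). ring. }
  assert (TX : forall f, X f -> X (T f)).
  { intros f Hf. destruct (Sol f Hf) as [l1 [l2 [Q1 [_ [Q2 _]]]]].
    split; [exact (solves_cont Q1) | split; [exact (solves_cont Q2) |]].
    destruct (Hcont f Hf) as [Ch1 Ch2]. destruct (Hbd f Hf) as [Bh1 Bh2].
    destruct (HS1 _ _ Ch1 Bh1) as [_ [Q3 _]]. destruct (HS2 _ _ Ch2 Bh2) as [_ [R3 _]].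
    intros [[|] x]; unfold T; simpl.
    - eapply Rle_trans; [apply Q3 |]. nra.
    - eapply Rle_trans; [apply Rabs_plus_le; [apply Rabs_mult_le; [apply Rle_refl | apply (L_k2 HL)] | apply R3] |].
      nra. }
  destruct (contraction_fixed_point T X (fun _ => 0) (r + r)) as [f [Hf Ef]].
  - intros u f Hu Hlim.
    assert (Sub : forall b, uniform_limit (fun n x => u n (b, x)) (fun x => f (b, x))).
    { intros b e He. destruct (Hlim e He) as [n Hn]. exists n. intros x. apply Hn. }
    split; [| split].
    + apply (cont_uniform_limit (fun n => Wf (u n))); [intros n; apply Hu | apply Sub].
    + apply (cont_uniform_limit (fun n => Vf (u n))); [intros n; apply Hu | apply Sub].
    + intros i. apply le_epsilon. intros e He. destruct (Hlim e He) as [n Hn].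
      replace (f i) with (u n i - (u n i - f i)) by ring. apply Rabs_minus_le; [apply Hu | apply Hn].
  - exact X0.
  - exact TX.
  - intros i. apply Rabs_minus_le; [apply (TX _ X0) | rewrite Rabs_R0; lra].
  - intros f g c Hf Hg Hc.
    assert (Pc : 0 <= c) by (generalize (Hc (true, 0)) (Rabs_pos (f (true, 0) - g (true, 0))); lra).
    destruct (Diff f g c Hf Hg Hc) as [D1 D2].
    destruct (Hcont f Hf) as [Ch1 Ch2]. destruct (Hbd f Hf) as [Bh1 Bh2].
    destruct (Hcont g Hg) as [Ch1' Ch2']. destruct (Hbd g Hg) as [Bh1' Bh2'].
    assert (E1 := HD1 _ _ _ _ _ Ch1 Bh1 Ch1' Bh1' D1). assert (E2 := HD2 _ _ _ _ _ Ch2 Bh2 Ch2' Bh2' D2).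
    assert (Prc : 0 <= r * c) by (apply Rmult_le_pos; lra).
    assert (Krc : 60 * K * r * c <= 1 * c) by nra.
    intros [[|] x]; unfold T; simpl.
    + eapply Rle_trans; [apply E1 |]. assert (L * C1 * (r * c) <= K * (r * c)) by nra. lra.
    + replace (a * k2 P x + S2 (h2 f) x - (a * k2 P x + S2 (h2 g) x)) with (S2 (h2 f) x - S2 (h2 g) x) by ring.
      eapply Rle_trans; [apply E2 |]. assert (L * C2 * (r * c) <= K * (r * c)) by nra. lra.
  - destruct (Sol f Hf) as [l1 [l2 [Q1 [Q2 [Q3 Q4]]]]].
    assert (EW : S1 (h1 f) = Wf f) by (apply functional_extensionality; intros x; exact (Ef (true, x))).
    assert (EV : (fun x => a * k2 P x + S2 (h2 f) x) = Vf f) by (apply functional_extensionality; intros x; exact (Ef (false, x))).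
    rewrite EW in Q1, Q2. rewrite EV in Q3, Q4.
    exists (Wf f), (Vf f), l1, l2. split; [split; [exact Q1 | split; [exact Q3 | split; assumption]] |].
    split; [intros x; apply Hf | split; [intros x; apply Hf | exact Hmu]].
Qed.

(** * The reduced bifurcation equation *)

Record symmetric (P : problem) (sg : R) : Prop := {
  sy_sg : sg = 1 \/ sg = -1;
  sy_m1 : forall x, m1 P (- x) = m1 P x;
  sy_m2 : forall x, m2 P (- x) = m2 P x;
  sy_k1 : forall x, k1 P (- x) = - k1 P x;
  sy_k2 : forall x, k2 P (- x) = sg * k2 P x;
  sy_NN : forall x w v mu, NN P (- x) w v mu = NN P x w v mu;
  sy_GG : forall x w v mu, GG P (- x) w v mu = GG P x w v mu;
  sy_NNv : forall x w v mu, NN P x w (- v) mu = NN P x w v mu;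
  sy_GGv : forall x w v mu, GG P x w (- v) mu = GG P x w v mu
}.
Arguments sy_sg {P sg} _.
Arguments sy_m1 {P sg} _.
Arguments sy_m2 {P sg} _.
Arguments sy_k1 {P sg} _.
Arguments sy_k2 {P sg} _.
Arguments sy_NN {P sg} _.
Arguments sy_GG {P sg} _.
Arguments sy_NNv {P sg} _.
Arguments sy_GGv {P sg} _.

Lemma projected_opp P sg a mu W V l1 l2 : symmetric P sg ->
  projected P a mu W V l1 l2 -> projected P (- a) mu W (fun x => - V x) l1 (- l2).
Proof.
  intros Sy [H1 [H2 [H3 H4]]]. split; [| split; [| split; [exact H3 |]]].
  - eapply solves_ext; [reflexivity | | reflexivity | exact H1].
    intros x. rewrite (sy_NNv Sy). reflexivity.
  - eapply solves_ext; [reflexivity | | | exact (solves_scal (-1) H2)];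
      intros x; cbv beta; [rewrite (sy_GGv Sy) |]; ring.
  - replace (fun x => - V x) with (fun x => (-1) * V x) by fext.
    rewrite level_scal by apply H2. rewrite H4. ring.
Qed.

(** The factor sg, the parity of k2, keeps both the amplitude and l2 unchanged: k2(0) = sg k2(0) and
    k2'(0) = - sg k2'(0). *)
Lemma projected_reflect P sg a mu W V l1 l2 : symmetric P sg ->
  projected P a mu W V l1 l2 ->
  projected P a mu (fun x => W (- x)) (fun x => sg * V (- x)) (- l1) l2.
Proof.
  intros Sy [H1 [H2 [H3 H4]]].
  assert (sg2 : sg * sg = 1) by (destruct (sy_sg Sy) as [-> | ->]; ring).
  assert (NNs : forall x w v, NN P x w (sg * v) mu = NN P x w v mu).
  { intros x w v. destruct (sy_sg Sy) as [-> | ->]; [rewrite Rmult_1_l; reflexivity |].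
    replace (-1 * v) with (- v) by ring. apply (sy_NNv Sy). }
  assert (GGs : forall x w v, GG P x w (sg * v) mu = GG P x w v mu).
  { intros x w v. destruct (sy_sg Sy) as [-> | ->]; [rewrite Rmult_1_l; reflexivity |].
    replace (-1 * v) with (- v) by ring. apply (sy_GGv Sy). }
  split; [| split; [| split]].
  - eapply solves_ext; [| | reflexivity | exact (solves_reflect H1)]; intros x; cbv beta.
    + apply (sy_m1 Sy).
    + rewrite (sy_NN Sy), (sy_k1 Sy), NNs. ring.
  - eapply solves_ext; [| | | exact (solves_scal sg (solves_reflect H2))]; intros x; cbv beta.
    + apply (sy_m2 Sy).
    + rewrite (sy_GG Sy), (sy_k2 Sy), GGs.
      replace (sg * (GG P x (W (- x)) (V (- x)) mu * V (- x) - l2 * (sg * k2 P x)))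
        with (GG P x (W (- x)) (V (- x)) mu * (sg * V (- x)) - l2 * (sg * sg) * k2 P x) by ring.
      rewrite sg2. ring.
    + reflexivity.
  - assert (K0 : k1 P 0 = 0) by (assert (E := sy_k1 Sy 0); rewrite Ropp_0 in E; lra).
    unfold level in *. rewrite K0 in *. rewrite (Derive_reflect W 0) by apply H1. rewrite Ropp_0.
    replace (0 * W 0 + Derive (k1 P) 0 * - Derive W 0) with (- (0 * W 0 + Derive (k1 P) 0 * Derive W 0)) by ring.
    unfold Rdiv in *. rewrite Ropp_mult_distr_l_reverse, H3. ring.
  - rewrite <- H4.
    assert (K0 : k2 P 0 = sg * k2 P 0) by (assert (E := sy_k2 Sy 0); rewrite Ropp_0 in E; exact E).
    assert (K1 : Derive (k2 P) 0 = - sg * Derive (k2 P) 0).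
    { assert (E1 := Derive_reflect (k2 P) 0 ltac:(apply (crit_sol (crit2 P)))). rewrite Ropp_0 in E1.
      rewrite (Derive_ext _ (fun x => sg * k2 P x)) in E1 by (intros; apply (sy_k2 Sy)).
      rewrite Derive_scal in E1. lra. }
    rewrite level_scal.
    2:{ apply (solves_reflect H2). }
    unfold level. rewrite (Derive_reflect V 0) by (rewrite Ropp_0; apply H2). rewrite Ropp_0. unfold Rdiv. rewrite <- Rmult_assoc. f_equal.
    transitivity ((sg * k2 P 0) * V 0 + (- sg * Derive (k2 P) 0) * Derive V 0); [ring |].
    rewrite <- K0, <- K1. reflexivity.
Qed.

Lemma solves_source_unique m h h' d : solves m h d -> solves m h' d -> forall x, h x = h' x.
Proof.
  intros H H' x.
  assert (E := is_derive_unique _ _ _ (solves_der2 H x)).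
  rewrite (is_derive_unique _ _ _ (solves_der2 H' x)) in E. lra.
Qed.

Definition expansion_bounds (P : problem) (r Q : R) : Prop :=
  forall a a' mu W V l1 l2 W' V' l1' l2',
  projected P a mu W V l1 l2 -> projected P a' mu W' V' l1' l2' ->
  small r mu W V -> small r mu W' V' ->
  bounded_by (Q * Rabs a) V /\ bounded_by (Q * theta a a' mu) W /\
  bounded_by (Q * theta a a' mu * Rabs (a - a')) (fun x => V x - V' x - (a - a') * k2 P x) /\
  bounded_by (Q * theta a a' mu * (Rabs a + Rabs a') * Rabs (a - a'))
    (fun x => W x - W' x - (a ^ 2 - a' ^ 2) * W2 P x) /\
  Rabs ((l2 - l2') * int_line (fun x => k2 P x * k2 P x)
        + (a - a') * (b2 P * (a ^ 2 + a * a' + a' ^ 2) + a2 P * mu))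
    <= Q * theta a a' mu ^ 2 * Rabs (a - a').

(** For a = a' the difference estimates have right-hand side 0. *)
Lemma projected_unique P r Q : expansion_bounds P r Q -> forall a mu W V l1 l2 W' V' l1' l2',
  projected P a mu W V l1 l2 -> projected P a mu W' V' l1' l2' ->
  small r mu W V -> small r mu W' V' ->
  (forall x, W x = W' x) /\ (forall x, V x = V' x).
Proof.
  intros H a mu W V l1 l2 W' V' l1' l2' HP HP' Hs Hs'.
  destruct (H _ _ _ _ _ _ _ _ _ _ _ HP HP' Hs Hs') as [_ [_ [Z [Y _]]]].
  split; intros x.
  - specialize (Y x). rewrite !Rminus_diag, Rabs_R0, Rmult_0_r, Rmult_0_l, Rminus_0_r in Y.
    assert (E := Rabs_eq_0 _ (Rle_antisym _ _ Y (Rabs_pos _))). lra.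
  - specialize (Z x). rewrite !Rminus_diag, Rabs_R0, Rmult_0_r, Rmult_0_l, Rminus_0_r in Z.
    assert (E := Rabs_eq_0 _ (Rle_antisym _ _ Z (Rabs_pos _))). lra.
Qed.

(* The reflection of a projected solution solves the same problem with l1 replaced by - l1. *)
Lemma multiplier_vanishes P sg r Q : symmetric P sg -> expansion_bounds P r Q ->
  forall a mu W V l1 l2, projected P a mu W V l1 l2 -> small r mu W V -> l1 = 0.
Proof.
  intros Sy H a mu W V l1 l2 HP Hs.
  assert (HR := projected_reflect P sg a mu W V l1 l2 Sy HP).
  assert (HsR : small r mu (fun x => W (- x)) (fun x => sg * V (- x))).
  { destruct Hs as [A1 [A2 A3]]. split; [intros x; apply A1 |]. split; [| exact A3].
    intros x. rewrite Rabs_mult. replace (Rabs sg) with 1; [rewrite Rmult_1_l; apply A2 |].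
    destruct (sy_sg Sy) as [-> | ->]; [rewrite Rabs_R1; reflexivity | rewrite Rabs_left; lra]. }
  destruct (projected_unique P r Q H _ _ _ _ _ _ _ _ _ _ HP HR Hs HsR) as [EW EV].
  apply functional_extensionality in EW. apply functional_extensionality in EV.
  rewrite <- EW, <- EV in HR. destruct HR as [S' _].
  destruct HP as [S _].
  destruct (crit_nontrivial (crit1 P)) as [x Hx].
  assert (E := solves_source_unique _ _ _ _ S S' x).
  assert (E' : l1 * k1 P x = 0) by lra.
  destruct (Rmult_integral _ _ E'); [assumption | contradiction].
Qed.

(** The amplitude involves V'(0), which uniform smallness does not control directly; the equation
    bounds V'', and Landau's inequality then bounds V'. Hence every solution with l2 = 0 in a small
    ball has a small amplitude. *)
Lemma level_small P L : constants P L -> exists C, 0 <= C /\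
  forall r a mu W V l1, 0 <= r <= 1 / 3 -> projected P a mu W V l1 0 -> small r mu W V -> Rabs a <= C * r.
Proof.
  intros HL. assert (L1 := L_ge1 HL).
  destruct (crit_bounded (crit2 P)) as [M HM].
  assert (M0 : 0 <= M) by (generalize (HM 0) (Rabs_pos (m2 P 0)); lra).
  assert (Pr := critical_rho (crit2 P)). set (rho := k2 P 0 ^ 2 + Derive (k2 P) 0 ^ 2) in *.
  set (C0 := Rabs (k2 P 0) + Rabs (Derive (k2 P) 0) * (2 + (M + 3 * L))).
  assert (HC0 : 0 <= C0).
  { apply Rplus_le_le_0_compat; [apply Rabs_pos |]. apply Rmult_le_pos; [apply Rabs_pos | lra]. }
  exists (C0 / rho). split; [apply Rdiv_le_0_compat; assumption |].
  intros r a mu W V l1 Hr HP Hs.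
  destruct (small_sized r mu W V ltac:(lra) Hs) as [_ Sz].
  destruct (small_bounds r mu W V ltac:(lra) Hs) as [Bd Bmu].
  destruct HP as [_ [S [_ <-]]]. destruct Hs as [_ [BV _]].
  assert (B1 : Rabs (Derive V 0) <= 2 * r + (M * r + 3 * L * 1 * r)).
  { apply (derive_bound V (Derive V) (fun x => m2 P x * V x - (GG P x (W x) (V x) mu * V x - 0 * k2 P x))).
    - intros y _. apply (solves_der S).
    - intros y _. apply (solves_der2 S).
    - intros y _. apply BV.
    - intros y _. destruct (Bd y) as [Bw Bv]. apply Rabs_minus_le; [apply Rabs_mult_le; [apply HM | apply BV] |].
      rewrite Rmult_0_l, Rminus_0_r. apply Rabs_mult_le; [| apply BV].
      apply (GG_bound P L HL); try assumption; [lra |]. eapply Rle_trans; [apply Sz | lra]. }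
  unfold level. fold rho. unfold Rdiv. rewrite Rabs_mult, (Rabs_pos_eq (/ rho)) by (left; apply Rinv_0_lt_compat, Pr).
  replace (C0 * / rho * r) with (C0 * r * / rho) by ring.
  apply Rmult_le_compat_r; [left; apply Rinv_0_lt_compat, Pr |].
  eapply Rle_trans; [apply Rabs_plus_le; apply Rabs_mult_le; [apply Rle_refl | apply BV | apply Rle_refl | exact B1] |].
  unfold C0. right. ring.
Qed.

Lemma lipschitz_continuity (f : R -> R) (C : R) : 0 <= C ->
  (forall x y, Rabs (f x - f y) <= C * Rabs (x - y)) -> continuity f.
Proof.
  intros HC H x. apply cont_pt. apply filterlim_locally. intros e. assert (Pe := cond_pos e).
  assert (Hd : 0 < e / (C + 1)) by (apply Rdiv_lt_0_compat; lra).
  exists (mkposreal _ Hd). intros y Hy. change (Rabs (y - x) < e / (C + 1)) in Hy. change (Rabs (f y - f x) < e).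
  eapply Rle_lt_trans; [apply H |].
  apply Rmult_lt_compat_r with (r := C + 1) in Hy; [| lra].
  replace (e / (C + 1) * (C + 1)) with (pos e) in Hy by (field; lra).
  generalize (Rabs_pos (y - x)). nra.
Qed.

Lemma clamp_lipschitz (lo hi x y : R) :
  Rabs (Rmax lo (Rmin hi x) - Rmax lo (Rmin hi y)) <= Rabs (x - y).
Proof.
  apply Rle_trans with (Rabs (Rmin hi x - Rmin hi y)).
  - generalize (Rmin hi x) (Rmin hi y). intros u v. unfold Rmax, Rabs.
    destruct (Rle_dec lo u), (Rle_dec lo v), (Rcase_abs (u - v)); match goal with |- context [Rcase_abs ?t] => destruct (Rcase_abs t) | _ => idtac end; lra.
  - unfold Rmin, Rabs.
    destruct (Rle_dec hi x), (Rle_dec hi y), (Rcase_abs (x - y)); match goal with |- context [Rcase_abs ?t] => destruct (Rcase_abs t) | _ => idtac end; lra.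
Qed.

(** With t = a^2 + |mu|, the part Q t |mu| of the remainder is absorbed by |a2| |mu| and the part Q
    t a^2 is at most |b2| a^2. This leaves |mu| <= c a^2, whence the factor 4 in c, and the
    remainder becomes O(a^4). *)
Lemma reduced_equation (a2 b2 Q mu a : R) : a2 <> 0 -> b2 <> 0 -> 0 < Q -> a <> 0 ->
  let c := 4 * Rabs b2 / Rabs a2 in let c2 := Q * (1 + c) ^ 2 / Rabs b2 in
  Rabs (b2 * a ^ 2 + a2 * mu) <= Q * (a ^ 2 + Rabs mu) ^ 2 ->
  Q * (a ^ 2 + Rabs mu) <= Rabs a2 / 2 -> Q * (a ^ 2 + Rabs mu) <= Rabs b2 ->
  c2 * a ^ 2 <= 1 / 2 ->
  Rabs mu <= c * a ^ 2 /\ Rabs (b2 * a ^ 2 + a2 * mu) <= Rabs b2 * (c2 * a ^ 4) /\ 0 < - b2 / a2 * mu.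
Proof.
  intros Ha2 Hb2 HQ Ha c c2 HE H1 H2 H3.
  assert (Pal : 0 < Rabs a2) by (apply Rabs_pos_lt; assumption). assert (Pbe : 0 < Rabs b2) by (apply Rabs_pos_lt; assumption).
  assert (Pm := Rabs_pos mu). assert (Pa : 0 < a ^ 2) by nra.
  set (E := b2 * a ^ 2 + a2 * mu) in *. set (t := a ^ 2 + Rabs mu) in *.
  assert (Pt : 0 < t) by (unfold t; lra).
  assert (M1 : Rabs a2 * Rabs mu <= Rabs E + Rabs b2 * a ^ 2).
  { rewrite <- Rabs_mult. replace (a2 * mu) with (E - b2 * a ^ 2) by (unfold E; ring).
    apply Rabs_minus_le; [apply Rle_refl |]. rewrite Rabs_mult, (Rabs_pos_eq (a ^ 2)) by lra. lra. }
  assert (M2 : Rabs mu <= c * a ^ 2).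
  { assert (Q * t * Rabs mu <= Rabs a2 / 2 * Rabs mu) by nra.
    assert (Q * t * a ^ 2 <= Rabs b2 * a ^ 2) by nra.
    assert (Q * t ^ 2 = Q * t * Rabs mu + Q * t * a ^ 2) by (unfold t; ring).
    apply Rmult_le_reg_l with (Rabs a2); [exact Pal |].
    unfold c. replace (Rabs a2 * (4 * Rabs b2 / Rabs a2 * a ^ 2)) with (4 * (Rabs b2 * a ^ 2)) by (field; lra). lra. }
  assert (M3 : Rabs E <= Rabs b2 * (c2 * a ^ 4)).
  { eapply Rle_trans; [exact HE |]. unfold c2. replace (Rabs b2 * (Q * (1 + c) ^ 2 / Rabs b2 * a ^ 4)) with (Q * ((1 + c) * a ^ 2) ^ 2) by (field; lra).
    apply Rmult_le_compat_l; [lra |]. apply pow_incr. unfold t in *. lra. }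
  split; [exact M2 |]. split; [exact M3 |].
  (* Since |E| <= |b2| a^2 / 2, the term b2^2 a^2 decides the sign. *)
  assert (S : - b2 / a2 * mu = (b2 ^ 2 * a ^ 2 - b2 * E) / a2 ^ 2) by (unfold E; field; assumption).
  rewrite S. apply Rdiv_lt_0_compat; [| apply pow2_gt_0; assumption].
  assert (M4 : Rabs (b2 * E) <= Rabs b2 * (Rabs b2 * (a ^ 2 / 2))).
  { apply Rabs_mult_le; [apply Rle_refl |]. eapply Rle_trans; [exact M3 |]. apply Rmult_le_compat_l; [lra |].
    replace (c2 * a ^ 4) with (c2 * a ^ 2 * a ^ 2) by ring. nra. }
  replace (Rabs b2 * (Rabs b2 * (a ^ 2 / 2))) with (Rabs b2 ^ 2 * a ^ 2 / 2) in M4 by field. rewrite pow2_abs in M4.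
  assert (0 < b2 ^ 2) by nra.
  assert (0 < b2 ^ 2 * a ^ 2) by nra.
  generalize (Rle_abs (b2 * E)). lra.
Qed.

(** For mu = mb eps^2 the reduced equation, multiplied by b2, reads n b2 l2 = - a b2^2 (a^2 - eps^2)
    up to an error of at most a b2^2 eps^2 / 2. The main term is 3/4 a b2^2 eps^2 at a = eps / 2 and
    - 3 a b2^2 eps^2 at a = 2 eps, so l2 changes sign in between; its continuity in a is the
    comparison of two solutions. *)
Lemma multiplier_root P sg r r1 Q alpha : symmetric P sg -> expansion_bounds P r Q -> 0 < Q ->
  a2 P <> 0 -> b2 P <> 0 -> 0 < r1 -> r1 <= r -> 0 < alpha ->
  (forall a mu, Rabs a <= alpha -> Rabs mu <= r1 ->
     exists W V l1 l2, projected P a mu W V l1 l2 /\ small r1 mu W V) ->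
  exists eps0, 0 < eps0 /\ forall eps, 0 < eps < eps0 ->
    exists a W V, 0 < a /\ projected P a (- b2 P / a2 P * eps ^ 2) W V 0 0 /\
      small r1 (- b2 P / a2 P * eps ^ 2) W V.
Proof.
  intros Sy HX HQ Ha2 Hb2 Hr1 Hr1r Hal Hex.
  set (mb := - b2 P / a2 P).
  assert (Pmb := Rabs_pos mb). assert (Pbe : 0 < Rabs (b2 P)) by (apply Rabs_pos_lt; assumption).
  set (c := 4 + Rabs mb).
  assert (Pc : 0 < Q * c ^ 2) by (apply Rmult_lt_0_compat; [exact HQ | apply pow_lt; unfold c; lra]).
  (* Summand by summand, S eps <= 1 gives eps <= 1, 2 eps <= alpha, |mb| eps^2 <= r1 and, as theta
     <= c eps^2 for a <= 2 eps, the error bound Q theta^2 <= |b2| eps^2 / 2. *)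
  set (S := 1 + 2 / alpha + Rabs mb / r1 + 2 * (Q * c ^ 2) / Rabs (b2 P)).
  assert (S1 : 0 < 2 / alpha) by (apply Rdiv_lt_0_compat; lra).
  assert (S2 : 0 <= Rabs mb / r1) by (apply Rdiv_le_0_compat; lra).
  assert (S3 : 0 < 2 * (Q * c ^ 2) / Rabs (b2 P)) by (apply Rdiv_lt_0_compat; lra).
  exists (/ S). split; [apply Rinv_0_lt_compat; unfold S; lra |].
  intros eps [He0 He].
  assert (HS : S * eps <= 1).
  { apply Rmult_lt_compat_l with (r := S) in He; [| unfold S; lra]. rewrite Rinv_r in He by (unfold S; lra). lra. }
  assert (Pe2 : 0 < eps ^ 2) by (apply pow_lt; assumption).
  assert (He1 : eps <= 1) by (unfold S in HS; nra).
  assert (He2 : eps ^ 2 <= eps) by nra.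
  assert (Ealpha : 2 * eps <= alpha).
  { assert (2 / alpha * eps <= 1) by (unfold S in HS; nra).
    apply Rmult_le_compat_l with (r := alpha) in H; [| lra].
    replace (alpha * (2 / alpha * eps)) with (2 * eps) in H by (field; lra). lra. }
  assert (Emu : Rabs mb * eps ^ 2 <= r1).
  { assert (Rabs mb / r1 * eps <= 1) by (unfold S in HS; nra).
    apply Rmult_le_compat_l with (r := r1) in H; [| lra].
    replace (r1 * (Rabs mb / r1 * eps)) with (Rabs mb * eps) in H by (field; lra). nra. }
  assert (Eb : 2 * (Q * c ^ 2) * eps ^ 2 <= Rabs (b2 P)).
  { assert (2 * (Q * c ^ 2) / Rabs (b2 P) * eps <= 1) by (unfold S in HS; nra).
    apply Rmult_le_compat_l with (r := Rabs (b2 P)) in H; [| lra].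
    replace (Rabs (b2 P) * (2 * (Q * c ^ 2) / Rabs (b2 P) * eps)) with (2 * (Q * c ^ 2) * eps) in H by (field; lra). nra. }
  set (mu := mb * eps ^ 2).
  assert (Amu : Rabs mu = Rabs mb * eps ^ 2) by (unfold mu; rewrite Rabs_mult, (Rabs_pos_eq (eps ^ 2)); lra).
  set (lo := eps / 2). set (hi := 2 * eps).
  (* The multiplier becomes a function of a by choice; outside [lo, hi] its value is arbitrary. *)
  assert (Sol : forall a, exists l2, lo <= a <= hi -> exists W V l1, projected P a mu W V l1 l2 /\ small r1 mu W V).
  { intros a. destruct (classic (lo <= a <= hi)) as [Ha|Ha]; [| exists 0; intros; contradiction].
    destruct (Hex a mu) as [W [V [l1 [l2 H]]]].
    - rewrite Rabs_pos_eq; unfold lo, hi in Ha; lra.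
    - lra.
    - exists l2. intros _. exists W, V, l1. exact H. }
  pose (phi := fun a => proj1_sig (constructive_indefinite_description _ (Sol a))).
  assert (Hphi : forall a, lo <= a <= hi -> exists W V l1, projected P a mu W V l1 (phi a) /\ small r1 mu W V)
    by (intros a; exact (proj2_sig (constructive_indefinite_description _ (Sol a)))).
  assert (Sm : forall W V, small r1 mu W V -> small r mu W V).
  { intros W V [A1 [A2 A3]]. split; [intros x; specialize (A1 x); lra |]. split; [intros x; specialize (A2 x); lra | lra]. }
  assert (Pn := critical_norm_pos (crit2 P)). set (n := int_line (fun x => k2 P x * k2 P x)) in *.
  (* The argument is clamped to [lo, hi] because the intermediate value theorem is applied to a
     function continuous on the whole line; the sign makes f negative at lo and positive at hi. *)
  set (f := fun a => - (b2 P * phi (Rmax lo (Rmin hi a)))).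
  assert (Hcl : forall a, lo <= Rmax lo (Rmin hi a) <= hi).
  { intros a. assert (lo <= hi) by (unfold lo, hi; lra). split; [apply Rmax_l |]. apply Rmax_lub; [assumption | apply Rmin_l]. }
  set (Cl := Rabs (b2 P) / n * (Rabs (b2 P) * (12 * eps ^ 2) + Rabs (a2 P) * Rabs mu + Q * (8 * eps ^ 2 + Rabs mu) ^ 2)).
  assert (HCl : 0 <= Cl).
  { assert (0 <= Rabs (b2 P) / n) by (apply Rdiv_le_0_compat; lra).
    apply Rmult_le_pos; [assumption |].
    assert (0 <= Rabs (b2 P) * (12 * eps ^ 2)) by (apply Rmult_le_pos; lra).
    assert (0 <= Rabs (a2 P) * Rabs mu) by (apply Rmult_le_pos; apply Rabs_pos).
    assert (0 <= Q * (8 * eps ^ 2 + Rabs mu) ^ 2) by (apply Rmult_le_pos; [lra | apply pow2_ge_0]). lra. }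
  assert (Lip : forall a a', lo <= a <= hi -> lo <= a' <= hi -> Rabs (b2 P * phi a - b2 P * phi a') <= Cl * Rabs (a - a')).
  { intros a a' Ha Ha'.
    destruct (Hphi a Ha) as [W [V [l1 [HP Hs]]]]. destruct (Hphi a' Ha') as [W' [V' [l1' [HP' Hs']]]].
    destruct (HX _ _ _ _ _ _ _ _ _ _ _ HP HP' (Sm _ _ Hs) (Sm _ _ Hs')) as [_ [_ [_ [_ E]]]].
    set (D := Rabs (a - a')) in *. assert (PD : 0 <= D) by apply Rabs_pos.
    assert (SqA : a ^ 2 <= 4 * eps ^ 2 /\ a * a' <= 4 * eps ^ 2 /\ a' ^ 2 <= 4 * eps ^ 2 /\ 0 <= a * a').
    { assert (0 <= a) by (unfold lo in Ha; lra). assert (0 <= a') by (unfold lo in Ha'; lra).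
      assert (Pr : forall u v, 0 <= u <= hi -> 0 <= v <= hi -> 0 <= u * v <= 4 * eps ^ 2).
      { intros u v Hu Hv. split; [apply Rmult_le_pos; lra |].
        replace (4 * eps ^ 2) with (hi * hi) by (unfold hi; ring). apply Rmult_le_compat; lra. }
      assert (P1 := Pr a a ltac:(lra) ltac:(lra)). assert (P2 := Pr a a' ltac:(lra) ltac:(lra)). assert (P3 := Pr a' a' ltac:(lra) ltac:(lra)).
      replace (a ^ 2) with (a * a) by ring. replace (a' ^ 2) with (a' * a') by ring. lra. }
    assert (Th : 0 <= theta a a' mu <= 8 * eps ^ 2 + Rabs mu) by (split; [apply theta_pos | unfold theta; lra]).
    set (X := b2 P * (a ^ 2 + a * a' + a' ^ 2) + a2 P * mu) in *.
    assert (BX : Rabs X <= Rabs (b2 P) * (12 * eps ^ 2) + Rabs (a2 P) * Rabs mu).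
    { apply Rabs_plus_le; apply Rabs_mult_le; try apply Rle_refl.
      rewrite Rabs_pos_eq; [lra |]. generalize (pow2_ge_0 a) (pow2_ge_0 a'); lra. }
    assert (B1 : Rabs ((phi a - phi a') * n) <= D * (Rabs (b2 P) * (12 * eps ^ 2) + Rabs (a2 P) * Rabs mu + Q * (8 * eps ^ 2 + Rabs mu) ^ 2)).
    { replace ((phi a - phi a') * n) with ((phi a - phi a') * n + (a - a') * X - (a - a') * X) by ring.
      eapply Rle_trans; [apply Rabs_minus_le; [exact E | apply Rabs_mult_le; [apply Rle_refl | exact BX]] |].
      fold D. assert (Q * theta a a' mu ^ 2 * D <= Q * (8 * eps ^ 2 + Rabs mu) ^ 2 * D).
      { apply Rmult_le_compat_r; [exact PD |]. apply Rmult_le_compat_l; [lra |]. apply pow_incr. exact Th. }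
      lra. }
    replace (b2 P * phi a - b2 P * phi a') with (b2 P / n * ((phi a - phi a') * n)) by (field; lra).
    eapply Rle_trans; [apply Rabs_mult_le; [apply Rle_refl | exact B1] |].
    unfold Cl. unfold Rdiv. rewrite Rabs_mult, (Rabs_pos_eq (/ n)) by (left; apply Rinv_0_lt_compat; lra). right. ring. }
  assert (Cf : continuity f).
  { apply (lipschitz_continuity f Cl HCl). intros x y. unfold f.
    replace (- (b2 P * phi (Rmax lo (Rmin hi x))) - - (b2 P * phi (Rmax lo (Rmin hi y))))
      with (- (b2 P * phi (Rmax lo (Rmin hi x)) - b2 P * phi (Rmax lo (Rmin hi y)))) by ring.
    rewrite Rabs_Ropp. eapply Rle_trans; [apply Lip; apply Hcl |].
    apply Rmult_le_compat_l; [exact HCl |]. apply clamp_lipschitz. }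
  assert (Main : forall a, lo <= a <= hi ->
     Rabs (n * (b2 P * phi a) + a * (b2 P ^ 2 * (a ^ 2 - eps ^ 2))) <= a * (b2 P ^ 2 * (eps ^ 2 / 2))).
  { intros a Ha. destruct (Hphi a Ha) as [W [V [l1 [HP Hs]]]].
    assert (Hs0 := small_zero r mu W V (Sm _ _ Hs) ltac:(lra)).
    destruct (HX _ _ _ _ _ _ _ _ _ _ _ HP (projected_zero P mu) (Sm _ _ Hs) Hs0) as [_ [_ [_ [_ E]]]].
    rewrite !Rminus_0_r in E. rewrite (Rabs_pos_eq a) in E by (unfold lo in Ha; lra).
    assert (Pa : 0 < a) by (unfold lo in Ha; lra).
    assert (Th : 0 <= theta a 0 mu <= c * eps ^ 2).
    { split; [apply theta_pos |]. unfold theta, c. rewrite Amu. assert (a ^ 2 <= 4 * eps ^ 2)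
        by (replace (4 * eps ^ 2) with (hi ^ 2) by (unfold hi; ring); apply pow_incr; lra).
      simpl. simpl in H. lra. }
    replace (n * (b2 P * phi a) + a * (b2 P ^ 2 * (a ^ 2 - eps ^ 2)))
      with (b2 P * (phi a * n + a * (b2 P * (a ^ 2 + a * 0 + 0 ^ 2) + a2 P * mu))) by (unfold mu, mb; field; assumption).
    eapply Rle_trans; [apply Rabs_mult_le; [apply Rle_refl | exact E] |].
    rewrite <- (pow2_abs (b2 P)).
    replace (a * (Rabs (b2 P) ^ 2 * (eps ^ 2 / 2))) with (Rabs (b2 P) * (Rabs (b2 P) * (eps ^ 2 / 2) * a)) by ring.
    apply Rmult_le_compat_l; [lra |]. apply Rmult_le_compat_r; [lra |].
    apply Rle_trans with (Q * (c * eps ^ 2) ^ 2).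
    - apply Rmult_le_compat_l; [lra |]. apply pow_incr. exact Th.
    - replace (Q * (c * eps ^ 2) ^ 2) with (2 * (Q * c ^ 2) * eps ^ 2 * (eps ^ 2 / 2)) by field.
      apply Rmult_le_compat_r; lra. }
  assert (Pb2 : 0 < b2 P ^ 2) by nra.
  assert (Pbe2 : 0 < b2 P ^ 2 * eps ^ 2) by nra.
  assert (Plo : 0 < lo) by (unfold lo; lra). assert (Phi : 0 < hi) by (unfold hi; lra).
  assert (Hlh : lo < hi) by (unfold lo, hi; lra).
  assert (Flo : f lo < 0).
  { unfold f. rewrite (Rmin_right hi lo), (Rmax_left lo lo) by lra.
    assert (Mn := Main lo ltac:(lra)). apply Rabs_le_between in Mn.
    assert (lo * (b2 P ^ 2 * (lo ^ 2 - eps ^ 2)) = - (3 / 4) * (lo * (b2 P ^ 2 * eps ^ 2))) by (unfold lo; field).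
    assert (0 < b2 P * phi lo) by nra. lra. }
  assert (Fhi : 0 < f hi).
  { unfold f. rewrite (Rmin_left hi hi), (Rmax_right lo hi) by lra.
    assert (Mn := Main hi ltac:(lra)). apply Rabs_le_between in Mn.
    assert (hi * (b2 P ^ 2 * (hi ^ 2 - eps ^ 2)) = 3 * (hi * (b2 P ^ 2 * eps ^ 2))) by (unfold hi; field).
    assert (b2 P * phi hi < 0) by nra. lra. }
  destruct (IVT f lo hi Cf Hlh Flo Fhi) as [z [Hz Fz]].
  assert (Ez : Rmax lo (Rmin hi z) = z) by (rewrite Rmin_right, Rmax_right; lra).
  unfold f in Fz. rewrite Ez in Fz.
  assert (Pz : phi z = 0) by nra.
  destruct (Hphi z Hz) as [W [V [l1 [HP Hs]]]]. rewrite Pz in HP.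
  assert (El := multiplier_vanishes P sg r Q Sy HX _ _ _ _ _ _ HP (Sm _ _ Hs)). subst l1.
  exists z, W, V. split; [lra |]. split; assumption.
Qed.

(** The conclusions on size and uniqueness concern arbitrary solutions in a fixed ball, so that they
    apply to any homoclinic solution near the wave and not only to the constructed branch. At l2 = 0
    the reduced equation with mu = mb eps^2 gives |a^2 - eps^2| <= c2 a^4, by which expansions in a
    turn into expansions in eps. *)
Theorem abstract_pitchfork P sg : symmetric P sg -> a2 P <> 0 -> b2 P <> 0 ->
  let mb := - b2 P / a2 P in
  exists r K, 0 < r <= 1 /\ 0 <= K /\
  (forall a mu W V l1 l2, projected P a mu W V l1 l2 -> small r mu W V -> a = 0 -> forall x, V x = 0) /\
  (forall a mu W V, projected P a mu W V 0 0 -> small r mu W V -> a <> 0 -> 0 < mb * mu) /\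
  (forall a eps W V, 0 < eps -> 0 < a -> projected P a (mb * eps ^ 2) W V 0 0 -> small r (mb * eps ^ 2) W V ->
     bounded_by (K * eps ^ 4) (fun x => W x - eps ^ 2 * W2 P x) /\
     bounded_by (K * eps ^ 3) (fun x => V x - eps * k2 P x)) /\
  (forall a a' mu W V W' V', 0 < a -> 0 < a' ->
     projected P a mu W V 0 0 -> projected P a' mu W' V' 0 0 -> small r mu W V -> small r mu W' V' ->
     (forall x, W x = W' x) /\ (forall x, V x = V' x)) /\
  (exists eps0, 0 < eps0 /\ forall eps, 0 < eps < eps0 ->
     exists a W V, 0 < a /\ projected P a (mb * eps ^ 2) W V 0 0 /\ small r (mb * eps ^ 2) W V).
Proof.
  intros Sy Ha2 Hb2 mb.
  destruct (constants_exist P) as [L HL]. assert (L1 := L_ge1 HL).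
  destruct (projected_expansion P L HL) as [r0 [Q [Hr0 [HQ HX]]]]. fold (expansion_bounds P r0 Q) in HX.
  destruct (level_small P L HL) as [Cl [HCl Hlev]].
  destruct (projected_exists P) as [r1 [Hr1 Hex]].
  assert (Pal : 0 < Rabs (a2 P)) by (apply Rabs_pos_lt; assumption).
  assert (Pbe : 0 < Rabs (b2 P)) by (apply Rabs_pos_lt; assumption).
  set (c := 4 * Rabs (b2 P) / Rabs (a2 P)). set (c2 := Q * (1 + c) ^ 2 / Rabs (b2 P)).
  assert (Pc : 0 < c) by (apply Rdiv_lt_0_compat; lra).
  assert (Pc2 : 0 < c2) by (apply Rdiv_lt_0_compat; [apply Rmult_lt_0_compat; [lra | apply pow_lt; lra] | exact Pbe]).
  (* The constant in |b2| (a a' + a'^2) <= c3 a'^4, reached in the uniqueness argument: there a^2 <=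
     3 a'^2, whence 9 in the bound of a^4 and theta <= (4 + 3 c) a'^2. *)
  set (c3 := 9 * (Q * (1 + c) ^ 2) + Q * (4 + 3 * c) ^ 2).
  assert (Pc3 : 0 < c3).
  { unfold c3. assert (0 < Q * (1 + c) ^ 2) by nra.
    assert (0 < Q * (4 + 3 * c) ^ 2) by nra. lra. }
  (* The first three summands pay for the smallness conditions of [reduced_equation], the last one
     for uniqueness. *)
  set (S := 2 * Q / Rabs (a2 P) + Q / Rabs (b2 P) + 2 * c2 + 2 * c3 / Rabs (b2 P)).
  assert (S1 : 0 < 2 * Q / Rabs (a2 P)) by (apply Rdiv_lt_0_compat; lra).
  assert (S2 : 0 < Q / Rabs (b2 P)) by (apply Rdiv_lt_0_compat; lra).
  assert (S3 : 0 < 2 * c3 / Rabs (b2 P)) by (apply Rdiv_lt_0_compat; lra).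
  assert (PS : 0 < S) by (unfold S; lra).
  (* The last entry gives S (a^2 + |mu|) <= 1 for all solutions in the ball, since |a| <= Cl r and
     |mu| <= r imply a^2 + |mu| <= (Cl^2 + 1) r. *)
  set (r := Rmin (Rmin r0 r1) (Rmin (1 / 3) (/ (S * (Cl ^ 2 + 1))))).
  assert (PCl : 0 < Cl ^ 2 + 1) by (generalize (pow2_ge_0 Cl); lra).
  assert (Hr : 0 < r /\ r <= r0 /\ r <= r1 /\ r <= 1 / 3 /\ r <= / (S * (Cl ^ 2 + 1))).
  { unfold r. split; [repeat apply Rmin_glb_lt; try lra; apply Rinv_0_lt_compat, Rmult_lt_0_compat; assumption |].
    generalize (Rmin_l (Rmin r0 r1) (Rmin (1 / 3) (/ (S * (Cl ^ 2 + 1))))) (Rmin_r (Rmin r0 r1) (Rmin (1 / 3) (/ (S * (Cl ^ 2 + 1)))))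
      (Rmin_l r0 r1) (Rmin_r r0 r1) (Rmin_l (1 / 3) (/ (S * (Cl ^ 2 + 1)))) (Rmin_r (1 / 3) (/ (S * (Cl ^ 2 + 1)))). lra. }
  destruct Hr as [Pr [Hrr0 [Hrr1 [Hr3 HrS]]]].
  assert (SmX : forall mu W V, small r mu W V -> small r0 mu W V).
  { intros mu W V [A1 [A2 A3]]. split; [intros x; specialize (A1 x); lra |]. split; [intros x; specialize (A2 x); lra | lra]. }
  assert (Small : forall a mu W V, projected P a mu W V 0 0 -> small r mu W V ->
     S * (a ^ 2 + Rabs mu) <= 1).
  { intros a mu W V HP Hs. assert (Ba := Hlev r a mu W V 0 ltac:(lra) HP Hs).
    assert (a ^ 2 <= Cl ^ 2 * r).
    { rewrite <- pow2_abs. apply Rle_trans with ((Cl * r) ^ 2); [apply pow_incr; split; [apply Rabs_pos | exact Ba] |].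
      rewrite Rpow_mult_distr. apply Rmult_le_compat_l; [apply pow2_ge_0 |].
      replace (r ^ 2) with (r * r) by ring. rewrite <- (Rmult_1_l r) at 3. apply Rmult_le_compat_r; lra. }
    assert (Bm : Rabs mu <= r) by apply Hs.
    apply Rle_trans with (S * ((Cl ^ 2 + 1) * r)); [apply Rmult_le_compat_l; lra |].
    apply Rmult_le_compat_l with (r := S * (Cl ^ 2 + 1)) in HrS; [| left; apply Rmult_lt_0_compat; assumption].
    rewrite Rinv_r in HrS; [lra |]. apply Rgt_not_eq. apply Rmult_lt_0_compat; assumption. }
  assert (Red : forall a mu W V, projected P a mu W V 0 0 -> small r mu W V -> a <> 0 ->
     Rabs mu <= c * a ^ 2 /\ Rabs (b2 P * a ^ 2 + a2 P * mu) <= Rabs (b2 P) * (c2 * a ^ 4) /\ 0 < mb * mu).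
  { intros a mu W V HP Hs Ha. assert (Sm := Small a mu W V HP Hs).
    assert (Pt : 0 <= a ^ 2 + Rabs mu) by (generalize (pow2_ge_0 a) (Rabs_pos mu); lra).
    assert (Hs0 := small_zero r0 mu W V (SmX _ _ _ Hs) ltac:(lra)).
    destruct (HX _ _ _ _ _ _ _ _ _ _ _ HP (projected_zero P mu) (SmX _ _ _ Hs) Hs0) as [_ [_ [_ [_ E]]]].
    apply (reduced_equation (a2 P) (b2 P) Q mu a Ha2 Hb2); fold c; fold c2; try assumption; try lra.
    - rewrite !Rminus_0_r, Rmult_0_l, Rplus_0_l, Rabs_mult in E.
      replace (b2 P * (a ^ 2 + a * 0 + 0 ^ 2) + a2 P * mu) with (b2 P * a ^ 2 + a2 P * mu) in E by ring.
      replace (theta a 0 mu) with (a ^ 2 + Rabs mu) in E by (unfold theta; ring).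
      apply Rmult_le_reg_l with (Rabs a); [apply Rabs_pos_lt; assumption |]. lra.
    - assert (E1 : 2 * Q / Rabs (a2 P) * (a ^ 2 + Rabs mu) <= 1)
        by (apply Rle_trans with (2 := Sm); apply Rmult_le_compat_r; [exact Pt | unfold S; lra]).
      apply Rmult_le_compat_l with (r := Rabs (a2 P) / 2) in E1; [| lra].
      replace (Rabs (a2 P) / 2 * (2 * Q / Rabs (a2 P) * (a ^ 2 + Rabs mu))) with (Q * (a ^ 2 + Rabs mu)) in E1 by (field; lra). lra.
    - assert (E1 : Q / Rabs (b2 P) * (a ^ 2 + Rabs mu) <= 1)
        by (apply Rle_trans with (2 := Sm); apply Rmult_le_compat_r; [exact Pt | unfold S; lra]).
      apply Rmult_le_compat_l with (r := Rabs (b2 P)) in E1; [| lra].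
      replace (Rabs (b2 P) * (Q / Rabs (b2 P) * (a ^ 2 + Rabs mu))) with (Q * (a ^ 2 + Rabs mu)) in E1 by (field; lra). lra.
    - assert (E1 : 2 * c2 * (a ^ 2 + Rabs mu) <= 1)
        by (apply Rle_trans with (2 := Sm); apply Rmult_le_compat_r; [exact Pt | unfold S; lra]).
      assert (0 <= c2 * Rabs mu) by (apply Rmult_le_pos; [lra | apply Rabs_pos]). lra. }
  assert (Cmp : forall a eps W V, 0 < eps -> 0 < a -> projected P a (mb * eps ^ 2) W V 0 0 -> small r (mb * eps ^ 2) W V ->
     Rabs (a ^ 2 - eps ^ 2) <= c2 * a ^ 4 /\ a ^ 2 <= 2 * eps ^ 2 /\ eps ^ 2 <= 3 / 2 * a ^ 2).
  { intros a eps W V He Ha HP Hs. destruct (Red _ _ _ _ HP Hs ltac:(lra)) as [_ [R2 _]].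
    assert (Sm := Small _ _ _ _ HP Hs).
    replace (b2 P * a ^ 2 + a2 P * (mb * eps ^ 2)) with (b2 P * (a ^ 2 - eps ^ 2)) in R2 by (unfold mb; field; assumption).
    rewrite Rabs_mult in R2. apply Rmult_le_reg_l in R2; [| exact Pbe].
    assert (Pa2 : 0 < a ^ 2) by (apply pow_lt; exact Ha).
    assert (c2 * a ^ 2 <= 1 / 2).
    { assert (Pm := Rabs_pos (mb * eps ^ 2)).
      assert (2 * c2 * (a ^ 2 + Rabs (mb * eps ^ 2)) <= 1)
        by (apply Rle_trans with (2 := Sm); apply Rmult_le_compat_r; [lra | unfold S; lra]).
      assert (0 <= c2 * Rabs (mb * eps ^ 2)) by (apply Rmult_le_pos; lra). lra. }
    assert (R3 : c2 * a ^ 4 <= a ^ 2 / 2) by (replace (c2 * a ^ 4) with (c2 * a ^ 2 * a ^ 2) by ring; replace (a ^ 2 / 2) with (1 / 2 * a ^ 2) by field; apply Rmult_le_compat_r; lra).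
    split; [exact R2 |]. assert (R4 : Rabs (a ^ 2 - eps ^ 2) <= a ^ 2 / 2) by lra.
    apply Rabs_le_between in R4. lra. }
  exists r, (4 * (Q * (1 + c)) + 4 * c2 * L).
  assert (PQc : 0 < Q * (1 + c)) by (apply Rmult_lt_0_compat; lra).
  assert (Pc2L : 0 < c2 * L) by (apply Rmult_lt_0_compat; lra).
  split; [lra |]. split; [lra |].
  split; [| split; [| split; [| split]]].
  - intros a mu W V l1 l2 HP Hs E0 x. assert (Hs0 := small_zero r0 mu W V (SmX _ _ _ Hs) ltac:(lra)).
    destruct (HX _ _ _ _ _ _ _ _ _ _ _ HP (projected_zero P mu) (SmX _ _ _ Hs) Hs0) as [E _].
    specialize (E x). rewrite E0, Rabs_R0, Rmult_0_r in E.
    apply Rabs_eq_0, Rle_antisym; [exact E | apply Rabs_pos].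
  - intros a mu W V HP Hs Ha. apply (Red a mu W V HP Hs Ha).
  - intros a eps W V He Ha HP Hs. set (mu := mb * eps ^ 2) in *.
    destruct (Cmp a eps W V He Ha HP Hs) as [C1 [C2 C3]].
    destruct (Red _ _ _ _ HP Hs ltac:(lra)) as [R1 _].
    assert (Hs0 := small_zero r0 mu W V (SmX _ _ _ Hs) ltac:(lra)).
    destruct (HX _ _ _ _ _ _ _ _ _ _ _ HP (projected_zero P mu) (SmX _ _ _ Hs) Hs0) as [_ [_ [EV [EW _]]]].
    rewrite Rabs_R0, Rplus_0_r, !Rminus_0_r, (Rabs_pos_eq a) in EW by lra.
    rewrite !Rminus_0_r, (Rabs_pos_eq a) in EV by lra.
    assert (Th : theta a 0 mu <= (1 + c) * a ^ 2) by (unfold theta; simpl; simpl in R1; lra).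
    assert (Th0 := theta_pos a 0 mu).
    assert (A4 : a ^ 4 <= 4 * eps ^ 4).
    { replace (a ^ 4) with (a ^ 2 * a ^ 2) by ring. replace (4 * eps ^ 4) with (2 * eps ^ 2 * (2 * eps ^ 2)) by ring.
      apply Rmult_le_compat; lra. }
    assert (Cm : Rabs (a ^ 2 - eps ^ 2) <= 4 * c2 * eps ^ 4).
    { eapply Rle_trans; [exact C1 |]. replace (4 * c2 * eps ^ 4) with (c2 * (4 * eps ^ 4)) by ring. apply Rmult_le_compat_l; lra. }
    assert (ale : a <= 2 * eps).
    { apply Rsqr_incr_0; [unfold Rsqr | lra | lra].
      replace (a * a) with (a ^ 2) by ring. replace (2 * eps * (2 * eps)) with (4 * eps ^ 2) by ring. lra. }
    split; intros x; destruct (coeff_bounds P L x HL) as [_ [_ [_ [_ [BW2 Bk2]]]]].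
    + specialize (EW x). replace (0 ^ 2) with 0 in EW by ring. rewrite !Rminus_0_r in EW.
      replace (W x - eps ^ 2 * W2 P x) with ((W x - a ^ 2 * W2 P x) + (a ^ 2 - eps ^ 2) * W2 P x) by ring.
      eapply Rle_trans; [apply Rabs_plus_le; [exact EW | apply Rabs_mult_le; [exact Cm | exact BW2]] |].
      assert (Q * theta a 0 mu * a * a <= Q * (1 + c) * a ^ 4).
      { replace (Q * theta a 0 mu * a * a) with (Q * a ^ 2 * theta a 0 mu) by ring.
        replace (Q * (1 + c) * a ^ 4) with (Q * a ^ 2 * ((1 + c) * a ^ 2)) by ring.
        apply Rmult_le_compat_l; [|exact Th]. apply Rmult_le_pos; lra. }
      assert (Q * (1 + c) * a ^ 4 <= Q * (1 + c) * (4 * eps ^ 4)) by (apply Rmult_le_compat_l; lra).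
      lra.
    + specialize (EV x). cbv beta in EV. rewrite !Rminus_0_r in EV.
      replace (V x - eps * k2 P x) with ((V x - a * k2 P x) + (a - eps) * k2 P x) by ring.
      (* |a^2 - eps^2| = O(eps^4) is divided by a + eps >= eps. *)
      assert (Ca : Rabs (a - eps) <= 4 * c2 * eps ^ 3).
      { apply Rmult_le_reg_r with eps; [exact He |].
        apply Rle_trans with (Rabs (a - eps) * (a + eps)).
        - apply Rmult_le_compat_l; [apply Rabs_pos | lra].
        - rewrite <- (Rabs_pos_eq (a + eps)) by lra. rewrite <- Rabs_mult.
          replace ((a - eps) * (a + eps)) with (a ^ 2 - eps ^ 2) by ring.
          eapply Rle_trans; [exact Cm |]. right. ring. }
      eapply Rle_trans; [apply Rabs_plus_le; [exact EV | apply Rabs_mult_le; [exact Ca | exact Bk2]] |].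
      assert (Q * theta a 0 mu * a <= Q * (1 + c) * (4 * eps ^ 3)).
      { apply Rle_trans with (Q * ((1 + c) * (2 * eps ^ 2)) * (2 * eps)).
        - apply Rmult_le_compat; [apply Rmult_le_pos; lra | lra | | exact ale].
          apply Rmult_le_compat_l; [lra |]. eapply Rle_trans; [exact Th |]. apply Rmult_le_compat_l; lra.
        - right. ring. }
      lra.
  - intros a a' mu W V W' V' Ha Ha' HP HP' Hs Hs'.
    destruct (Red _ _ _ _ HP Hs ltac:(lra)) as [R1 [R2 R3]].
    assert (Pmb : 0 < mb * mb)
      by (assert (Nmb : mb <> 0) by (intros E; rewrite E in R3; lra); exact (Rsqr_pos_lt mb Nmb)).
    assert (Pq : 0 < mu / mb).
    { replace (mu / mb) with (mb * mu / (mb * mb)) by (field; intros E; rewrite E in R3; lra). apply Rdiv_lt_0_compat; lra. }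
    set (eps := sqrt (mu / mb)). assert (Peps : 0 < eps) by (apply sqrt_lt_R0; exact Pq).
    assert (Emu : mu = mb * eps ^ 2).
    { unfold eps. rewrite pow2_sqrt by lra. field. intros E; rewrite E in R3; lra. }
    assert (HPe := HP). rewrite Emu in HPe. assert (Hse := Hs). rewrite Emu in Hse.
    assert (HPe' := HP'). rewrite Emu in HPe'. assert (Hse' := Hs'). rewrite Emu in Hse'.
    destruct (Cmp a eps W V Peps Ha HPe Hse) as [_ [C2 _]]. destruct (Cmp a' eps W' V' Peps Ha' HPe' Hse') as [_ [_ C3]].
    (* For a <> a', dividing by a - a' and subtracting the reduced equation of a leaves |b2| a' (a +
       a') <= c3 a'^4, which contradicts 2 c3 a'^2 <= |b2|. *)
    assert (Eaa : a = a').
    { apply NNPP. intros Hne.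
      destruct (HX _ _ _ _ _ _ _ _ _ _ _ HP HP' (SmX _ _ _ Hs) (SmX _ _ _ Hs')) as [_ [_ [_ [_ E]]]].
      rewrite Rminus_diag, Rmult_0_l, Rplus_0_l, Rabs_mult in E.
      assert (PD : 0 < Rabs (a - a')) by (apply Rabs_pos_lt; lra).
      assert (E' : Rabs (b2 P * (a ^ 2 + a * a' + a' ^ 2) + a2 P * mu) <= Q * theta a a' mu ^ 2).
      { apply Rmult_le_reg_l with (Rabs (a - a')); [exact PD |]. lra. }
      assert (Pa2 : 0 < a ^ 2) by (apply pow_lt; exact Ha). assert (Pa2' : 0 < a' ^ 2) by (apply pow_lt; exact Ha').
      assert (Th : 0 <= theta a a' mu <= (4 + 3 * c) * a' ^ 2).
      { split; [apply theta_pos |]. unfold theta. assert (c * a ^ 2 <= c * (3 * a' ^ 2)) by (apply Rmult_le_compat_l; lra). lra. }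
      assert (T2 : Q * theta a a' mu ^ 2 <= Q * (4 + 3 * c) ^ 2 * a' ^ 4).
      { replace (Q * (4 + 3 * c) ^ 2 * a' ^ 4) with (Q * ((4 + 3 * c) * a' ^ 2) ^ 2) by ring.
        apply Rmult_le_compat_l; [lra |]. apply pow_incr. exact Th. }
      assert (T3 : Rabs (b2 P) * (c2 * a ^ 4) <= 9 * (Q * (1 + c) ^ 2) * a' ^ 4).
      { unfold c2. replace (Rabs (b2 P) * (Q * (1 + c) ^ 2 / Rabs (b2 P) * a ^ 4)) with (Q * (1 + c) ^ 2 * (a ^ 2 * a ^ 2)) by (field; lra).
        replace (9 * (Q * (1 + c) ^ 2) * a' ^ 4) with (Q * (1 + c) ^ 2 * (3 * a' ^ 2 * (3 * a' ^ 2))) by ring.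
        apply Rmult_le_compat_l; [apply Rmult_le_pos; [lra | apply pow2_ge_0] |]. apply Rmult_le_compat; lra. }
      assert (T4 : Rabs (b2 P * (a * a' + a' ^ 2)) <= c3 * a' ^ 4).
      { replace (b2 P * (a * a' + a' ^ 2)) with ((b2 P * (a ^ 2 + a * a' + a' ^ 2) + a2 P * mu) - (b2 P * a ^ 2 + a2 P * mu)) by ring.
        eapply Rle_trans; [apply Rabs_minus_le; [exact E' | exact R2] |]. unfold c3. lra. }
      assert (Paa : 0 < a * a') by (apply Rmult_lt_0_compat; assumption).
      rewrite Rabs_mult, (Rabs_pos_eq (a * a' + a' ^ 2)) in T4 by lra.
      assert (Sm := Small _ _ _ _ HP' Hs').
      assert (Pm := Rabs_pos mu).
      assert (T5 : 2 * c3 / Rabs (b2 P) * a' ^ 2 <= 1).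
      { apply Rle_trans with (2 := Sm). apply Rmult_le_compat; [lra | lra | unfold S; lra | lra]. }
      apply Rmult_le_compat_l with (r := Rabs (b2 P)) in T5; [| lra].
      replace (Rabs (b2 P) * (2 * c3 / Rabs (b2 P) * a' ^ 2)) with (2 * (c3 * a' ^ 2)) in T5 by (field; lra).
      assert (T6 : Rabs (b2 P) * a' ^ 2 <= c3 * a' ^ 2 * a' ^ 2).
      { replace (c3 * a' ^ 2 * a' ^ 2) with (c3 * a' ^ 4) by ring. eapply Rle_trans; [| exact T4].
        apply Rmult_le_compat_l; lra. }
      apply Rmult_le_reg_r in T6; [lra | exact Pa2']. }
    subst a'. exact (projected_unique P r0 Q HX _ _ _ _ _ _ _ _ _ _ HP HP' (SmX _ _ _ Hs) (SmX _ _ _ Hs')).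
  - destruct (Hex r ltac:(lra)) as [alpha [Pal' Hsol]].
    exact (multiplier_root P sg r0 r Q alpha Sy HX ltac:(lra) Ha2 Hb2 Pr Hrr0 Pal' Hsol).
Qed.

(** * The CNLS nonlinearity *)

Lemma square_diff_le (u w w' beta : R) : Rabs u <= beta -> Rabs w <= 1 -> Rabs w' <= 1 ->
  Rabs ((u + w) ^ 2 - (u + w') ^ 2) <= (2 * beta + 2) * Rabs (w - w').
Proof.
  intros Hu Hw Hw'. replace ((u + w) ^ 2 - (u + w') ^ 2) with ((u + u + (w + w')) * (w - w')) by ring.
  rewrite Rabs_mult. apply Rmult_le_compat_r; [apply Rabs_pos |].
  eapply Rle_trans; [apply Rabs_plus_le; apply Rabs_plus_le; eassumption |]. lra.
Qed.

Lemma square_box (u w beta : R) : Rabs u <= beta -> Rabs w <= 1 -> Rabs ((u + w) ^ 2) <= (beta + 1) ^ 2.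
Proof.
  intros Hu Hw. rewrite <- RPow_abs. apply pow_incr. split; [apply Rabs_pos |].
  apply Rabs_plus_le; assumption.
Qed.

Lemma box_in (u w v mu beta : R) : 0 <= beta -> Rabs u <= beta -> Rabs w <= 1 -> Rabs v <= 1 -> Rabs mu <= 1 ->
  in_box ((beta + 1) ^ 2) ((u + w) ^ 2) (v ^ 2) mu.
Proof.
  intros Hb Hu Hw Hv Hm. assert (1 <= (beta + 1) ^ 2) by nra.
  split; [apply square_box; assumption |]. split; [| lra].
  rewrite <- RPow_abs. generalize (Rabs_pos v). nra.
Qed.

(** The only nonlinear substitution is (u + w)^2. Its increment is 2 u (w - w') + (w + w') (w - w'),
    and the last product joins the error through the bound B1 on D1 f. The constant is uniform in
    |u| <= beta, hence later in x. *)
Lemma composed_estimates f beta : of_class_C 2 f -> 0 <= beta -> exists L, 0 <= L /\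
  forall u w v mu w' v' mu', Rabs u <= beta -> Rabs w <= 1 -> Rabs v <= 1 -> Rabs w' <= 1 -> Rabs v' <= 1 ->
    Rabs mu <= 1 -> Rabs mu' <= 1 ->
  let D := Rabs (w - w') + Rabs (v ^ 2 - v' ^ 2) + Rabs (mu - mu') in
  Rabs (f ((u + w) ^ 2) (v ^ 2) mu - f ((u + w') ^ 2) (v' ^ 2) mu') <= L * D /\
  Rabs (f ((u + w) ^ 2) (v ^ 2) mu - f ((u + w') ^ 2) (v' ^ 2) mu'
        - (2 * u * D1 f (u ^ 2) 0 0 * (w - w') + D2 f (u ^ 2) 0 0 * (v ^ 2 - v' ^ 2) + Dmu f (u ^ 2) 0 0 * (mu - mu')))
  <= L * (Rabs w + v ^ 2 + Rabs mu + (Rabs w' + v' ^ 2 + Rabs mu')) * D.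
Proof.
  intros Hf Hb.
  destruct (taylor_on_box f ((beta + 1) ^ 2) Hf) as [L1 [HL1 T]].
  destruct (lipschitz_on_box f ((beta + 1) ^ 2) (of_class_C_S Hf)) as [L2 [HL2 Lp]].
  destruct (bounded_on_box (D1 f) ((beta + 1) ^ 2)) as [B1 [HB1 Bd]]; [apply Hf |].
  set (c := 2 * beta + 2). assert (Hc : 2 <= c) by (unfold c; lra).
  assert (P1 : 0 <= L1 * c * c) by nra.
  assert (P2 : 0 <= L2 * c) by (apply Rmult_le_pos; lra).
  exists (L1 * c * c + L2 * c + B1). split; [lra |].
  intros u w v mu w' v' mu' Hu Hw Hv Hw' Hv' Hm Hm' D.
  assert (R0 : Rabs 0 <= 1) by (rewrite Rabs_R0; lra).
  assert (I1 := box_in u w v mu beta Hb Hu Hw Hv Hm). assert (I2 := box_in u w' v' mu' beta Hb Hu Hw' Hv' Hm').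
  assert (I0 := box_in u 0 0 0 beta Hb Hu R0 R0 R0).
  replace ((u + 0) ^ 2) with (u ^ 2) in I0 by ring. replace (0 ^ 2) with 0 in I0 by ring.
  assert (PD : 0 <= D) by (unfold D; generalize (Rabs_pos (w - w')) (Rabs_pos (v ^ 2 - v' ^ 2)) (Rabs_pos (mu - mu')); lra).
  assert (Gen : forall w1 v1 m1 w2 v2 m2, Rabs w1 <= 1 -> Rabs w2 <= 1 ->
     dist3 ((u + w1) ^ 2) v1 m1 ((u + w2) ^ 2) v2 m2 <= c * (Rabs (w1 - w2) + Rabs (v1 - v2) + Rabs (m1 - m2))).
  { intros w1 v1 q1 w2 v2 q2 H1 H2. unfold dist3. assert (E := square_diff_le u w1 w2 beta Hu H1 H2). fold c in E.
    generalize (Rabs_pos (v1 - v2)) (Rabs_pos (q1 - q2)). nra. }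
  assert (G1 := Gen w (v ^ 2) mu w' (v' ^ 2) mu' Hw Hw').
  assert (G2 := Gen w (v ^ 2) mu 0 0 0 Hw R0). assert (G3 := Gen w' (v' ^ 2) mu' 0 0 0 Hw' R0).
  replace ((u + 0) ^ 2) with (u ^ 2) in G2, G3 by ring. rewrite !Rminus_0_r in G2, G3.
  rewrite (Rabs_pos_eq (v ^ 2)) in G2 by apply pow2_ge_0. rewrite (Rabs_pos_eq (v' ^ 2)) in G3 by apply pow2_ge_0.
  set (S := Rabs w + v ^ 2 + Rabs mu + (Rabs w' + v' ^ 2 + Rabs mu')).
  assert (PS : 0 <= S) by (unfold S; generalize (Rabs_pos w) (Rabs_pos w') (Rabs_pos mu) (Rabs_pos mu') (pow2_ge_0 v) (pow2_ge_0 v'); lra).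
  split.
  - eapply Rle_trans; [apply Lp; assumption |].
    apply Rle_trans with (L2 * (c * D)); [apply Rmult_le_compat_l; assumption |].
    replace (L2 * (c * D)) with (L2 * c * D) by ring. apply Rmult_le_compat_r; lra.
  - assert (E := T _ _ _ _ _ _ _ _ _ I1 I2 I0).
    set (f1 := D1 f (u ^ 2) 0 0) in *.
    assert (Bf1 : Rabs f1 <= B1) by (apply Bd; apply I0).
    match type of E with Rabs ?e <= _ => set (T0 := e) in * end.
    match goal with |- Rabs ?e <= _ => replace e with (T0 + f1 * ((w + w') * (w - w'))) by (unfold T0; ring) end.
    assert (E2 : Rabs (f1 * ((w + w') * (w - w'))) <= B1 * (S * D)).
    { apply Rabs_mult_le; [exact Bf1 |]. apply Rabs_mult_le.
      - eapply Rle_trans; [apply Rabs_triang |]. unfold S. generalize (Rabs_pos mu) (Rabs_pos mu') (pow2_ge_0 v) (pow2_ge_0 v'); lra.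
      - unfold D. generalize (Rabs_pos (v ^ 2 - v' ^ 2)) (Rabs_pos (mu - mu')); lra. }
    assert (E1 : Rabs T0 <= L1 * c * c * (S * D)).
    { eapply Rle_trans; [exact E |].
      apply Rle_trans with (L1 * (c * S) * (c * D)); [| right; ring].
      apply Rmult_le_compat; [| | | exact G1].
      - apply Rmult_le_pos; [exact HL1 |]. repeat apply Rplus_le_le_0_compat; apply Rabs_pos.
      - repeat apply Rplus_le_le_0_compat; apply Rabs_pos.
      - apply Rmult_le_compat_l; [exact HL1 |]. unfold S. lra. }
    eapply Rle_trans; [apply (Rabs_plus_le _ _ _ _ E1 E2) |].
    assert (0 <= L2 * c * (S * D)) by (apply Rmult_le_pos; [assumption | apply Rmult_le_pos; assumption]).
    lra.
Qed.

(** The derivative of u -> D1 F (u^2) 0 0 u. *)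
Definition qU (F : R -> R -> R -> R) (u : R) : R := 2 * D1 (D1 F) (u ^ 2) 0 0 * u ^ 2 + D1 F (u ^ 2) 0 0.

(** What remains of the nonlinearity at u + w after the equation of u and its linearisation are
    subtracted. *)
Definition remU (F : R -> R -> R -> R) (u w v mu : R) : R :=
  D1 F ((u + w) ^ 2) (v ^ 2) mu * (u + w) - D1 F (u ^ 2) 0 0 * u - qU F u * w.

Definition remV (F : R -> R -> R -> R) (u w v mu : R) : R :=
  D2 F ((u + w) ^ 2) (v ^ 2) mu - D2 F (u ^ 2) 0 0.

Lemma remU_estimate F beta : of_class_C 3 F -> 0 <= beta -> exists L, 0 <= L /\
  forall u w v w' v' mu, Rabs u <= beta -> Rabs w <= 1 -> Rabs v <= 1 -> Rabs w' <= 1 -> Rabs v' <= 1 -> Rabs mu <= 1 ->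
  Rabs (remU F u w v mu - remU F u w' v' mu - D1 (D2 F) (u ^ 2) 0 0 * u * (v ^ 2 - v' ^ 2))
  <= L * (Rabs w + v ^ 2 + Rabs mu + (Rabs w' + v' ^ 2 + Rabs mu)) * (Rabs (w - w') + Rabs (v ^ 2 - v' ^ 2)).
Proof.
  intros HF Hb. assert (HA : of_class_C 2 (D1 F)) by apply HF.
  destruct (composed_estimates (D1 F) beta HA Hb) as [L [HL H]].
  exists ((beta + 2) * L). split; [apply Rmult_le_pos; lra |].
  intros u w v w' v' mu Hu Hw Hv Hw' Hv' Hm.
  assert (R0 : Rabs 0 <= 1) by (rewrite Rabs_R0; lra).
  destruct (H u w v mu w' v' mu Hu Hw Hv Hw' Hv' Hm Hm) as [E1 E2].
  destruct (H u w' v' mu 0 0 0 Hu Hw' Hv' R0 R0 Hm R0) as [E3 _].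
  replace ((u + 0) ^ 2) with (u ^ 2) in E3 by ring. replace (0 ^ 2) with 0 in E3 by ring.
  rewrite !Rminus_0_r in E3. rewrite (Rabs_pos_eq (v' ^ 2)) in E3 by apply pow2_ge_0.
  rewrite Rminus_diag, Rabs_R0, Rplus_0_r in E1, E2. rewrite Rmult_0_r, Rplus_0_r in E2.
  rewrite (D1_D2_comm F _ _ _ (of_class_C_S HF)).
  set (S := Rabs w + v ^ 2 + Rabs mu + (Rabs w' + v' ^ 2 + Rabs mu)) in *.
  set (D := Rabs (w - w') + Rabs (v ^ 2 - v' ^ 2)) in *.
  assert (HSw : Rabs w <= S) by (unfold S; generalize (Rabs_pos w') (Rabs_pos mu) (pow2_ge_0 v) (pow2_ge_0 v'); lra).
  assert (HSw' : Rabs w' + v' ^ 2 + Rabs mu <= S) by (unfold S; generalize (Rabs_pos w) (Rabs_pos mu) (pow2_ge_0 v); lra).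
  assert (HDw : Rabs (w - w') <= D) by (unfold D; generalize (Rabs_pos (v ^ 2 - v' ^ 2)); lra).
  set (a := D1 F ((u + w) ^ 2) (v ^ 2) mu) in *. set (a' := D1 F ((u + w') ^ 2) (v' ^ 2) mu) in *.
  set (a0 := D1 F (u ^ 2) 0 0) in *.
  match type of E2 with Rabs ?e <= _ => set (T0 := e) in * end.
  assert (E3' : Rabs (a' - a0) <= L * S) by nra.
  (* [qU] removes both terms linear in w; what is left is u times the Taylor error and two products
     of increments of D1 F with w and with w - w'. *)
  match goal with |- Rabs ?e <= _ => replace e with (u * T0 + (a - a') * w + (a' - a0) * (w - w'))
     by (unfold T0, remU, qU; fold a a' a0; ring) end.
  eapply Rle_trans; [apply Rabs_plus_le; [apply Rabs_plus_le |] |].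
  - exact (Rabs_mult_le _ _ _ _ Hu E2).
  - exact (Rabs_mult_le _ _ _ _ E1 HSw).
  - exact (Rabs_mult_le _ _ _ _ E3' HDw).
  - right. ring.
Qed.

Lemma remV_estimate F beta : of_class_C 3 F -> 0 <= beta -> exists L, 0 <= L /\
  forall u w v mu w' v' mu', Rabs u <= beta -> Rabs w <= 1 -> Rabs v <= 1 -> Rabs w' <= 1 -> Rabs v' <= 1 ->
    Rabs mu <= 1 -> Rabs mu' <= 1 ->
  Rabs (remV F u w v mu - remV F u w' v' mu'
        - (2 * u * D1 (D2 F) (u ^ 2) 0 0 * (w - w') + D2 (D2 F) (u ^ 2) 0 0 * (v ^ 2 - v' ^ 2)
           + Dmu (D2 F) (u ^ 2) 0 0 * (mu - mu')))
  <= L * (Rabs w + v ^ 2 + Rabs mu + (Rabs w' + v' ^ 2 + Rabs mu'))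
       * (Rabs (w - w') + Rabs (v ^ 2 - v' ^ 2) + Rabs (mu - mu')).
Proof.
  intros HF Hb. assert (HA : of_class_C 2 (D2 F)) by apply HF.
  destruct (composed_estimates (D2 F) beta HA Hb) as [L [HL H]].
  exists L. split; [exact HL |]. intros u w v mu w' v' mu' Hu Hw Hv Hw' Hv' Hm Hm'.
  destruct (H u w v mu w' v' mu' Hu Hw Hv Hw' Hv' Hm Hm') as [_ E].
  match goal with |- Rabs ?e <= _ => match type of E with Rabs ?e' <= _ => replace e with e' by (unfold remV; ring) end end.
  exact E.
Qed.

(** * The two linearisations at the fundamental wave *)

(** F z 0 is constant in mu by the mean value theorem. This is why U0 persists for every mu and why
    the nonlinear part of the U equation vanishes at W = V = 0. *)
Lemma mu_independent F z mu : nonlinearity_assumption F -> D1 F z 0 mu = D1 F z 0 0.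
Proof.
  intros [HF [_ Hmu]]. apply Derive_ext. intros t.
  destruct HF as [_ [HF _]].
  destruct (mvt_between (fun m => F t 0 m) mu 0) as [c [_ E]]; [intros m; exact (proj2 (proj2 (HF t 0 m))) |].
  unfold Dmu in Hmu. rewrite Hmu in E. lra.
Qed.

Lemma twice_solves m h f : twice_derivable f -> (forall x, Derive_n f 2 x = m x * f x - h x) -> solves m h f.
Proof.
  intros Ht H x. destruct (Ht x) as [H1 H2]. split; [exact H1 |].
  rewrite <- H. apply Derive_correct. exact H2.
Qed.

Lemma solves_twice m h f : solves m h f -> twice_derivable f /\ forall x, Derive_n f 2 x = m x * f x - h x.
Proof.
  intros H. split.
  - intros x. split; [exact (proj1 (H x)) |]. exists (m x * f x - h x). exact (proj2 (H x)).
  - intros x. apply is_derive_unique. exact (proj2 (H x)).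
Qed.

Lemma vanishing_bounded f : (forall x, continuous f x) -> vanishes_at_infinity f -> exists B, 0 <= B /\ bounded_by B f.
Proof.
  intros Cf [H1 H2]. destruct (tends_small f 1 H1 Rlt_0_1) as [X [HX A1]]. destruct (tends_small_m f 1 H2 Rlt_0_1) as [Y [HY A2]].
  destruct (bounded_on_segment f (- Y) X Cf) as [B [HB A3]].
  exists (B + 1). split; [lra |]. intros x.
  destruct (Rle_or_lt X x); [specialize (A1 x); lra |]. destruct (Rle_or_lt x (- Y)); [specialize (A2 x); lra |].
  specialize (A3 x). lra.
Qed.

Lemma far_bound (psi U : R -> R) (c : R) : 0 < c -> continuous psi 0 -> psi 0 = 0 -> vanishes_at_infinity U ->
  exists b X, 0 < b /\ 0 <= X /\ forall x, X <= Rabs x -> b ^ 2 <= c - psi (U x).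
Proof.
  intros Hc Cp P0 [H1 H2].
  destruct (proj1 (filterlim_locally _ _) Cp (mkposreal (c / 2) ltac:(lra))) as [d Hd].
  assert (Pd := cond_pos d).
  destruct (tends_small U (d / 2) H1 ltac:(lra)) as [X [HX A1]]. destruct (tends_small_m U (d / 2) H2 ltac:(lra)) as [Y [HY A2]].
  exists (sqrt (c / 2)), (X + Y). split; [apply sqrt_lt_R0; lra |]. split; [lra |]. intros x Hx.
  rewrite pow2_sqrt by lra.
  assert (Hu : Rabs (U x) <= d / 2).
  { unfold Rabs in Hx. destruct (Rcase_abs x); [apply A2 | apply A1]; lra. }
  specialize (Hd (U x)). change (Rabs (U x - 0) < d -> Rabs (psi (U x) - psi 0) < c / 2) in Hd.
  rewrite P0, !Rminus_0_r in Hd. specialize (Hd ltac:(lra)). apply Rabs_lt_between in Hd. lra.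
Qed.

(** The reflected k is again a bounded solution, hence equal to c k, and reflecting twice gives c^2
    = 1. *)
Lemma critical_parity m k : critical m k -> (forall x, m (- x) = m x) ->
  exists sg, (sg = 1 \/ sg = -1) /\ forall x, k (- x) = sg * k x.
Proof.
  intros Hc Hm. assert (Hs := crit_sol Hc).
  assert (Hr : solves m (fun _ => 0) (fun x => k (- x))).
  { eapply solves_ext; [exact Hm | reflexivity | reflexivity | exact (solves_reflect Hs)]. }
  destruct (crit_bounded Hc) as [M HM]. destruct (crit_far Hc) as [b [X [Hb [HX Hf]]]]. destruct (crit_kb Hc) as [K HK].
  destruct (bounded_homogeneous_multiple m (fun x => k (- x)) k b X M K Hb) as [c Ec]; try assumption.
  - intros x Hx. apply Hf. rewrite Rabs_pos_eq; lra.
  - apply (crit_nontrivial Hc).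
  - intros x _. apply HK.
  - intros x _. apply HK.
  - exists c. split; [| exact Ec].
    destruct (crit_nontrivial Hc) as [x0 Hx0].
    assert (E : k x0 = c * (c * k x0)).
    { rewrite <- (Ec x0). assert (E' := Ec (- x0)). rewrite Ropp_involutive in E'. exact E'. }
    assert (E2 : (c - 1) * (c + 1) = 0) by nra.
    destruct (Rmult_integral _ _ E2); [left | right]; lra.
Qed.

Lemma wronskian_const m k p : solves m (fun _ => 0) k -> solves m (fun _ => 0) p -> forall x,
  k x * Derive p x - Derive k x * p x = k 0 * Derive p 0 - Derive k 0 * p 0.
Proof.
  intros Hk Hp x.
  set (w := fun x => k x * Derive p x - Derive k x * p x).
  assert (Dw : forall x, is_derive w x 0).
  { intros y. assert (A1 := solves_der Hk y). assert (A2 := solves_der2 Hk y).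
    assert (A3 := solves_der Hp y). assert (A4 := solves_der2 Hp y). unfold w. der. ring. }
  assert (E := lipschitz_of_derive w (fun _ => 0) 0 0 x Dw ltac:(intros; cbv beta; rewrite Rabs_R0; lra)).
  rewrite Rmult_0_l in E. apply Rminus_diag_uniq, Rabs_eq_0, Rle_antisym; [exact E | apply Rabs_pos].
Qed.

Lemma even_integrand_zero m k h H : critical m k -> cont h -> bounded_by H h ->
  (forall x, k (- x) = - k x) -> (forall x, h (- x) = h x) -> int_line (fun x => k x * h x) = 0.
Proof.
  intros Hc Ch HH Hk He. apply int_line_odd; [exact (critical_product_expo _ _ _ _ Hc Ch HH) |].
  intros x. rewrite Hk, He. ring.
Qed.

(** With k = phi12 the second solution must be - phi11 for the Wronskian to be 1; this accounts for
    the signs in [U2]. *)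
Lemma U2_green F U0 V1 phi11 phi12 : cont phi11 -> cont (fun y => D1 (D2 F) (U0 y ^ 2) 0 0 * U0 y * V1 y ^ 2) ->
  U2 F U0 V1 phi11 phi12
  = green phi12 (fun x => - phi11 x) (fun y => D1 (D2 F) (U0 y ^ 2) 0 0 * U0 y * V1 y ^ 2).
Proof.
  intros Cp Cg. apply functional_extensionality. intros x. unfold U2, green, tail.
  set (g := fun y => D1 (D2 F) (U0 y ^ 2) 0 0 * U0 y * V1 y ^ 2).
  assert (E : RInt (fun y => - phi11 y * g y) 0 x = - RInt (fun y => phi11 y * g y) 0 x).
  { transitivity (RInt (fun y => opp (phi11 y * g y)) 0 x).
    - apply RInt_ext. intros y _. unfold opp; simpl. ring.
    - apply (RInt_opp (V := R_CompleteNormedModule) (fun y => phi11 y * g y)).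
      apply ex_RInt_cont. intros y. apply (continuous_mult phi11 g); [apply Cp | apply Cg]. }
  change (RInt (fun y => - phi11 y * (D1 (D2 F) (U0 y ^ 2) 0 0 * U0 y * V1 y ^ 2)) 0 x) with (RInt (fun y => - phi11 y * g y) 0 x).
  rewrite E. unfold g. ring.
Qed.

Record problem_for (F : R -> R -> R -> R) (omega s : R) (U0 V1 phi11 phi12 : R -> R) (P : problem) : Prop := {
  pf_m1 : m1 P = fun x => omega - qU F (U0 x);
  pf_m2 : m2 P = fun x => s - D2 F (U0 x ^ 2) 0 0;
  pf_k1 : k1 P = phi12;
  pf_k2 : k2 P = V1;
  pf_W2 : W2 P = U2 F U0 V1 phi11 phi12;
  pf_NN : NN P = fun x => remU F (U0 x);
  pf_GG : GG P = fun x => remV F (U0 x);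
  pf_a2 : a2 P = a2bar F U0 V1;
  pf_b2 : b2 P = b2bar F U0 V1 phi11 phi12
}.
Arguments pf_m1 {F omega s U0 V1 phi11 phi12 P} _.
Arguments pf_m2 {F omega s U0 V1 phi11 phi12 P} _.
Arguments pf_k1 {F omega s U0 V1 phi11 phi12 P} _.
Arguments pf_k2 {F omega s U0 V1 phi11 phi12 P} _.
Arguments pf_W2 {F omega s U0 V1 phi11 phi12 P} _.
Arguments pf_NN {F omega s U0 V1 phi11 phi12 P} _.
Arguments pf_GG {F omega s U0 V1 phi11 phi12 P} _.
Arguments pf_a2 {F omega s U0 V1 phi11 phi12 P} _.
Arguments pf_b2 {F omega s U0 V1 phi11 phi12 P} _.

Lemma fundamental_solves {F omega U0} : fundamental_assumption F omega U0 ->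
  solves (fun _ => omega) (fun x => D1 F (U0 x ^ 2) 0 0 * U0 x) U0.
Proof.
  intros [Ht [He _]]. apply twice_solves; [exact Ht |]. intros x. specialize (He x). lra.
Qed.

(** Translation invariance: differentiating the equation of U0 yields a kernel element of its
    linearisation. *)
Lemma fundamental_derivative_solves F omega U0 : of_class_C 3 F -> fundamental_assumption F omega U0 ->
  solves (fun x => omega - qU F (U0 x)) (fun _ => 0) (Derive U0).
Proof.
  intros HF HU. assert (S := fundamental_solves HU).
  apply solves_intro with (fun x => omega * U0 x - D1 F (U0 x ^ 2) 0 0 * U0 x).
  - exact (solves_der2 S).
  - intros x. assert (A := solves_der S x).
    assert (Asq : is_derive (fun x => U0 x ^ 2) x (2 * U0 x * Derive U0 x)).
    { apply is_derive_ext with (fun x => U0 x * U0 x); [intros; simpl; ring |]. der. ring. }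
    assert (AF : is_derive (fun z => D1 F z 0 0) (U0 x ^ 2) (D1 (D1 F) (U0 x ^ 2) 0 0)).
    { apply Derive_correct. destruct HF as [_ [_ [[_ [H _]] _]]]. exact (proj1 (H (U0 x ^ 2) 0 0)). }
    assert (AC := der_comp _ _ x _ _ AF Asq).
    der. unfold qU. ring.
Qed.

Lemma sqr_cont_comp f U : jointly_continuous f -> cont U -> cont (fun x => f (U x ^ 2) 0 0).
Proof. intros Hf HU. apply jc_comp; [exact Hf | apply cont_sqr, HU | apply cont_const | apply cont_const]. Qed.

Lemma fundamental_derivative_bounded F omega U0 : of_class_C 3 F -> fundamental_assumption F omega U0 ->
  exists B, bounded_by B (Derive U0).
Proof.
  intros HF HU. assert (SU := fundamental_solves HU).
  destruct HU as [_ [_ [HUv _]]].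
  destruct (vanishing_bounded U0 (solves_cont SU) HUv) as [beta [Hbeta BU]].
  assert (J1 : jointly_continuous (D1 F)) by apply HF.
  destruct (bounded_on_box (D1 F) (beta ^ 2) J1) as [B1 [HB1 Bd1]].
  exists (2 * beta + (Rabs omega * beta + B1 * beta)). intros x.
  apply (derive_bound U0 (Derive U0) (fun x => omega * U0 x - D1 F (U0 x ^ 2) 0 0 * U0 x)).
  - intros y _. apply (solves_der SU).
  - intros y _. apply (solves_der2 SU).
  - intros y _. apply BU.
  - intros y _. apply Rabs_minus_le; apply Rabs_mult_le; [apply Rle_refl | apply BU | | apply BU].
    apply Bd1; [| rewrite Rabs_R0; apply pow2_ge_0 | rewrite Rabs_R0; apply pow2_ge_0].
    rewrite <- RPow_abs. apply pow_incr. split; [apply Rabs_pos | apply BU].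
Qed.

(** Initial values identify phi12 with a multiple of U0', so it is bounded and odd; V1 has a parity
    as well. The source of [U2] is therefore even, hence orthogonal to phi12, and [U2] is
    bounded. *)
Lemma exists_problem F omega s U0 V1 phi11 phi12 :
  0 < omega -> 0 < s -> nonlinearity_assumption F -> fundamental_assumption F omega U0 ->
  kernel_assumption F s U0 V1 -> fundamental_pair F omega U0 phi11 phi12 ->
  exists P sg, problem_for F omega s U0 V1 phi11 phi12 P /\ symmetric P sg.
Proof.
  intros Hom Hs HFall HU HV Hphi. assert (HFall' := HFall). destruct HFall' as [HF [HF0 _]].
  assert (SU := fundamental_solves HU). assert (CU := solves_cont SU : cont U0).
  assert (HU' := HU). destruct HU' as [_ [_ [HUv [HU0 [HUp [HUe HUd]]]]]].
  destruct (vanishing_bounded U0 CU HUv) as [beta [Hbeta BU]].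
  assert (C2F := of_class_C_S HF). assert (HA : of_class_C 2 (D1 F)) by apply HF. assert (HB : of_class_C 2 (D2 F)) by apply HF.
  assert (J1 : jointly_continuous (D1 F)) by apply HA. assert (J2 : jointly_continuous (D2 F)) by apply HB.
  assert (J11 : jointly_continuous (D1 (D1 F))) by apply HA.
  assert (J21 : jointly_continuous (D1 (D2 F))) by apply HB. assert (J22 : jointly_continuous (D2 (D2 F))) by apply HB.
  assert (J2m : jointly_continuous (Dmu (D2 F))) by apply HB.
  assert (Bcomp : forall f, jointly_continuous f -> exists B, 0 <= B /\ bounded_by B (fun x => f (U0 x ^ 2) 0 0)).
  { intros f Jf. destruct (bounded_on_box f (beta ^ 2) Jf) as [B [HB' Bb]]. exists B. split; [exact HB' |].
    intros x. apply Bb; [| rewrite Rabs_R0; apply pow2_ge_0 | rewrite Rabs_R0; apply pow2_ge_0].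
    rewrite <- RPow_abs. apply pow_incr. split; [apply Rabs_pos | apply BU]. }
  destruct (Bcomp _ J1) as [B1 [HB1 Bd1]]. destruct (Bcomp _ J2) as [B2 [HB2 Bd2]]. destruct (Bcomp _ J11) as [B11 [HB11 Bd11]].
  destruct (Bcomp _ J21) as [B21 [HB21 Bd21]]. destruct (Bcomp _ J22) as [B22 [HB22 Bd22]]. destruct (Bcomp _ J2m) as [B2m [HB2m Bd2m]].
  assert (BU2 : bounded_by (beta ^ 2) (fun x => U0 x ^ 2)).
  { intros x. rewrite <- RPow_abs. apply pow_incr. split; [apply Rabs_pos | apply BU]. }
  set (mU := fun x => omega - qU F (U0 x)). set (mV := fun x => s - D2 F (U0 x ^ 2) 0 0).
  assert (CqU : forall U, cont U -> cont (fun x => qU F (U x))).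
  { intros U HUc. apply cont_plus; [| apply sqr_cont_comp; assumption].
    apply cont_mult; [apply cont_mult; [apply cont_const | apply sqr_cont_comp; assumption] | apply cont_sqr, HUc]. }
  assert (CmU : cont mU) by (apply cont_minus; [apply cont_const | apply CqU, CU]).
  assert (CmV : cont mV) by (apply cont_minus; [apply cont_const | apply sqr_cont_comp; assumption]).
  assert (BmU : bounded_by (omega + (2 * B11 * beta ^ 2 + B1)) mU).
  { intros x. apply Rabs_minus_le; [rewrite Rabs_pos_eq; lra |].
    apply Rabs_plus_le; [| apply Bd1]. apply Rabs_mult_le; [| apply BU2].
    apply Rabs_mult_le; [rewrite Rabs_pos_eq; lra | apply Bd11]. }
  assert (BmV : bounded_by (s + B2) mV).
  { intros x. apply Rabs_minus_le; [rewrite Rabs_pos_eq; lra | apply Bd2]. }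
  assert (Cid : cont (fun x => x)) by (intros x; apply continuous_id).
  assert (FarU : exists b X, 0 < b /\ 0 <= X /\ forall x, X <= Rabs x -> b ^ 2 <= mU x).
  { apply (far_bound (qU F) U0 omega Hom); [exact (CqU (fun x => x) Cid 0) | | exact HUv].
    unfold qU. replace (0 ^ 2) with 0 by ring. rewrite (proj1 (proj2 (HF0 0))). ring. }
  assert (FarV : exists b X, 0 < b /\ 0 <= X /\ forall x, X <= Rabs x -> b ^ 2 <= mV x).
  { apply (far_bound (fun u => D2 F (u ^ 2) 0 0) U0 s Hs); [exact (sqr_cont_comp (D2 F) (fun x => x) J2 Cid 0) | | exact HUv].
    replace (0 ^ 2) with 0 by ring. exact (proj2 (proj2 (HF0 0))). }
  destruct Hphi as [[T11 E11] [I11 [I11' [[T12 E12] [I12 I12']]]]].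
  assert (S11 : solves mU (fun _ => 0) phi11).
  { apply twice_solves; [exact T11 |]. intros x. specialize (E11 x). unfold mU, qU. lra. }
  assert (S12 : solves mU (fun _ => 0) phi12).
  { apply twice_solves; [exact T12 |]. intros x. specialize (E12 x). unfold mU, qU. lra. }
  assert (SD : solves mU (fun _ => 0) (Derive U0)) by exact (fundamental_derivative_solves F omega U0 HF HU).
  (* kap is nonzero, since otherwise U0' would vanish identically, against U0'(1) < 0. *)
  set (kap := Derive (Derive U0) 0).
  assert (EDk : forall x, Derive U0 x = kap * phi12 x).
  { intros x. assert (Z : 1 * Derive U0 x + (- kap) * phi12 x = 0).
    { apply (ode_zero mU (fun x => 1 * Derive U0 x + (- kap) * phi12 x) _ 0) with (2 := BmU).
      - eapply solves_ext; [reflexivity | | reflexivity | exact (solves_lin 1 (- kap) SD S12)]. intros y; simpl; ring.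
      - rewrite HU0, I12. ring.
      - rewrite Derive_lin; [rewrite I12'; unfold kap; ring | apply SD | apply S12]. }
    lra. }
  assert (D1neg := HUd 1 Rlt_0_1).
  assert (Hkap : kap <> 0) by (intros E; rewrite EDk, E in D1neg; lra).
  destruct (fundamental_derivative_bounded F omega U0 HF HU) as [BD HBD].
  assert (Ephi : forall x, phi12 x = / kap * Derive U0 x) by (intros x; rewrite EDk; field; exact Hkap).
  assert (Crit1 : critical mU phi12).
  { constructor; [exact CmU | eexists; exact BmU | exact FarU | exact S12 | |].
    - exists (Rabs (/ kap) * BD). intros x. rewrite Ephi. apply Rabs_mult_le; [apply Rle_refl | apply HBD].
    - exists 1. intros E. rewrite EDk, E in D1neg. lra. }
  assert (Odd12 : forall x, phi12 (- x) = - phi12 x).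
  { intros x. rewrite !Ephi.
    assert (E := Derive_reflect U0 x ltac:(apply SU)).
    rewrite (Derive_ext _ U0) in E by (intros; apply HUe). rewrite E. ring. }
  destruct HV as [TV [EV [NV [BV VV]]]].
  assert (SV : solves mV (fun _ => 0) V1).
  { apply twice_solves; [exact TV |]. intros x. specialize (EV x). unfold mV. lra. }
  assert (CV : cont V1) by exact (solves_cont SV).
  assert (Crit2 : critical mV V1) by (constructor; [exact CmV | eexists; exact BmV | exact FarV | exact SV | exact BV | exact NV]).
  assert (EmV : forall x, mV (- x) = mV x) by (intros x; unfold mV; rewrite HUe; reflexivity).
  destruct (critical_parity mV V1 Crit2 EmV) as [sg [Hsg Psg]].
  assert (V1sq : forall x, V1 (- x) ^ 2 = V1 x ^ 2).
  { intros x. rewrite Psg. destruct Hsg as [-> | ->]; ring. }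
  destruct BV as [K HK].
  assert (BV2 : bounded_by (K ^ 2) (fun x => V1 x ^ 2)).
  { intros x. rewrite <- RPow_abs. apply pow_incr. split; [apply Rabs_pos | apply HK]. }
  set (g := fun y => D1 (D2 F) (U0 y ^ 2) 0 0 * U0 y * V1 y ^ 2).
  assert (Cgam : cont (fun x => D1 (D2 F) (U0 x ^ 2) 0 0 * U0 x)) by (apply cont_mult; [apply sqr_cont_comp |]; assumption).
  assert (Cg : cont g) by (apply cont_mult; [exact Cgam | apply cont_sqr, CV]).
  assert (Bgam : bounded_by (B21 * beta) (fun x => D1 (D2 F) (U0 x ^ 2) 0 0 * U0 x)) by (intros x; apply Rabs_mult_le; [apply Bd21 | apply BU]).
  assert (Bg : bounded_by (B21 * beta * K ^ 2) g) by (intros x; apply Rabs_mult_le; [apply Bgam | apply BV2]).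
  assert (EU2 : U2 F U0 V1 phi11 phi12 = green phi12 (fun x => - phi11 x) g) by exact (U2_green F U0 V1 phi11 phi12 (solves_cont S11) Cg).
  assert (S11' : solves mU (fun _ => 0) (fun x => - phi11 x)).
  { eapply solves_ext; [reflexivity | | | exact (solves_scal (-1) S11)]; intros x; simpl; ring. }
  assert (D11' : Derive (fun x => - phi11 x) 0 = 0) by (rewrite Derive_opp, I11'; ring).
  assert (Dich : dichotomy mU phi12 (fun x => - phi11 x)).
  { constructor; [exact S11' |]. intros x. rewrite (wronskian_const mU phi12 (fun x => - phi11 x) S12 S11' x).
    rewrite I12, I12', I11. ring. }
  destruct (green_bound _ _ _ Crit1 Dich) as [CG [HCG GB]].
  assert (BU2' : bounded_by (CG * (B21 * beta * K ^ 2)) (U2 F U0 V1 phi11 phi12)).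
  { rewrite EU2. refine (GB g _ Cg Bg _). apply (even_integrand_zero mU phi12 g _ Crit1 Cg Bg Odd12).
    intros x. unfold g. rewrite HUe, V1sq. reflexivity. }
  destruct (green_level mU phi12 (fun x => - phi11 x) g _ Crit1 Dich ltac:(rewrite I12, D11'; ring) Cg Bg) as [SW LW].
  rewrite <- EU2 in SW, LW. assert (CW2 : cont (U2 F U0 V1 phi11 phi12)) by exact (solves_cont SW).
  destruct (remU_estimate F beta HF Hbeta) as [LU [HLU EstU]]. destruct (remV_estimate F beta HF Hbeta) as [LV [HLV EstV]].
  set (BW := CG * (B21 * beta * K ^ 2)) in *. assert (HBW := bounded_by_pos BU2').
  set (L := B21 * beta + 2 * beta * B21 + B22 + B2m + BW + LU + LV).
  assert (Pbb : 0 <= B21 * beta) by nra.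
  assert (Cal : cont (fun x => 2 * U0 x * D1 (D2 F) (U0 x ^ 2) 0 0)) by (apply cont_mult; [apply cont_mult; [apply cont_const | exact CU] | apply sqr_cont_comp; assumption]).
  assert (Cbe : cont (fun x => D2 (D2 F) (U0 x ^ 2) 0 0)) by (apply sqr_cont_comp; assumption).
  assert (Cka : cont (fun x => Dmu (D2 F) (U0 x ^ 2) 0 0)) by (apply sqr_cont_comp; assumption).
  assert (Bal : bounded_by (2 * beta * B21) (fun x => 2 * U0 x * D1 (D2 F) (U0 x ^ 2) 0 0)).
  { intros x. apply Rabs_mult_le; [apply Rabs_mult_le; [rewrite Rabs_pos_eq; lra | apply BU] | apply Bd21]. }
  assert (Cpt : forall f W V mu, jointly_continuous f -> cont W -> cont V -> cont (fun x => f ((U0 x + W x) ^ 2) (V x ^ 2) mu)).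
  { intros f W V mu Jf CW CV'. apply (jc_comp f (fun x => (U0 x + W x) ^ 2) (fun x => V x ^ 2) (fun _ => mu)); [exact Jf | apply cont_sqr, cont_plus; assumption | apply cont_sqr, CV' | apply cont_const]. }
  assert (CNN : forall W V mu, cont W -> cont V -> cont (fun x => remU F (U0 x) (W x) (V x) mu)).
  { intros W V mu CW CV'. apply cont_minus; [apply cont_minus |].
    - apply cont_mult; [apply Cpt; assumption | apply cont_plus; assumption].
    - apply cont_mult; [apply sqr_cont_comp; assumption | assumption].
    - apply cont_mult; [apply CqU, CU | assumption]. }
  assert (CGG : forall W V mu, cont W -> cont V -> cont (fun x => remV F (U0 x) (W x) (V x) mu)).
  { intros W V mu CW CV'. apply cont_minus; [apply Cpt; assumption | apply sqr_cont_comp; assumption]. }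
  assert (ZNN : forall x mu, remU F (U0 x) 0 0 mu = 0).
  { intros x mu. unfold remU. replace ((U0 x + 0) ^ 2) with (U0 x ^ 2) by ring. replace (0 ^ 2) with 0 by ring.
    rewrite (mu_independent F _ mu HFall). ring. }
  assert (ZGG : forall x, remV F (U0 x) 0 0 0 = 0).
  { intros x. unfold remV. replace ((U0 x + 0) ^ 2) with (U0 x ^ 2) by ring. replace (0 ^ 2) with 0 by ring. ring. }
  assert (Ea2 : int_line (fun x => V1 x * (Dmu (D2 F) (U0 x ^ 2) 0 0 * V1 x)) = - a2bar F U0 V1).
  { unfold a2bar. rewrite Ropp_involutive. f_equal. apply functional_extensionality. intros x.
    rewrite (D2_Dmu_comm F _ _ _ C2F). ring. }
  assert (X : forall f H', cont f -> bounded_by H' f -> expo (fun x => V1 x * f x))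
    by (intros f H' Cf Bf; exact (critical_product_expo _ _ f H' Crit2 Cf Bf)).
  (* The factor 2 in the coefficient [al], which comes from differentiating (U0 + w)^2, is the
     factor 2 of [b2bar]. *)
  assert (Eb2 : int_line (fun x => V1 x * ((2 * U0 x * D1 (D2 F) (U0 x ^ 2) 0 0 * U2 F U0 V1 phi11 phi12 x
            + D2 (D2 F) (U0 x ^ 2) 0 0 * V1 x ^ 2) * V1 x)) = - b2bar F U0 V1 phi11 phi12).
  { unfold b2bar.
    set (W := U2 F U0 V1 phi11 phi12) in *.
    set (f1 := fun x => D1 (D2 F) (U0 x ^ 2) 0 0 * U0 x * W x * V1 x). set (f2 := fun x => D2 (D2 F) (U0 x ^ 2) 0 0 * V1 x ^ 2 * V1 x).
    replace (fun x => V1 x * ((2 * U0 x * D1 (D2 F) (U0 x ^ 2) 0 0 * W x + D2 (D2 F) (U0 x ^ 2) 0 0 * V1 x ^ 2) * V1 x))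
      with (fun x => 2 * (V1 x * f1 x) + 1 * (V1 x * f2 x)) by (apply functional_extensionality; intros x; unfold f1, f2; ring).
    replace (fun x => D1 (D2 F) (U0 x ^ 2) 0 0 * U0 x * W x * V1 x ^ 2) with (fun x => V1 x * f1 x) by (apply functional_extensionality; intros x; unfold f1; ring).
    replace (fun x => D2 (D2 F) (U0 x ^ 2) 0 0 * V1 x ^ 4) with (fun x => V1 x * f2 x) by (apply functional_extensionality; intros x; unfold f2; ring).
    rewrite (int_line_lin (fun x => V1 x * f1 x) (fun x => V1 x * f2 x)); [ring | |].
    - apply (X f1 (B21 * beta * BW * K)).
      + apply cont_mult; [apply cont_mult; assumption | assumption].
      + intros x. apply Rabs_mult_le; [apply Rabs_mult_le; [apply Bgam | apply BU2'] | apply HK].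
    - apply (X f2 (B22 * K ^ 2 * K)).
      + apply cont_mult; [apply cont_mult; [assumption | apply cont_sqr, CV] | assumption].
      + intros x. apply Rabs_mult_le; [apply Rabs_mult_le; [apply Bd22 | apply BV2] | apply HK]. }
  assert (LLU : LU <= L) by (unfold L; lra). assert (LLV : LV <= L) by (unfold L; lra).
  unshelve eexists {| m1 := mU; m2 := mV; k1 := phi12; k2 := V1; W2 := U2 F U0 V1 phi11 phi12;
    gam := fun x => D1 (D2 F) (U0 x ^ 2) 0 0 * U0 x; al := fun x => 2 * U0 x * D1 (D2 F) (U0 x ^ 2) 0 0;
    be := fun x => D2 (D2 F) (U0 x ^ 2) 0 0; ka := fun x => Dmu (D2 F) (U0 x ^ 2) 0 0;
    NN := fun x => remU F (U0 x); GG := fun x => remV F (U0 x);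
    a2 := a2bar F U0 V1; b2 := b2bar F U0 V1 phi11 phi12; L0 := L |}; try assumption.
  - intros x. eapply Rle_trans; [apply Bgam | unfold L; lra].
  - intros x. eapply Rle_trans; [apply Bal | unfold L; lra].
  - intros x. eapply Rle_trans; [apply Bd22 | unfold L; lra].
  - intros x. eapply Rle_trans; [apply Bd2m | unfold L; lra].
  - intros x. eapply Rle_trans; [apply BU2' | unfold L; lra].
  - intros x w v w' v' mu Hw Hv Hw' Hv' Hm. eapply Rle_trans; [apply EstU; auto; apply BU |].
    apply Rmult_le_compat_r; [apply Rplus_le_le_0_compat; apply Rabs_pos |].
    apply Rmult_le_compat_r; [| exact LLU].
    generalize (Rabs_pos w) (Rabs_pos w') (Rabs_pos mu) (pow2_ge_0 v) (pow2_ge_0 v'); lra.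
  - intros x w v mu w' v' mu' Hw Hv Hw' Hv' Hm Hm'. eapply Rle_trans; [apply EstV; auto; apply BU |].
    apply Rmult_le_compat_r; [repeat apply Rplus_le_le_0_compat; apply Rabs_pos |].
    apply Rmult_le_compat_r; [| exact LLV].
    generalize (Rabs_pos w) (Rabs_pos w') (Rabs_pos mu) (Rabs_pos mu') (pow2_ge_0 v) (pow2_ge_0 v'); lra.
  - exists sg. split; [constructor; reflexivity |]. constructor; simpl; try assumption.
    + intros x. unfold mU. rewrite HUe. reflexivity.
    + intros x w v mu. rewrite HUe. reflexivity.
    + intros x w v mu. rewrite HUe. reflexivity.
    + intros x w v mu. unfold remU. replace ((- v) ^ 2) with (v ^ 2) by ring. reflexivity.
    + intros x w v mu. unfold remV. replace ((- v) ^ 2) with (v ^ 2) by ring. reflexivity.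
Qed.

(** * Homoclinic solutions *)

Lemma eventually_small m d b X B : 0 < b -> solves m (fun _ => 0) d -> (forall x, X <= x -> b ^ 2 <= m x) ->
  bounded_by B d -> forall e, 0 < e -> exists N, forall x, N < x -> Rabs (d x) < e.
Proof.
  intros Hb Hs Hm HB e He.
  destruct (homogeneous_decay m d b X B Hb Hs Hm (fun x _ => HB x)) as [_ D].
  assert (B0 := bounded_by_pos HB).
  exists (X + 2 * B / (b * e)). intros x Hx.
  assert (Hbe : 0 < b * e) by nra.
  assert (Hq : 0 <= 2 * B / (b * e)) by (apply Rdiv_le_0_compat; lra).
  specialize (D X x ltac:(lra)).
  assert (G := exp_growth (b / 2) (x - X)).
  assert (Ee : exp (- (b / 2) * (x - X)) * exp (b / 2 * (x - X)) = 1).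
  { rewrite <- exp_plus. replace (- (b / 2) * (x - X) + b / 2 * (x - X)) with 0 by ring. apply exp_0. }
  assert (P := exp_pos (b / 2 * (x - X))).
  assert (Hlt : B < e * (b / 2 * (x - X))).
  { apply Rmult_lt_reg_l with (2 / (b * e)); [apply Rdiv_lt_0_compat; lra |].
    replace (2 / (b * e) * (e * (b / 2 * (x - X)))) with (x - X) by (field; lra).
    replace (2 / (b * e) * B) with (2 * B / (b * e)) by (field; lra). lra. }
  apply Rmult_lt_reg_r with (exp (b / 2 * (x - X))); [exact P |].
  apply Rle_lt_trans with (B * 1).
  - rewrite <- Ee, <- Rmult_assoc. apply Rmult_le_compat_r; [lra |].
    eapply Rle_trans; [exact D |]. apply Rmult_le_compat_r; [left; apply exp_pos | apply HB].
  - assert (e * (1 + b / 2 * (x - X)) <= e * exp (b / 2 * (x - X))) by nra. lra.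
Qed.

Lemma far_vanishing m d b X B : 0 < b -> solves m (fun _ => 0) d -> (forall x, X <= Rabs x -> b ^ 2 <= m x) ->
  0 <= X -> bounded_by B d -> vanishes_at_infinity d.
Proof.
  intros Hb Hs Hm HX HB. split; apply is_lim_spec; intros e.
  - destruct (eventually_small m d b X B Hb Hs) with (e := pos e) as [N HN]; try assumption; [| apply cond_pos |].
    + intros x Hx. apply Hm. rewrite Rabs_pos_eq; lra.
    + exists N. intros x Hx. rewrite Rminus_0_r. apply HN, Hx.
  - destruct (eventually_small _ _ b X B Hb (solves_reflect Hs)) with (e := pos e) as [N HN].
    + intros x Hx. apply Hm. rewrite Rabs_Ropp, Rabs_pos_eq; lra.
    + intros x. apply HB.
    + apply cond_pos.
    + exists (- N). intros x Hx. rewrite Rminus_0_r. specialize (HN (- x) ltac:(lra)).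
      rewrite Ropp_involutive in HN. exact HN.
Qed.

Lemma small_near_zero f c : jointly_continuous f -> f 0 0 0 = 0 -> 0 < c -> exists rho, 0 < rho <= 1 /\
  forall u v mu, Rabs u <= rho -> Rabs v <= rho -> Rabs mu <= rho -> Rabs (f (u ^ 2) (v ^ 2) mu) <= c.
Proof.
  intros Hf H0 Hc.
  destruct (proj1 (filterlim_locally _ _) (Hf ((0, 0), 0)) (mkposreal c Hc)) as [d Hd]. assert (Pd := cond_pos d).
  exists (Rmin 1 (d / 2)). assert (M1 := Rmin_l 1 (d / 2)). assert (M2 := Rmin_r 1 (d / 2)).
  split; [split; [apply Rmin_glb_lt; lra | exact M1] |].
  assert (Sq : forall z, Rabs z <= Rmin 1 (d / 2) -> Rabs (z ^ 2 - 0) < d).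
  { intros z Hz. rewrite Rminus_0_r, <- RPow_abs. assert (P := Rabs_pos z). nra. }
  intros u v mu Hu Hv Hm.
  assert (B : ball ((0, 0), 0) d ((u ^ 2, v ^ 2), mu)).
  { split; [split; apply Sq; assumption |]. change (Rabs (mu - 0) < d). rewrite Rminus_0_r. lra. }
  specialize (Hd _ B). change (Rabs (f (u ^ 2) (v ^ 2) mu - f 0 0 0) < c) in Hd. rewrite H0, Rminus_0_r in Hd. lra.
Qed.

Lemma stationary_solves F omega s mu U V : stationary_solution F omega s mu U V <->
  solves (fun _ => omega) (fun x => D1 F (U x ^ 2) (V x ^ 2) mu * U x) U /\
  solves (fun _ => s) (fun x => D2 F (U x ^ 2) (V x ^ 2) mu * V x) V.
Proof.
  split.
  - intros [TU [TV H]]. split; apply twice_solves; try assumption; intros x; destruct (H x); lra.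
  - intros [SU SV]. destruct (solves_twice _ _ _ SU) as [TU EU]. destruct (solves_twice _ _ _ SV) as [TV EV].
    split; [exact TU |]. split; [exact TV |]. intros x. rewrite EU, EV. split; ring.
Qed.

(** Far out U0 is small, so U, V and mu are all small, and U and V satisfy linear equations with
    coefficients omega - D1 F and s - D2 F, at least omega / 2 and s / 2; bounded solutions of these
    decay. *)
Lemma homoclinic_of_small F omega s U0 : 0 < omega -> 0 < s -> nonlinearity_assumption F ->
  fundamental_assumption F omega U0 -> exists rho, 0 < rho /\
  forall mu U V, stationary_solution F omega s mu U V -> bounded_by rho (fun x => U x - U0 x) -> bounded_by rho V ->
    Rabs mu <= rho -> homoclinic_solution F omega s mu U V.
Proof.
  intros Hom Hs [HF [HF0 _]] HU. assert (SU := fundamental_solves HU).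
  destruct HU as [_ [_ [HUv _]]].
  assert (J1 : jointly_continuous (D1 F)) by apply HF. assert (J2 : jointly_continuous (D2 F)) by apply HF.
  destruct (small_near_zero (D1 F) (omega / 2) J1 (proj1 (proj2 (HF0 0))) ltac:(lra)) as [r1 [Hr1 N1]].
  destruct (small_near_zero (D2 F) (s / 2) J2 (proj2 (proj2 (HF0 0))) ltac:(lra)) as [r2 [Hr2 N2]].
  set (r := Rmin r1 r2). assert (M1 : r <= r1) by apply Rmin_l. assert (M2 : r <= r2) by apply Rmin_r.
  assert (Hr : 0 < r) by (apply Rmin_glb_lt; lra).
  exists (r / 2). split; [lra |]. intros mu U V Hst BU BV Hmu. split; [exact Hst |].
  apply stationary_solves in Hst. destruct Hst as [S1 S2].
  destruct (vanishing_bounded U0 (solves_cont SU) HUv) as [beta [Hbeta BU0]].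
  destruct HUv as [V1 V2].
  destruct (tends_small U0 (r / 2) V1 ltac:(lra)) as [X [HX A1]]. destruct (tends_small_m U0 (r / 2) V2 ltac:(lra)) as [Y [HY A2]].
  assert (Far : forall x, X + Y <= Rabs x -> Rabs (U x) <= r).
  { intros x Hx. replace (U x) with ((U x - U0 x) + U0 x) by ring. replace r with (r / 2 + r / 2) by field.
    apply Rabs_plus_le; [apply BU |]. unfold Rabs in Hx. destruct (Rcase_abs x); [apply A2 | apply A1]; lra. }
  split.
  - apply (far_vanishing (fun x => omega - D1 F (U x ^ 2) (V x ^ 2) mu) U (sqrt (omega / 2)) (X + Y) (r / 2 + beta)).
    + apply sqrt_lt_R0; lra.
    + apply solves_intro with (Derive U); intros x; [apply (solves_der S1) |].
      eapply is_derive_eq; [apply (solves_der2 S1) |]. ring.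
    + intros x Hx. rewrite pow2_sqrt by lra. specialize (Far x Hx). specialize (BV x).
      assert (E := N1 (U x) (V x) mu ltac:(lra) ltac:(lra) ltac:(lra)). apply Rabs_le_between in E. lra.
    + lra.
    + intros x. replace (U x) with ((U x - U0 x) + U0 x) by ring. apply Rabs_plus_le; [apply BU | apply BU0].
  - apply (far_vanishing (fun x => s - D2 F (U x ^ 2) (V x ^ 2) mu) V (sqrt (s / 2)) (X + Y) (r / 2)).
    + apply sqrt_lt_R0; lra.
    + apply solves_intro with (Derive V); intros x; [apply (solves_der S2) |].
      eapply is_derive_eq; [apply (solves_der2 S2) |]. ring.
    + intros x Hx. rewrite pow2_sqrt by lra. specialize (Far x Hx). specialize (BV x).
      assert (E := N2 (U x) (V x) mu ltac:(lra) ltac:(lra) ltac:(lra)). apply Rabs_le_between in E. lra.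
    + lra.
    + exact BV.
Qed.

Lemma solves_shift m h d tau : solves m h d ->
  solves (fun x => m (x + tau)) (fun x => h (x + tau)) (fun x => d (x + tau)).
Proof.
  intros H.
  assert (N : forall x : R, is_derive (fun t : R => t + tau) x 1) by (intros x; der; ring).
  apply solves_intro with (fun x => Derive d (x + tau)); intros x.
  - eapply is_derive_eq; [apply (der_comp d (fun t => t + tau)); [apply (solves_der H) | apply N] | ring].
  - eapply is_derive_eq; [apply (der_comp (Derive d) (fun t => t + tau)); [apply (solves_der2 H) | apply N] | ring].
Qed.

Lemma stationary_shift F omega s mu U V tau : stationary_solution F omega s mu U V ->
  stationary_solution F omega s mu (fun x => U (x + tau)) (fun x => V (x + tau)).
Proof.
  intros H. apply stationary_solves in H. destruct H as [H1 H2]. apply stationary_solves.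
  split; [exact (solves_shift _ _ _ tau H1) | exact (solves_shift _ _ _ tau H2)].
Qed.

Lemma trivial_homoclinic F omega s U0 mu : nonlinearity_assumption F -> fundamental_assumption F omega U0 ->
  homoclinic_solution F omega s mu U0 (fun _ => 0).
Proof.
  intros HF HU. assert (SU := fundamental_solves HU). split; [| split; [apply HU |]].
  - apply stationary_solves. split.
    + eapply solves_ext; [reflexivity | | reflexivity | exact SU]. intros x.
      replace (0 ^ 2) with 0 by ring. rewrite (mu_independent F _ mu HF). reflexivity.
    + apply solves_intro with (fun _ => 0); intros x; [apply der_const |].
      eapply is_derive_eq; [apply der_const | ring].
  - split; apply (is_lim_const 0).
Qed.

Lemma projected_stationary F omega s U0 V1 phi11 phi12 P a mu W V :
  problem_for F omega s U0 V1 phi11 phi12 P -> fundamental_assumption F omega U0 ->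
  projected P a mu W V 0 0 -> stationary_solution F omega s mu (fun x => U0 x + W x) V.
Proof.
  intros HP HU [H1 [H2 _]]. apply stationary_solves.
  rewrite (pf_m1 HP), (pf_NN HP) in H1.
  rewrite (pf_m2 HP), (pf_GG HP) in H2.
  assert (S0 := fundamental_solves HU). split.
  - apply solves_intro with (fun x => Derive U0 x + Derive W x); intros x.
    + apply der_plus; [apply (solves_der S0) | apply (solves_der H1)].
    + eapply is_derive_eq; [apply der_plus; [apply (solves_der2 S0) | apply (solves_der2 H1)] |].
      unfold remU. ring.
  - apply solves_intro with (Derive V); intros x; [apply (solves_der H2) |].
    eapply is_derive_eq; [apply (solves_der2 H2) |]. unfold remV. ring.
Qed.

Lemma stationary_perturbation F omega s U0 V1 phi11 phi12 P mu U V :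
  problem_for F omega s U0 V1 phi11 phi12 P -> fundamental_assumption F omega U0 ->
  stationary_solution F omega s mu U V ->
  solves (m1 P) (fun x => NN P x (U x - U0 x) (V x) mu - 0 * k1 P x) (fun x => U x - U0 x) /\
  solves (m2 P) (fun x => GG P x (U x - U0 x) (V x) mu * V x - 0 * k2 P x) V.
Proof.
  intros HP HU Hst. apply stationary_solves in Hst. destruct Hst as [H1 H2].
  rewrite (pf_m1 HP), (pf_NN HP), (pf_m2 HP), (pf_GG HP).
  assert (S0 := fundamental_solves HU). split.
  - apply solves_intro with (fun x => Derive U x - Derive U0 x); intros x.
    + apply der_minus; [apply (solves_der H1) | apply (solves_der S0)].
    + eapply is_derive_eq; [apply der_minus; [apply (solves_der2 H1) | apply (solves_der2 S0)] |].
      unfold remU. replace (U0 x + (U x - U0 x)) with (U x) by ring. ring.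
  - apply solves_intro with (Derive V); intros x; [apply (solves_der H2) |].
    eapply is_derive_eq; [apply (solves_der2 H2) |]. unfold remV.
    replace (U0 x + (U x - U0 x)) with (U x) by ring. ring.
Qed.

(** * Standing waves *)

Lemma is_derive_C (f g : R -> R) (x a b : R) : is_derive f x a -> is_derive g x b ->
  @is_derive R_AbsRing C_R_NormedModule (fun t => (f t, g t) : C) x ((a, b) : C).
Proof.
  intros Hf Hg.
  assert (H1 := is_derive_scal_l (V := C_R_NormedModule) f x a ((1, 0) : C) Hf).
  assert (H2 := is_derive_scal_l (V := C_R_NormedModule) g x b ((0, 1) : C) Hg).
  assert (H := is_derive_plus (V := C_R_NormedModule) _ _ _ _ _ H1 H2).
  assert (E : forall p q : R, plus (G := C_R_NormedModule) (scal (p : R_AbsRing) ((1, 0) : C)) (scal (q : R_AbsRing) ((0, 1) : C)) = ((p, q) : C)).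
  { intros p q. unfold plus, scal; simpl. unfold prod_plus, prod_scal, plus, scal; simpl. unfold mult; simpl. f_equal; ring. }
  rewrite E in H. apply is_derive_ext with (2 := H). intros t. apply E.
Qed.

Lemma Cmod_standing_wave freq U t x : Cmod (standing_wave freq U t x) ^ 2 = U x ^ 2.
Proof.
  unfold standing_wave, expi. rewrite Cmod_mult, Cmod_R.
  assert (E : Cmod (cos (freq * t), sin (freq * t)) = 1).
  { unfold Cmod. simpl. assert (H := sin2_cos2 (freq * t)). unfold Rsqr in H.
    replace (cos (freq * t) * (cos (freq * t) * 1) + sin (freq * t) * (sin (freq * t) * 1)) with 1 by lra. apply sqrt_1. }
  rewrite E, Rmult_1_l. apply pow2_abs.
Qed.

Lemma stationary_cnls F omega s mu U V : stationary_solution F omega s mu U V ->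
  cnls_solution F mu (standing_wave omega U) (standing_wave s V).
Proof.
  intros H. apply stationary_solves in H. destruct H as [H1 H2].
  assert (Ew : forall freq Z t x, standing_wave freq Z t x = ((cos (freq * t) * Z x, sin (freq * t) * Z x) : C)).
  { intros. unfold standing_wave, expi, RtoC, Cmult; simpl. f_equal; ring. }
  set (wt := fun freq (Z : R -> R) (t x : R) => ((- freq * sin (freq * t) * Z x, freq * cos (freq * t) * Z x) : C)).
  set (wx := fun freq (Z : R -> R) (t x : R) => ((cos (freq * t) * Derive Z x, sin (freq * t) * Derive Z x) : C)).
  (* The second derivative is written through the stationary equation, f being the potential of the
     component. *)
  set (wxx := fun freq (f Z : R -> R) (t x : R) => ((cos (freq * t) * (freq * Z x - f x * Z x), sin (freq * t) * (freq * Z x - f x * Z x)) : C)).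
  assert (Dt : forall freq Z t x, @is_derive R_AbsRing C_R_NormedModule (fun t' => standing_wave freq Z t' x) t (wt freq Z t x)).
  { intros freq Z t x. apply is_derive_ext with (fun t' => ((cos (freq * t') * Z x, sin (freq * t') * Z x) : C)); [intros; symmetry; apply Ew |].
    apply is_derive_C; auto_derive; try exact I; ring. }
  assert (Dx : forall freq Z t x, is_derive Z x (Derive Z x) ->
     @is_derive R_AbsRing C_R_NormedModule (fun x' => standing_wave freq Z t x') x (wx freq Z t x)).
  { intros freq Z t x HZ. apply is_derive_ext with (fun x' => ((cos (freq * t) * Z x', sin (freq * t) * Z x') : C)); [intros; symmetry; apply Ew |].
    apply is_derive_C; der; ring. }
  assert (Dxx : forall freq f Z t x, is_derive (Derive Z) x (freq * Z x - f x * Z x) ->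
     @is_derive R_AbsRing C_R_NormedModule (fun x' => wx freq Z t x') x (wxx freq f Z t x)).
  { intros freq f Z t x HZ. apply is_derive_C; der; ring. }
  exists (wt omega U), (wx omega U), (wxx omega (fun x => D1 F (U x ^ 2) (V x ^ 2) mu) U),
    (wt s V), (wx s V), (wxx s (fun x => D2 F (U x ^ 2) (V x ^ 2) mu) V).
  intros t x. rewrite !Cmod_standing_wave.
  split; [apply Dt |]. split; [apply Dx, (solves_der H1) |].
  split; [apply Dxx, (solves_der2 H1) |].
  split; [apply Dt |]. split; [apply Dx, (solves_der H2) |].
  split; [apply Dxx, (solves_der2 H2) |].
  rewrite !Ew. unfold wt, wxx, RtoC, Ci, Cmult, Cplus; simpl.
  split; f_equal; ring.
Qed.

Lemma bifurcating_pair_side F omega s U0 (side side' : R -> Prop) Ub Vb : (forall mu, side mu <-> side' mu) ->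
  bifurcating_pair F omega s U0 side Ub Vb -> bifurcating_pair F omega s U0 side' Ub Vb.
Proof.
  intros E [[mu0 [H0 H1]] [H2 [r [mu1 [Hr [Hm H3]]]]]]. split; [| split].
  - exists mu0. split; [exact H0 |]. intros mu Hmu Hside. apply H1; [exact Hmu | apply E, Hside].
  - intros e He. destruct (H2 e He) as [d [Hd H]]. exists d. split; [exact Hd |].
    intros mu Hmu Hside. apply H; [exact Hmu | apply E, Hside].
  - exists r, mu1. split; [exact Hr |]. split; [exact Hm |]. intros mu U V Hmu HU Hn C1 C2.
    destruct (H3 mu U V Hmu HU Hn C1 C2) as [Hside H]. split; [apply E, Hside | exact H].
Qed.

(** * Removal of translations and the scale eps *)

(** Landau's inequality, applied to the equation of W, turns uniform closeness of U and U0 into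
    closeness of their derivatives. *)
Lemma perturbation_derivative_small P L : constants P L -> exists C, 0 <= C /\
  forall r mu W V, 0 <= r <= 1 / 3 -> small r mu W V ->
    solves (m1 P) (fun x => NN P x (W x) (V x) mu - 0 * k1 P x) W -> bounded_by (C * r) (Derive W).
Proof.
  intros HL. assert (L1 := L_ge1 HL).
  destruct (crit_bounded (crit1 P)) as [M HM].
  assert (M0 : 0 <= M) by (generalize (HM 0) (Rabs_pos (m1 P 0)); lra).
  exists (2 + (M + 12 * L)). split; [lra |].
  intros r mu W V Hr Hs HW x.
  destruct (small_sized r mu W V ltac:(lra) Hs) as [_ Sz].
  destruct (small_bounds r mu W V ltac:(lra) Hs) as [Bd Bmu].
  destruct Hs as [BW [BV Hmu]].
  replace ((2 + (M + 12 * L)) * r) with (2 * r + (M * r + 12 * L * r)) by ring.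
  apply (derive_bound W (Derive W) (fun x => m1 P x * W x - (NN P x (W x) (V x) mu - 0 * k1 P x))).
  - intros y _. apply (solves_der HW).
  - intros y _. apply (solves_der2 HW).
  - intros y _. apply BW.
  - intros y _. destruct (Bd y) as [Bw Bv]. apply Rabs_minus_le; [apply Rabs_mult_le; [apply HM | apply BW] |].
    rewrite Rmult_0_l, Rminus_0_r.
    assert (R0 : Rabs 0 <= 1) by (rewrite Rabs_R0; lra).
    assert (E := NN_lip P L HL y (W y) (V y) 0 0 mu (3 * r) r Bw Bv R0 R0 Bmu ltac:(lra) (Sz y)
       ltac:(rewrite Rabs_R0; simpl; lra) (BV y) ltac:(rewrite Rabs_R0; lra)).
    rewrite NN_zero, !Rminus_0_r in E. eapply Rle_trans; [exact E |].
    assert (Lr : 0 <= L * r) by (apply Rmult_le_pos; lra).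
    assert (6 * (L * r) * Rabs (V y) <= 6 * (L * r) * 1) by nra.
    assert (6 * (L * r) * Rabs (W y) <= 6 * (L * r) * 1) by nra.
    lra.
Qed.

(* A solution close to U0 has a critical point near 0, because U0' changes sign there. *)
Lemma centering F omega s U0 V1 phi11 phi12 P : problem_for F omega s U0 V1 phi11 phi12 P ->
  of_class_C 3 F -> fundamental_assumption F omega U0 ->
  forall r, 0 < r -> exists r', 0 < r' <= r /\ forall mu U V, Rabs mu <= r' ->
    stationary_solution F omega s mu U V -> bounded_by r' (fun x => U x - U0 x) -> bounded_by r' V ->
    exists tau, Derive U tau = 0 /\ bounded_by r (fun x => U (x + tau) - U0 x).
Proof.
  intros HP HF HU r Hr. destruct (constants_exist P) as [L HL].
  destruct (perturbation_derivative_small P L HL) as [C [HC HD]].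
  destruct (fundamental_derivative_bounded F omega U0 HF HU) as [B HB]. assert (B0 := bounded_by_pos HB).
  assert (S0 := fundamental_solves HU).
  (* A shift by at most d changes U0 by at most B d <= r / 2. *)
  set (d := r / (2 * (B + 1))). assert (Hd : 0 < d) by (apply Rdiv_lt_0_compat; lra).
  assert (Ed : B * d <= r / 2).
  { apply Rmult_le_reg_r with (2 * (B + 1)); [lra |]. unfold d.
    replace (B * (r / (2 * (B + 1))) * (2 * (B + 1))) with (B * r) by (field; lra). nra. }
  assert (HU' := HU). destruct HU' as [_ [_ [_ [_ [_ [He Hneg]]]]]].
  assert (Nd := Hneg d Hd).
  assert (Pd : Derive U0 (- d) = - Derive U0 d).
  { assert (E := Derive_reflect U0 d ltac:(apply S0)). rewrite (Derive_ext _ U0) in E by (intros; apply He). lra. }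
  set (c := - Derive U0 d) in *. assert (Hc : 0 < c) by (unfold c; lra).
  (* The last entry makes the error C r' of the derivative smaller than c = |U0'(d)|, so U' keeps
     the signs of U0' at - d and d. *)
  set (r' := Rmin (Rmin (r / 2) (1 / 3)) (c / (2 * (C + 1)))).
  assert (Hr' : 0 < r' /\ r' <= r / 2 /\ r' <= 1 / 3 /\ r' <= c / (2 * (C + 1))).
  { assert (0 < c / (2 * (C + 1))) by (apply Rdiv_lt_0_compat; lra).
    split; [unfold r'; repeat apply Rmin_glb_lt; lra |]. unfold r'.
    generalize (Rmin_l (Rmin (r / 2) (1 / 3)) (c / (2 * (C + 1)))) (Rmin_r (Rmin (r / 2) (1 / 3)) (c / (2 * (C + 1)))) (Rmin_l (r / 2) (1 / 3)) (Rmin_r (r / 2) (1 / 3)). lra. }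
  destruct Hr' as [P1 [P2 [P3 P4]]].
  assert (Ec : C * r' < c).
  { apply Rle_lt_trans with (C * (c / (2 * (C + 1)))); [apply Rmult_le_compat_l; assumption |].
    apply Rmult_lt_reg_r with (2 * (C + 1)); [lra |]. replace (C * (c / (2 * (C + 1))) * (2 * (C + 1))) with (C * c) by (field; lra). nra. }
  exists r'. split; [lra |]. intros mu U V Hmu Hst BU BV.
  destruct (stationary_perturbation F omega s U0 V1 phi11 phi12 P mu U V HP HU Hst) as [SW _].
  assert (BD := HD r' mu (fun x => U x - U0 x) V ltac:(lra) (conj BU (conj BV Hmu)) SW).
  apply stationary_solves in Hst. destruct Hst as [SU _].
  assert (DW : forall x, Rabs (Derive U x - Derive U0 x) <= C * r').
  { intros x. specialize (BD x). rewrite Derive_minus in BD; [exact BD | apply SU | apply S0]. }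
  assert (D1 := DW d). assert (D2 := DW (- d)). rewrite Pd in D2. apply Rabs_le_between in D1. apply Rabs_le_between in D2.
  unfold c in *.
  destruct (IVT (fun x => - Derive U x) (- d) d) as [z [Hz Ez]]; [| lra | lra | lra |].
  - intros x. apply cont_pt. apply (continuous_opp (Derive U)). apply (solves_cont1 SU).
  - exists z. split; [lra |]. intros x.
    replace (U (x + z) - U0 x) with ((U (x + z) - U0 (x + z)) + (U0 (x + z) - U0 x)) by ring.
    replace r with (r / 2 + r / 2) by field. apply Rabs_plus_le; [eapply Rle_trans; [apply BU | exact P2] |].
    eapply Rle_trans; [apply (lipschitz_of_derive U0 (Derive U0) B x (x + z) (solves_der S0) HB) |].
    replace (x + z - x) with z by ring. eapply Rle_trans; [| exact Ed]. apply Rmult_le_compat_l; [exact B0 |].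
    apply Rabs_le_between; lra.
Qed.

Lemma scale_of_parameter (mb mu e : R) : mb <> 0 -> 0 < e -> 0 < mb * mu -> Rabs mu < Rabs mb * e ^ 2 ->
  exists eps, 0 < eps < e /\ mu = mb * eps ^ 2.
Proof.
  intros Hmb He Hs Hmu.
  assert (Pmb : 0 < Rabs mb) by (apply Rabs_pos_lt; assumption).
  assert (Pmb2 : 0 < mb ^ 2) by nra.
  assert (Pq : 0 < mu / mb).
  { replace (mu / mb) with (mb * mu / mb ^ 2) by (field; assumption). apply Rdiv_lt_0_compat; assumption. }
  assert (Eq : mu / mb = Rabs mu / Rabs mb).
  { unfold Rdiv. rewrite <- Rabs_inv, <- Rabs_mult. symmetry. apply Rabs_pos_eq. left. exact Pq. }
  exists (sqrt (mu / mb)). assert (Pe : 0 < sqrt (mu / mb)) by (apply sqrt_lt_R0; exact Pq).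
  split; [split; [exact Pe |] |].
  - rewrite <- (sqrt_pow2 e) by lra. apply sqrt_lt_1_alt. split; [lra |]. rewrite Eq.
    apply Rmult_lt_reg_r with (Rabs mb); [exact Pmb |]. unfold Rdiv. rewrite Rmult_assoc, Rinv_l by lra. lra.
  - rewrite pow2_sqrt by lra. field. exact Hmb.
Qed.

(** * From the reduced equation to the bifurcating pair *)

Theorem theorem2p2 (omega s : R) (F : R -> R -> R -> R)
    (U0 V1 phi11 phi12 : R -> R)
    (homega : 0 < omega) (hs : 0 < s)
    (hF : nonlinearity_assumption F)
    (hU0 : fundamental_assumption F omega U0)
    (hV1 : kernel_assumption F s U0 V1)
    (hphi : fundamental_pair F omega U0 phi11 phi12)
    (ha2 : a2bar F U0 V1 <> 0)
    (hb2 : b2bar F U0 V1 phi11 phi12 <> 0) :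
  pitchfork_bifurcation F omega s U0 /\
  (a2bar F U0 V1 * b2bar F U0 V1 phi11 phi12 < 0 ->
     supercritical_pitchfork F omega s U0) /\
  (0 < a2bar F U0 V1 * b2bar F U0 V1 phi11 phi12 ->
     subcritical_pitchfork F omega s U0) /\
  let mubar := - b2bar F U0 V1 phi11 phi12 / a2bar F U0 V1 in
  exists Ub Vb : R -> R -> R,
    bifurcating_pair F omega s U0 (fun mu => 0 < mubar * mu) Ub Vb /\
    exists K eps0 : R, 0 < eps0 /\
      forall eps : R, 0 < eps < eps0 ->
        let mu := mubar * eps ^ 2 in
        homoclinic_solution F omega s mu (Ub mu) (Vb mu) /\
        cnls_solution F mu
          (standing_wave omega (Ub mu)) (standing_wave s (Vb mu)) /\
        cnls_solution F mu
          (standing_wave omega (Ub mu)) (standing_wave s (fun x => - Vb mu x)) /\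
        forall x : R,
          Rabs (Ub mu x - (U0 x + eps ^ 2 * U2 F U0 V1 phi11 phi12 x))
            <= K * eps ^ 4 /\
          Rabs (Vb mu x - eps * V1 x) <= K * eps ^ 3.
Proof.
  set (mb := - b2bar F U0 V1 phi11 phi12 / a2bar F U0 V1).
  assert (Hmb : mb <> 0).
  { apply Rmult_integral_contrapositive_currified; [lra | apply Rinv_neq_0_compat; exact ha2]. }
  assert (Main : exists Ub Vb : R -> R -> R,
    bifurcating_pair F omega s U0 (fun mu => 0 < mb * mu) Ub Vb /\
    exists K eps0 : R, 0 < eps0 /\
      forall eps : R, 0 < eps < eps0 ->
        homoclinic_solution F omega s (mb * eps ^ 2) (Ub (mb * eps ^ 2)) (Vb (mb * eps ^ 2)) /\
        cnls_solution F (mb * eps ^ 2)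
          (standing_wave omega (Ub (mb * eps ^ 2))) (standing_wave s (Vb (mb * eps ^ 2))) /\
        cnls_solution F (mb * eps ^ 2)
          (standing_wave omega (Ub (mb * eps ^ 2))) (standing_wave s (fun x => - Vb (mb * eps ^ 2) x)) /\
        forall x : R,
          Rabs (Ub (mb * eps ^ 2) x - (U0 x + eps ^ 2 * U2 F U0 V1 phi11 phi12 x)) <= K * eps ^ 4 /\
          Rabs (Vb (mb * eps ^ 2) x - eps * V1 x) <= K * eps ^ 3).
  { destruct (exists_problem F omega s U0 V1 phi11 phi12 homega hs hF hU0 hV1 hphi) as [P [sg [HP Sy]]].
    assert (Pk1 := pf_k1 HP). assert (Pk2 := pf_k2 HP). assert (PW2 := pf_W2 HP).
    assert (Pa2 := pf_a2 HP). assert (Pb2 := pf_b2 HP).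
    assert (HT := abstract_pitchfork P sg Sy). rewrite Pa2, Pb2 in HT. specialize (HT ha2 hb2). cbv zeta in HT.
    destruct HT as [r [K [Hr [HK [Tz [Tside [Test [Tuniq [eps1 [Heps1 Tex]]]]]]]]]].
    rewrite PW2, Pk2 in Test.
    destruct (constants_exist P) as [L HL]. assert (L1 := L_ge1 HL).
    assert (BW2 : bounded_by L (U2 F U0 V1 phi11 phi12)) by (rewrite <- PW2; intros x; apply (coeff_bounds P L x HL)).
    assert (Bk2 : bounded_by L V1) by (rewrite <- Pk2; apply (L_k2 HL)).
    destruct (homoclinic_of_small F omega s U0 homega hs hF hU0) as [rho [Hrho Hhom]].
    assert (Pmb : 0 < Rabs mb) by (apply Rabs_pos_lt; exact Hmb).
    (* One solution of positive amplitude is chosen for each admissible mu, which selects one of V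
       and - V; for other mu the pair is arbitrary. *)
    assert (Fam : forall mu, exists WV : (R -> R) * (R -> R), 0 < mb * mu -> Rabs mu < Rabs mb * eps1 ^ 2 ->
        exists a, 0 < a /\ projected P a mu (fst WV) (snd WV) 0 0 /\ small r mu (fst WV) (snd WV)).
    { intros mu. destruct (classic (0 < mb * mu /\ Rabs mu < Rabs mb * eps1 ^ 2)) as [[Hs Hm]|Hn].
      - destruct (scale_of_parameter mb mu eps1 Hmb Heps1 Hs Hm) as [eps [He ->]].
        destruct (Tex eps He) as [a [W [V [Ha [HPr Hsm]]]]]. exists (W, V). intros _ _. exists a. auto.
      - exists ((fun _ => 0), (fun _ => 0)). intros Hs Hm. exfalso. apply Hn. auto. }
    pose (WV := fun mu => proj1_sig (constructive_indefinite_description _ (Fam mu))).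
    pose (Wb := fun mu => fst (WV mu)). pose (Vb := fun mu => snd (WV mu)).
    assert (HWV : forall mu, 0 < mb * mu -> Rabs mu < Rabs mb * eps1 ^ 2 ->
        exists a, 0 < a /\ projected P a mu (Wb mu) (Vb mu) 0 0 /\ small r mu (Wb mu) (Vb mu))
      by (intros mu; exact (proj2_sig (constructive_indefinite_description _ (Fam mu)))).
    clearbody Wb Vb. clear WV Fam.
    assert (Scale : forall eps, 0 < eps < eps1 -> 0 < mb * (mb * eps ^ 2) /\ Rabs (mb * eps ^ 2) < Rabs mb * eps1 ^ 2).
    { intros eps He. split.
      - replace (mb * (mb * eps ^ 2)) with (mb ^ 2 * eps ^ 2) by ring.
        apply Rmult_lt_0_compat; [apply pow2_gt_0; exact Hmb | apply pow_lt; lra].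
      - rewrite Rabs_mult, (Rabs_pos_eq (eps ^ 2)) by apply pow2_ge_0. apply Rmult_lt_compat_l; [exact Pmb |].
        replace (eps ^ 2) with (eps * eps) by ring. replace (eps1 ^ 2) with (eps1 * eps1) by ring.
        apply Rmult_le_0_lt_compat; lra. }
    assert (Exp : forall eps, 0 < eps < eps1 ->
        bounded_by (K * eps ^ 4) (fun x => Wb (mb * eps ^ 2) x - eps ^ 2 * U2 F U0 V1 phi11 phi12 x) /\
        bounded_by (K * eps ^ 3) (fun x => Vb (mb * eps ^ 2) x - eps * V1 x)).
    { intros eps He. destruct (Scale eps He) as [S1 S2]. destruct (HWV _ S1 S2) as [a [Ha [HPr Hsm]]].
      exact (Test a eps _ _ ltac:(lra) Ha HPr Hsm). }
    (* For eps <= 1 the expansions bound W, V and mu by (K + L + |mb|) eps. *)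
    assert (Close : forall e, 0 < e -> exists e0, 0 < e0 <= eps1 /\ forall eps, 0 < eps < e0 ->
        bounded_by e (Wb (mb * eps ^ 2)) /\ bounded_by e (Vb (mb * eps ^ 2)) /\ Rabs (mb * eps ^ 2) <= e).
    { intros e He. set (e0 := Rmin (Rmin eps1 1) (e / (K + L + Rabs mb))).
      assert (Q : 0 < e / (K + L + Rabs mb)) by (apply Rdiv_lt_0_compat; lra).
      assert (Q0 : 0 < e0 /\ e0 <= eps1 /\ e0 <= 1 /\ e0 <= e / (K + L + Rabs mb)).
      { split; [unfold e0; repeat apply Rmin_glb_lt; lra |]. unfold e0.
        generalize (Rmin_l (Rmin eps1 1) (e / (K + L + Rabs mb))) (Rmin_r (Rmin eps1 1) (e / (K + L + Rabs mb))) (Rmin_l eps1 1) (Rmin_r eps1 1). lra. }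
      exists e0. split; [lra |]. intros eps Heps.
      assert (X1 : (K + L + Rabs mb) * eps <= e).
      { apply Rle_trans with ((K + L + Rabs mb) * (e / (K + L + Rabs mb))); [apply Rmult_le_compat_l; lra | right; field; lra]. }
      assert (X2 : 0 <= eps ^ 2 <= eps) by nra.
      assert (X3 : 0 <= eps ^ 3 <= eps) by nra.
      assert (P1 : 0 <= Rabs mb * eps) by (apply Rmult_le_pos; lra).
      assert (P2 : 0 <= K * eps) by (apply Rmult_le_pos; lra). assert (P3 : 0 <= L * eps) by (apply Rmult_le_pos; lra).
      destruct (Exp eps ltac:(lra)) as [E1 E2]. split; [| split].
      - intros x. replace (Wb (mb * eps ^ 2) x) with ((Wb (mb * eps ^ 2) x - eps ^ 2 * U2 F U0 V1 phi11 phi12 x) + eps ^ 2 * U2 F U0 V1 phi11 phi12 x) by ring.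
        eapply Rle_trans; [apply Rabs_plus_le; [apply E1 | apply Rabs_mult_le; [rewrite Rabs_pos_eq by apply X2; apply X2 | apply BW2]] |].
        assert (K * eps ^ 4 <= K * eps) by nra. lra.
      - intros x. replace (Vb (mb * eps ^ 2) x) with ((Vb (mb * eps ^ 2) x - eps * V1 x) + eps * V1 x) by ring.
        eapply Rle_trans; [apply Rabs_plus_le; [apply E2 | apply Rabs_mult_le; [rewrite Rabs_pos_eq by lra; apply Rle_refl | apply Bk2]] |].
        assert (K * eps ^ 3 <= K * eps) by nra. lra.
      - rewrite Rabs_mult, (Rabs_pos_eq (eps ^ 2)) by apply X2.
        assert (Rabs mb * eps ^ 2 <= Rabs mb * eps) by nra. lra. }
    set (Ub := fun mu x => U0 x + Wb mu x).
    destruct (Close rho Hrho) as [e2 [He2 Close2]].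
    assert (Sols : forall eps, 0 < eps < e2 ->
        (homoclinic_solution F omega s (mb * eps ^ 2) (Ub (mb * eps ^ 2)) (Vb (mb * eps ^ 2)) /\
         homoclinic_solution F omega s (mb * eps ^ 2) (Ub (mb * eps ^ 2)) (fun x => - Vb (mb * eps ^ 2) x)) /\
        nontrivial (Vb (mb * eps ^ 2))).
    { intros eps He. destruct (Close2 eps He) as [B1 [B2 B3]].
      destruct (Scale eps ltac:(lra)) as [S1 S2]. destruct (HWV _ S1 S2) as [a [Ha [HPr Hsm]]].
      assert (HPo := projected_opp P sg _ _ _ _ _ _ Sy HPr). rewrite Ropp_0 in HPo.
      assert (BU : bounded_by rho (fun x => Ub (mb * eps ^ 2) x - U0 x)).
      { intros x. unfold Ub. replace (U0 x + Wb (mb * eps ^ 2) x - U0 x) with (Wb (mb * eps ^ 2) x) by ring. apply B1. }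
      split; [split |].
      - apply Hhom; try assumption. exact (projected_stationary _ _ _ _ _ _ _ _ _ _ _ _ HP hU0 HPr).
      - apply Hhom; try assumption; [exact (projected_stationary _ _ _ _ _ _ _ _ _ _ _ _ HP hU0 HPo) |].
        intros x. rewrite Rabs_Ropp. apply B2.
      (* A vanishing V would have level 0, whereas the chosen amplitude is positive. *)
      - apply NNPP. intros Hn.
        assert (Z : Vb (mb * eps ^ 2) = fun _ => 0).
        { apply functional_extensionality. intros x. apply NNPP. intros Hx. apply Hn. exists x. exact Hx. }
        destruct HPr as [_ [_ [_ Hl]]]. rewrite Z in Hl. unfold level in Hl. rewrite Derive_const in Hl. lra. }
    exists Ub, Vb. split.
    - split; [| split].
      + exists (Rabs mb * e2 ^ 2). split; [apply Rmult_lt_0_compat; [exact Pmb | apply pow_lt; lra] |].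
        intros mu Hmu Hside. destruct (scale_of_parameter mb mu e2 Hmb ltac:(lra) Hside Hmu) as [eps [He ->]].
        destruct (Sols eps He) as [[A1 A2] A3]. auto.
      + intros e He. destruct (Close e He) as [e3 [He3 Close3]].
        exists (Rabs mb * e3 ^ 2). split; [apply Rmult_lt_0_compat; [exact Pmb | apply pow_lt; lra] |].
        intros mu Hmu Hside. destruct (scale_of_parameter mb mu e3 Hmb ltac:(lra) Hside Hmu) as [eps [Heps ->]].
        destruct (Close3 eps Heps) as [B1 [B2 _]]. split; intros x.
        * unfold Ub. replace (U0 x + Wb (mb * eps ^ 2) x - U0 x) with (Wb (mb * eps ^ 2) x) by ring. apply B1.
        * rewrite Rminus_0_r. apply B2.
      (* Translating by tau makes U' vanish at 0, which is the phase condition; r' is small enough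
         for the translate to stay in the ball of radius r, where uniqueness holds. *)
      + destruct (centering F omega s U0 V1 phi11 phi12 P HP (proj1 hF) hU0 r ltac:(lra)) as [r' [Hr' Hcen]].
        set (mu1 := Rmin r' (Rabs mb * eps1 ^ 2)).
        assert (Hmu1 : 0 < mu1).
        { apply Rmin_glb_lt; [lra |]. apply Rmult_lt_0_compat; [exact Pmb | apply pow_lt; exact Heps1]. }
        exists r', mu1. split; [lra |]. split; [exact Hmu1 |].
        intros mu U V Hmu [Hst _] Hnt CU CV.
        assert (Hm1 : Rabs mu < r') by (eapply Rlt_le_trans; [exact Hmu | apply Rmin_l]).
        assert (Hm2 : Rabs mu < Rabs mb * eps1 ^ 2) by (eapply Rlt_le_trans; [exact Hmu | apply Rmin_r]).
        assert (BV : bounded_by r' V) by (intros x; specialize (CV x); rewrite Rminus_0_r in CV; exact CV).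
        destruct (Hcen mu U V ltac:(lra) Hst CU BV) as [tau [Dtau Btau]].
        assert (Hst' := stationary_shift F omega s mu U V tau Hst).
        destruct (stationary_perturbation F omega s U0 V1 phi11 phi12 P mu _ _ HP hU0 Hst') as [SW SV].
        set (W' := fun x => U (x + tau) - U0 x) in *. set (V' := fun x => V (x + tau)) in *.
        assert (Lv : level (k1 P) W' = 0).
        { destruct hphi as [_ [_ [_ [_ [I0 I1]]]]]. unfold level. rewrite Pk1, I0, I1.
          assert (EU : ex_derive (fun x => U (x + tau)) 0) by (apply stationary_solves in Hst'; apply Hst').
          assert (E0 : ex_derive U0 0) by (apply (fundamental_solves hU0)).
          assert (DU : is_derive (fun x => U (x + tau)) 0 0).
          { apply stationary_solves in Hst. assert (A0 : is_derive U (0 + tau) 0)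
              by (rewrite Rplus_0_l, <- Dtau; apply (solves_der (proj1 Hst))).
            eapply is_derive_eq; [apply (der_comp U (fun t => t + tau)); [exact A0 | der; reflexivity] | ring]. }
          assert (DW : Derive W' 0 = 0).
          { rewrite (Derive_minus (fun x => U (x + tau)) U0) by assumption.
            rewrite (is_derive_unique _ _ _ DU). destruct hU0 as [_ [_ [_ [HD0 _]]]]. rewrite HD0. ring. }
          rewrite DW. field. }
        set (a := level (k2 P) V').
        assert (HPr : projected P a mu W' V' 0 0) by (split; [exact SW | split; [exact SV | split; [exact Lv | reflexivity]]]).
        assert (Hsm : small r mu W' V').
        { split; [exact Btau |]. split; [| lra]. intros x. specialize (BV (x + tau)). unfold V'. lra. }
        assert (Ha : a <> 0).
        { intros E. destruct Hnt as [x Hx]. apply Hx. assert (Z := Tz a mu W' V' 0 0 HPr Hsm E (x - tau)).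
          unfold V' in Z. replace (x - tau + tau) with x in Z by ring. exact Z. }
        assert (Hside := Tside a mu W' V' HPr Hsm Ha). split; [exact Hside |].
        destruct (HWV mu Hside Hm2) as [a' [Ha' [HPr' Hsm']]].
        (* Uniqueness identifies the translate by tau with the branch, so U itself is the branch
           translated back. *)
        exists (- tau).
        (* The branch has positive amplitude; for a negative one, - V is compared with it. *)
        destruct (Rdichotomy _ _ Ha) as [Hneg|Hpos].
        * assert (HPo := projected_opp P sg _ _ _ _ _ _ Sy HPr). rewrite Ropp_0 in HPo.
          assert (Hso : small r mu W' (fun x => - V' x)).
          { destruct Hsm as [A1 [A2 A3]]. split; [exact A1 |]. split; [| exact A3]. intros x. rewrite Rabs_Ropp. apply A2. }
          destruct (Tuniq (- a) a' mu _ _ _ _ ltac:(lra) Ha' HPo HPr' Hso Hsm') as [EW EV].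
          split; [| right]; intros x.
          -- specialize (EW (x + - tau)). unfold W' in EW. unfold Ub.
             replace (x + - tau + tau) with x in EW by ring. lra.
          -- specialize (EV (x + - tau)). unfold V' in EV.
             replace (x + - tau + tau) with x in EV by ring. lra.
        * destruct (Tuniq a a' mu _ _ _ _ Hpos Ha' HPr HPr' Hsm Hsm') as [EW EV].
          split; [| left]; intros x.
          -- specialize (EW (x + - tau)). unfold W' in EW. unfold Ub.
             replace (x + - tau + tau) with x in EW by ring. lra.
          -- specialize (EV (x + - tau)). unfold V' in EV.
             replace (x + - tau + tau) with x in EV by ring. lra.
    - exists K, e2. split; [lra |]. intros eps He.
      destruct (Sols eps He) as [[A1 A2] _]. destruct (Exp eps ltac:(lra)) as [E1 E2].
      split; [exact A1 |]. split; [exact (stationary_cnls _ _ _ _ _ _ (proj1 A1)) |].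
      split; [exact (stationary_cnls _ _ _ _ _ _ (proj1 A2)) |].
      intros x. split; [| apply E2]. specialize (E1 x). unfold Ub.
      replace (U0 x + Wb (mb * eps ^ 2) x - (U0 x + eps ^ 2 * U2 F U0 V1 phi11 phi12 x))
        with (Wb (mb * eps ^ 2) x - eps ^ 2 * U2 F U0 V1 phi11 phi12 x) by ring.
      exact E1. }
  assert (Triv : forall mu, homoclinic_solution F omega s mu U0 (fun _ => 0)) by (intros mu; exact (trivial_homoclinic F omega s U0 mu hF hU0)).
  destruct Main as [Ub [Vb [HBif HExp]]].
  (* The product of the two coefficients has the sign opposite to that of mb, and the sign of mb
     decides which half line of mu satisfies 0 < mb mu. *)
  assert (Eab : a2bar F U0 V1 * b2bar F U0 V1 phi11 phi12 = - mb * a2bar F U0 V1 ^ 2) by (unfold mb; field; exact ha2).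
  assert (Sup : 0 < mb -> supercritical_pitchfork F omega s U0).
  { intros H. split; [exact Triv |]. exists Ub, Vb.
    apply bifurcating_pair_side with (2 := HBif). intros mu. split; intros H'; nra. }
  assert (Sub : mb < 0 -> subcritical_pitchfork F omega s U0).
  { intros H. split; [exact Triv |]. exists Ub, Vb.
    apply bifurcating_pair_side with (2 := HBif). intros mu. split; intros H'; nra. }
  split; [| split; [| split]].
  - destruct (Rdichotomy _ _ Hmb) as [H|H]; [right; exact (Sub H) | left; exact (Sup H)].
  - intros H. apply Sup. nra.
  - intros H. apply Sub. nra.
  - intros mubar. exists Ub, Vb. split; [exact HBif | exact HExp].
Qed.
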